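(* Let $\xi_0,\xi_1,\xi_2,\ldots$ be mutually independent random variables with values in $\mathbb{Z}_{>0}$ such that $\xi_1,\xi_2,\ldots$ have a common distribution. Assume that $\xi_1$ is aperiodic and that $\xi_0,\xi_1\in\mathcal{E}$. Let $\mathcal{P}$ be the point process on $\mathbb{Z}_{>0}$ formed by the delayed renewal process $S_i=\xi_0+\xi_1+\cdots+\xi_i$, $i\ge 0$ (i.e. the law of the random subset $\{S_0,S_1,\ldots\}\subset\mathbb{Z}_{>0}$), and let $\mathcal{P}^{(p,q)}$ be the process $\mathcal{P}$ with Bernoulli noise with arbitrary parameters $p_x,q_x\in[0,1]$, $x\in\mathbb{Z}_{>0}$. For a finite set $\mathfrak{Y}\subset\mathbb{Z}_{>0}$ let $N_{\mathfrak{Y}}$ be the number of points of the random configuration of $\mathcal{P}^{(p,q)}$ that lie in $\mathfrak{Y}$. Then for any sequence $\{\mathfrak{Y}_m\}_{m\ge 1}$ of finite subsets of $\mathbb{Z}_{>0}$ such that $$\lim_{m\to\infty}|\mathfrak{Y}_m|=\infty,\qquad \operatorname{Var}N_{\mathfrak{Y}_m}\ge c_1\cdot|\mathfrak{Y}_m|^{c_2},\quad m\ge 1,$$ for some strictly positive constants $c_1$ and $c_2$, one has for any $x\in\mathbb{R}$ $$\lim_{m\to\infty}\operatorname{Prob}\left\{\frac{N_{\mathfrak{Y}_m}-\mathbb{E}N_{\mathfrak{Y}_m}}{\sqrt{\operatorname{Var}N_{\mathfrak{Y}_m}}}\le x\right\}=\frac{1}{\sqrt{2\pi}}\int_{-\infty}^{x}e^{-t^2/2}\,dt,$$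 where expectation, variance and probability are with respect to $\mathcal{P}^{(p,q)}$.
   Context: Class $\mathcal{E}$: a random variable $\xi$ with values in $\mathbb{Z}_{>0}$ belongs to class $\mathcal{E}$ if there exists a constant $r\in(0,1)$ such that $\operatorname{Prob}\{\xi=n\}\le r^n$ for all large enough $n$. Aperiodic: an integer valued random variable $\xi$ is aperiodic if $\operatorname{Prob}\{\xi\in N\mathbb{Z}\}<1$ for any integer $N\ge 2$. Bernoulli noise: given a random point process $\mathcal{P}$ on a discrete set $\mathfrak{X}$ (a probability measure on $2^{\mathfrak{X}}$) and numbers $0\le p_x\le 1$, $0\le q_x\le 1$, $x\in\mathfrak{X}$, the process $\mathcal{P}^{(p,q)}$ is obtained by transforming the random configuration $X\subset\mathfrak{X}$ as follows: each particle $x\in X$ is removed with probability $p_x$ and remains with probability $1-p_x$; at each empty location $y\in\mathfrak{X}\setminus X$ a new particle appears with probability $q_y$ and the location remains empty with probability $1-q_y$; the operations at different locations are independent. *)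

(* Defs.v *)
From HB Require Import structures.
From mathcomp Require Import all_boot all_order all_algebra.
From mathcomp Require Import finmap.
From mathcomp Require Import all_classical all_reals all_analysis.
From mathcomp Require Import measurable_realfun.

Set Implicit Arguments.
Unset Strict Implicit.
Unset Printing Implicit Defensive.

Import Order.TTheory GRing.Theory Num.Theory.
Import numFieldNormedType.Exports.

Local Open Scope classical_set_scope.
Local Open Scope ring_scope.

Definition posnat : Type := {n : nat | (0 < n)%N}.

Definition mutually_independent d (T : measurableType d) (R : realType)
    (P : probability T R) (I : choiceType) (F : I -> set_system T) : Prop :=
  forall (J : {fset I}) (A : I -> set T), (forall i, i \in J -> F i (A i)) ->
    P (\bigcap_(i in [set` J]) A i) = (\prod_(i <- J) P (A i))%E.

(* [g_sigma_algebra_preimage (X i)] is the sigma-algebra generated by [X i] *)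
Definition mutually_independent_RV d d' (T : measurableType d)
    (T' : measurableType d') (R : realType) (P : probability T R)
    (I : choiceType) (X : I -> {RV P >-> T'}) : Prop :=
  mutually_independent P (fun i => g_sigma_algebra_preimage (X i)).

Definition classE d (T : measurableType d) (R : realType)
    (P : probability T R) (X : {RV P >-> nat}) : Prop :=
  exists r : R, 0 < r < 1 /\
    \forall n \near \oo, (P [set w | X w = n] <= (r ^+ n)%:E)%E.

Definition aperiodic d (T : measurableType d) (R : realType)
    (P : probability T R) (X : {RV P >-> nat}) : Prop :=
  forall N : nat, (2 <= N)%N -> (P [set w | (N %| X w)%N] < 1)%E.

Section configurations.
Variable X : choiceType.

Definition cylinders : set_system (set X) :=
  [set [set Z : set X | Z x] | x in [set: X]].

(* 2^X with the product sigma-algebra; a point process on the discrete set X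
   is a [probability configuration R] *)
Definition configuration : measurableType cylinders.-sigma :=
  g_sigma_algebraType cylinders.

Definition npoints (Y : {fset X}) (Z : configuration) : nat :=
  #|` [fset x in Y | `[< Z x >]]%fset|.

(* [removed x] is the outcome of the removal trial at an occupied location x,
   [born x] the outcome of the creation trial at an empty location x *)
Definition noisy (removed born : X -> bool) (Z : configuration) :
    configuration :=
  [set x | (Z x /\ ~~ removed x) \/ (~ Z x /\ born x)].

(* Q is the law of the configuration obtained from a P-distributed random
   configuration Z by removing each particle x with probability p x and adding
   a particle at each empty location x with probability q x, where Z and all
   the trials are mutually independent. *)
Definition bernoulli_noise (R : realType) (P : probability configuration R)
    (p q : X -> R) (Q : probability configuration R) : Prop :=
  exists (d : measure_display) (T : measurableType d) (mu : probability T R)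
      (Z : {RV mu >-> configuration}) (removed born : X -> {RV mu >-> bool}),
    [/\ forall A, measurable A -> distribution mu Z A = P A,
        forall x, mu [set w | removed x w] = (p x)%:E,
        forall x, mu [set w | born x w] = (q x)%:E,
        mutually_independent mu (fun i : option (X + X) =>
          match i with
          | None => g_sigma_algebra_preimage Z
          | Some (inl x) => g_sigma_algebra_preimage (removed x)
          | Some (inr x) => g_sigma_algebra_preimage (born x)
          end) &
        forall A, measurable A ->
          Q A = mu [set w | A (noisy (removed^~ w) (born^~ w) (Z w))]].

End configurations.

Section renewal.
Context d (T : measurableType d) (R : realType) (P : probability T R).
Variable xi : nat -> {RV P >-> nat}.

Definition partial_sum (i : nat) (w : T) : nat := \sum_(j < i.+1) xi j w.

Definition renewal_config (w : T) : configuration posnat :=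
  [set x | exists i, partial_sum i w = val x].

Lemma measurable_partial_sum i : measurable_fun setT (partial_sum i).
Proof.
elim: i => [|i IH].
  rewrite (_ : partial_sum 0 = xi 0%N); first exact: measurable_funPT.
  by apply/funext => w; rewrite /partial_sum big_ord1.
rewrite (_ : partial_sum i.+1 = fun w => (partial_sum i w + xi i.+1 w)%N).
  by apply: measurable_fun_addn => //; exact: measurable_funPT.
by apply/funext => w; rewrite /partial_sum big_ord_recr.
Qed.

Lemma measurable_renewal_config : measurable_fun setT renewal_config.
Proof.
apply: (@measurability _ _ _ (configuration posnat) _ _ (@cylinders posnat)) => //.
move=> _ [_ [x _ <-] <-].
rewrite setTI (_ : _ @^-1` _ = \bigcup_i (partial_sum i @^-1` [set val x])).
  apply: bigcup_measurable => i _; rewrite -[X in measurable X]setTI.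
  exact: measurable_partial_sum.
by apply/seteqP; split => w /= [i]; [exists i | move=> _; exists i].
Qed.

HB.instance Definition _ :=
  isMeasurableFun.Build _ _ _ _ renewal_config measurable_renewal_config.

Definition renewal_process : probability (configuration posnat) R :=
  distribution P renewal_config.

End renewal.

(* Main.v *)
Require Import Defs.
From HB Require Import structures.
From mathcomp Require Import all_boot all_order all_algebra.
From mathcomp Require Import finmap.
From mathcomp Require Import all_classical all_reals all_analysis.
From mathcomp Require Import measurable_realfun.
From mathcomp Require Import ring lra zify.

Set Implicit Arguments.
Unset Strict Implicit.
Unset Printing Implicit Defensive.

Import Order.TTheory GRing.Theory Num.Theory.
Import numFieldNormedType.Exports.

Local Open Scope classical_set_scope.
Local Open Scope ring_scope.

(* Condition on the renewals one at a time. Given a renewal at s, let h(s) be the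
   mean number of noisy points beyond s and H(s) the corresponding variance; both
   are sums of a bounded weight against the renewal probabilities u_(t-s), so that
   the geometric convergence of u (Harris' theorem for the residual waiting time,
   aperiodicity making u eventually positive) bounds their oscillation across one
   step of length k by a multiple of min(k + 1, rho^-k). A second order Taylor
   expansion then shows that E cos(y + v N) and exp(-v^2 H(s)/2) cos(y + v h(s))
   differ at each step by O(|v|^3 kap) times the step variance, plus |v|^3 rho^kap
   per observed site. Since the step variances add up to O(Var N + 1), taking
   v = theta / sqrt(Var N) and kap = O(|Y|^(c2/4)) makes the total error vanish when
   Var N >= c1 |Y|^c2. Finally, cosine moments determine the limit: the indicator of
   a half-line is sandwiched between polynomials in sin(a z + b), up to a tail
   controlled by Chebyshev's inequality. *)

(** * Renewal sequences *)

(** All expectations of the count are finite sums. No site beyond the last observed one, [L],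
    matters, so steps may be cut at any [K > L] without changing the configuration on [0, L]; the
    price is that every moment bound must be uniform in [K]. Since [p] and [q] are arbitrary and
    [Var N] may be a small power of |Y|, errors cannot simply be charged to sites: short blocks are
    charged to their step variance, and long blocks are paid for by their rarity. The latter takes a
    moment of order rho^(-4k) of the step length k: three factors for the cube of the increment and
    one for the gain rho^kap. The step variances enter [Var N] weighted by the renewal probabilities
    [u], which therefore must be bounded below. This is proved by contradiction: if [u] decayed
    geometrically, the probabilities of the position of the last renewal before n could not add up
    to 1. Cosines of arbitrary phase replace complex exponentials, so that everything stays real and
    centring N is a mere change of phase. *)

Section bernoulli_inequality.
Context {R : realType}.
Implicit Types (x e : R).

Lemma bernoulli_le x n : -1 <= x -> 1 + n%:R * x <= (1 + x) ^+ n.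
Proof.
move=> x1; elim: n => [|n IH]; first by rewrite mul0r addr0 expr0.
rewrite exprS -natr1; apply: le_trans (ler_wpM2l _ IH); last by lra.
have : 0 <= n%:R * (x * x) by rewrite mulr_ge0 ?ler0n// -expr2 sqr_ge0.
by lra.
Qed.

(** Bernoulli's inequality for sqrt x, squared. It also turns the exponential moment of the first
    step into the second moment required of the first block. *)
Lemma sqr_le_exp x : 1 < x -> exists2 D : R, 0 < D & forall k, k.+1%:R ^+ 2 <= D * x ^+ k.
Proof.
move=> x1; pose s := Num.sqrt x; have x0 : 0 < x by exact: lt_trans x1.
have s1 : 1 < s by rewrite -[ltLHS]sqrtr1 ltr_sqrt.
(* The cap at 1 gives (k + 1) e <= 1 + k e. *)
pose e := Num.min (s - 1) 1.
have e0 : 0 < e by rewrite lt_min ltr01 subr_gt0 s1.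
have es : 1 + e <= s by rewrite -lerBrDl ge_min lexx.
have e1 : e <= 1 by rewrite ge_min lexx orbT.
have ske k : k.+1%:R * e <= s ^+ k.
  apply: le_trans (_ : 1 + k%:R * e <= _); first by rewrite -natr1 mulrDl mul1r addrC lerD2r.
  apply: le_trans (bernoulli_le _ _) _; first by lra.
  by rewrite lerXn2r ?nnegrE ?addr_ge0 ?(ltW e0)// (le_trans _ es)// addr_ge0 ?(ltW e0).
exists (e ^+ 2)^-1 => [|k]; first by rewrite invr_gt0 exprn_gt0.
rewrite ler_pdivlMl ?exprn_gt0// mulrC -exprMn.
have -> : x ^+ k = (s ^+ k) ^+ 2 by rewrite -exprM mulnC exprM sqr_sqrtr// ltW.
by rewrite lerXn2r ?nnegrE// ?mulr_ge0 ?ler0n ?exprn_ge0 ?(ltW e0)// ltW// (lt_trans ltr01).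
Qed.

Lemma geometric_times_linear (t A : R) : 0 < t < 1 -> exists n, A * n.+1%:R * t ^+ n < 1.
Proof.
move=> /andP[t0 t1]; have [D D0 HD] := @sqr_le_exp t^-1 ltac:(by rewrite invf_gt1).
have [A0|A0] := leP A 0.
  exists 0%N; rewrite expr0 mulr1 (le_lt_trans _ ltr01)// mulr_le0_ge0//.
(* Quadratic against linear: (n + 1)^2 t^n <= D, so any n with n + 1 > A D will do. *)
exists (Num.truncn (A * D)).
have := truncnS_gt (A * D); set n := Num.truncn _ => An.
have := HD n; rewrite exprVn ler_pdivlMr ?exprn_gt0// => h.
have n0 : 0 < n.+1%:R :> R by rewrite ltr0n.
rewrite -(ltr_pM2r n0) mul1r; apply: le_lt_trans An.
by apply: le_trans (ler_wpM2l (ltW A0) h); rewrite le_eqVlt; apply/orP; left; apply/eqP; ring.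
Qed.

End bernoulli_inequality.

(** The least positive gap [d] between two elements [n] and [n + d] of [A] divides every element,
    hence is 1. With [n] and [n + 1] in [A], write N = q n + r as (q - r) n + r (n + 1), which is
    possible once q >= n > r. *)
Lemma numerical_semigroup (A : pred nat) :
    A 0%N -> (forall a b, A a -> A b -> A (a + b)%N) ->
    (forall N, (2 <= N)%N -> exists2 a, A a & ~~ (N %| a)%N) ->
  exists n0, forall n, (n0 <= n)%N -> A n.
Proof.
move=> A0 Aadd Agcd.
have Amul q a : A a -> A (q * a)%N.
  by move=> Aa; elim: q => [|q IH]; rewrite ?mul0n ?mulSn//; apply: Aadd.
pose gap d := `[< (0 < d)%N /\ exists2 n, A n & A (n + d)%N >].
have gap_ex : exists d, gap d.
  have [//|a Aa a2] := Agcd 2%N; exists a; apply/asboolP; split; last by exists 0%N.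
  by case: a a2 {Aa}.
case: (ex_minnP gap_ex) => d /asboolP[d_gt0 [n An And]] d_min.
have d1 : d = 1%N.
  apply/eqP; apply: contraT => d1.
  have [|a Aa /negP[]] := Agcd d; first by lia.
  rewrite /dvdn; apply: contraT; rewrite -lt0n => r_gt0.
  (* The elements (a / d)(n + d) and (a / d) n + a differ by a mod d, a gap smaller than [d]. *)
  have : gap (a %% d)%N.
    apply/asboolP; split=> //; exists ((a %/ d) * (n + d))%N; first exact: Amul.
    rewrite mulnDr -addnA -divn_eq; apply: Aadd => //; exact: Amul.
  by move/d_min; rewrite leqNgt ltn_pmod.
rewrite d1 in And.
exists (n * n)%N => N nN.
have [n0|n_gt0] := posnP n.
  by rewrite -[N]muln1; apply: Amul; rewrite n0 add0n in And.
have := divn_eq N n; have := ltn_pmod N n_gt0.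
have : (n <= N %/ n)%N by rewrite leq_divRL.
set q := (N %/ n)%N; set r := (N %% n)%N => nq rn ->.
have -> : (q * n + r = (q - r) * n + r * (n + 1))%N.
  by rewrite mulnBl mulnDr muln1 addnA subnK// leq_mul2r (leq_trans (ltnW rn) nq) orbT.
by apply: Aadd; apply: Amul.
Qed.

Section renewal_sequence.
Context {R : realType}.
Implicit Types (f phi psi : nat -> R).

(** The renewal recursion needs all earlier values and is not structural; carrying the list u_n,
    ..., u_0, latest first, makes it so. *)
Fixpoint renewal_seq_rev f n : seq R :=
  if n is n'.+1 then
    (\sum_(k < n'.+1) f k.+1 * (renewal_seq_rev f n')`_k) :: renewal_seq_rev f n'
  else [:: 1].

Definition renewal_seq f n : R := head 0 (renewal_seq_rev f n).

Lemma nth_renewal_seq_rev f n k :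
  (k <= n)%N -> (renewal_seq_rev f n)`_k = renewal_seq f (n - k).
Proof.
elim: n k => [|n IH] [|k]//= kn; by rewrite IH// subSS.
Qed.

Lemma renewal_seq0 f : renewal_seq f 0 = 1.
Proof. by []. Qed.

Lemma renewal_seqS f n :
  renewal_seq f n.+1 = \sum_(k < n.+1) f k.+1 * renewal_seq f (n - k).
Proof.
by apply: eq_bigr => k _; rewrite nth_renewal_seq_rev// -ltnS.
Qed.

(* The law of [min xi K] when [xi] has law [f]. *)
Definition trunc_law f K k : R :=
  if (k < K)%N then f k else if k == K then 1 - \sum_(j < K) f j else 0.

Lemma trunc_law_lt f K k : (k < K)%N -> trunc_law f K k = f k.
Proof. by rewrite /trunc_law => ->. Qed.

Lemma sum_trunc_law f K : \sum_(k < K.+1) trunc_law f K k = 1.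
Proof.
rewrite big_ord_recr/= {2}/trunc_law ltnn eqxx.
by under eq_bigr => k _ do rewrite trunc_law_lt//; rewrite addrC subrK.
Qed.

Lemma trunc_law_ge0 f K k : (forall j, 0 <= f j) ->
  (forall n, \sum_(j < n) f j <= 1) -> 0 <= trunc_law f K k.
Proof.
by move=> f0 f1; rewrite /trunc_law; case: ifP => // _; case: ifP => // _; rewrite subr_ge0.
Qed.

(** The transition operator, acting on functions, of the residual waiting time: it counts down to 0,
    and from 0 a new step [k.+1] leaves [k] to wait. *)
Definition residual_op (g : nat -> R) K phi r : R :=
  if r is r'.+1 then phi r' else \sum_(k < K) g k.+1 * phi k.

Section operator.
Variables (g : nat -> R) (K : nat).
Hypotheses (g_ge0 : forall k, 0 <= g k) (g_sum : \sum_(k < K) g k.+1 = 1).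
Local Notation op := (residual_op g K).

Lemma iter_residualD m phi psi :
  iter m op (fun r => phi r + psi r) = (fun r => iter m op phi r + iter m op psi r).
Proof.
elim: m => [//|m IH]; rewrite !iterS IH; apply/funext => -[|r]//=.
by rewrite -big_split/=; apply: eq_bigr => k _; rewrite mulrDr.
Qed.

Lemma iter_residualZ m (a : R) phi :
  iter m op (fun r => a * phi r) = (fun r => a * iter m op phi r).
Proof.
elim: m => [//|m IH]; rewrite !iterS IH; apply/funext => -[|r]//=.
by rewrite mulr_sumr; apply: eq_bigr => k _; rewrite mulrCA.
Qed.

Lemma iter_residual_cst m (a : R) : iter m op (fun=> a) = (fun=> a).
Proof.
elim: m => [//|m IH]; rewrite !iterS IH; apply/funext => -[|r]//=.
by rewrite -mulr_suml g_sum mul1r.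
Qed.

Lemma iter_residual_le m phi psi : (forall r, phi r <= psi r) ->
  forall r, iter m op phi r <= iter m op psi r.
Proof.
move=> le; elim: m => [//|m IH] [|r]; rewrite !iterS//=.
by apply: ler_sum => k _; apply: ler_wpM2l.
Qed.

End operator.

End renewal_sequence.

Section renewal_rate.
Context {R : realType}.
Implicit Types (f phi psi : nat -> R).

Lemma renewal_seq_ge0 f : (forall k, 0 <= f k) -> forall n, 0 <= renewal_seq f n.
Proof.
move=> f0; elim/ltn_ind => -[|n] IH; first by rewrite renewal_seq0.
rewrite renewal_seqS; apply: sumr_ge0 => k _; apply: mulr_ge0 => //.
by apply: IH; rewrite ltnS leq_subr.
Qed.

Lemma renewal_seq_le1 f : f 0%N = 0 -> (forall k, 0 <= f k) ->
  (forall n, \sum_(j < n) f j <= 1) -> forall n, renewal_seq f n <= 1.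
Proof.
move=> f00 f0 f1; elim/ltn_ind => -[|n] IH; first by rewrite renewal_seq0.
rewrite renewal_seqS; apply: (@le_trans _ _ (\sum_(k < n.+1) f k.+1)).
  apply: ler_sum => k _; rewrite ler_piMr//.
  by apply: IH; rewrite ltnS leq_subr.
by move: (f1 n.+2); rewrite big_ord_recl f00 add0r.
Qed.

(** Renewing at [a] and again [b] later is one way to renew at [a + b]. The induction splits off the
    first step towards [a]. *)
Lemma renewal_seq_supermul f : (forall k, 0 <= f k) -> forall a b,
  renewal_seq f a * renewal_seq f b <= renewal_seq f (a + b).
Proof.
move=> f0; elim/ltn_ind => -[|a] IH b; first by rewrite renewal_seq0 mul1r.
rewrite addSn !renewal_seqS mulr_suml.
have ab : (a.+1 <= (a + b).+1)%N by lia.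
rewrite (big_ord_widen_cond _ xpredT (fun k => f k.+1 * renewal_seq f (a - k) * renewal_seq f b) ab).
rewrite [leRHS](bigID (fun k : 'I_(a + b).+1 => (k < a.+1)%N))/=.
rewrite -[leLHS]addr0; apply: lerD; last first.
  by apply: sumr_ge0 => k _; rewrite mulr_ge0// renewal_seq_ge0.
apply: ler_sum => k ka; rewrite -mulrA ler_wpM2l//.
have -> : (a + b - k = (a - k) + b)%N by lia.
by apply: IH; lia.
Qed.

(** From residual time [r] the chain needs [r] forced moves, then must renew exactly at time [n]. In
    fewer than [K] moves the truncation cannot be seen. *)
Lemma iter_residual_renewal f K : f 0%N = 0 -> forall n r, (n < K)%N ->
  iter n (residual_op (trunc_law f K) K) (fun r => (r == 0%N)%:R) r =
  if (r <= n)%N then renewal_seq f (n - r) else 0.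
Proof.
move=> f00; elim=> [|n IH] [|r] nK; rewrite ?iterS//=.
  rewrite renewal_seqS.
  under eq_bigr => k _ do rewrite IH ?(ltnW nK)//.
  rewrite [RHS](big_ord_widen_cond K xpredT (fun k => f k.+1 * renewal_seq f (n - k)))/=; last by lia.
  rewrite [LHS](bigID (fun k : 'I_K => (k < n.+1)%N))/= [X in _ + X]big1 ?addr0.
    by apply: eq_bigr => k; rewrite ltnS => kn; rewrite kn trunc_law_lt//; lia.
  by move=> k; rewrite ltnS => /negbTE ->; rewrite mulr0.
by rewrite IH ?(ltnW nK)// subSS ltnS.
Qed.

(** The minorization condition of Harris' theorem: [psi] dominates [psi 0] times the indicator of 0,
    whose iterates are renewal probabilities. *)
Lemma iter_residual_ge f K m psi r : f 0%N = 0 -> (forall k, 0 <= f k) ->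
    (forall n, \sum_(j < n) f j <= 1) -> (m < K)%N -> (r <= m)%N ->
    (forall t, 0 <= psi t) ->
  renewal_seq f (m - r) * psi 0%N <= iter m (residual_op (trunc_law f K) K) psi r.
Proof.
move=> f00 f0 f1 mK rm psi0.
have g0 k := trunc_law_ge0 K k f0 f1.
rewrite mulrC.
have -> : renewal_seq f (m - r) = iter m (residual_op (trunc_law f K) K) (fun r => (r == 0%N)%:R) r.
  by rewrite iter_residual_renewal// rm.
have /(congr1 (fun h => h r)) <- := iter_residualZ (trunc_law f K) K m (psi 0%N) (fun r => (r == 0%N)%:R).
by apply: iter_residual_le => // -[|t]; rewrite ?mulr1// mulr0.
Qed.

(** Every [phi r - B r] lies below every [phi s + B s], and the supremum of the former separates the
    two families. A weighted oscillation is thereby a weighted distance to a constant. *)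
Lemma pair_bound_center (B phi : nat -> R) :
  (forall r s, `|phi r - phi s| <= B r + B s) ->
  exists c, forall r, `|phi r - c| <= B r.
Proof.
move=> H; pose S := [set phi r - B r | r in [set: nat]].
have S0 : S !=set0 by exists (phi 0%N - B 0%N); exists 0%N.
have Sub s : ubound S (phi s + B s).
  move=> _ [r _ <-]; have := H r s; rewrite ler_norml => /andP[_].
  lra.
exists (sup S) => r; rewrite ler_distl; apply/andP; split; last first.
  rewrite -lerBlDr; apply: ub_le_sup; first by exists (phi 0%N + B 0%N); exact: Sub.
  by exists r.
by rewrite lerBlDr; apply: ge_sup => //; exact: Sub.
Qed.

(** One move maps x^r below x^-1 x^r + C0; the constant C0 / (1 - x^-1) is the fixed point of the
    resulting affine recursion. *)
Lemma lyapunov_iter (x C0 : R) g K : 1 < x -> 0 <= C0 ->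
    (forall k, 0 <= g k) -> \sum_(k < K) g k.+1 = 1 ->
    \sum_(k < K) g k.+1 * x ^+ k <= C0 ->
  forall m r, iter m (residual_op g K) (fun r => x ^+ r) r <=
    x^-1 ^+ m * x ^+ r + C0 / (1 - x^-1).
Proof.
move=> x1 C00 g0 gs gx.
have x0 : 0 < x by apply: lt_trans x1.
have y1 : x^-1 < 1 by rewrite invf_lt1.
have yp : 0 < 1 - x^-1 by rewrite subr_gt0.
have yi : 0 < x^-1 by rewrite invr_gt0.
set y := x^-1 in y1 yp yi *; set C1 := C0 / (1 - y).
have C1E : y * C1 + C0 = C1 by rewrite /C1; field; rewrite gt_eqF.
have C1_ge0 : 0 <= C1 by rewrite /C1 divr_ge0// ltW.
elim=> [|m IH] r; first by rewrite expr0 mul1r lerDl.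
rewrite iterSr.
have Pv t : residual_op g K (fun r => x ^+ r) t <= y * x ^+ t + C0.
  case: t => [|t]/=; last by rewrite exprS mulrA mulVf ?gt_eqF// mul1r lerDl.
  by apply: le_trans gx _; rewrite expr0 mulr1 lerDr ltW.
apply: le_trans (iter_residual_le K g0 m Pv r) _.
rewrite iter_residualD iter_residualZ iter_residual_cst//.
rewrite -C1E exprS -mulrA addrA lerD2r -mulrDr; apply: ler_wpM2l => //; exact: ltW.
Qed.

End renewal_rate.

(** * Harris' theorem for the residual waiting time *)

Section geometric_ergodicity.
Context {R : realType}.
Variables (f : nat -> R) (x C0 : R).
Hypotheses (f00 : f 0%N = 0) (f_ge0 : forall k, 0 <= f k)
  (f_le1 : forall n, \sum_(j < n) f j <= 1) (x_gt1 : 1 < x) (C0_gt0 : 0 < C0)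
  (f_exp : forall K, \sum_(k < K.+1) trunc_law f K k * x ^+ k <= C0).
Local Notation u := (renewal_seq f).

Let y := x^-1.
Let C1 := C0 / (1 - y).
Let x_gt0 : 0 < x. Proof. exact: lt_trans x_gt1. Qed.
Let y_gt0 : 0 < y. Proof. by rewrite invr_gt0. Qed.
Let y_lt1 : y < 1. Proof. by rewrite invf_lt1. Qed.
Let C1_gt0 : 0 < C1. Proof. by rewrite divr_gt0// subr_gt0. Qed.

Lemma sum_trunc_law_shift K : (0 < K)%N -> \sum_(k < K) trunc_law f K k.+1 = 1.
Proof.
move=> K0; rewrite -[RHS](sum_trunc_law f K) big_ord_recl/=.
by rewrite trunc_law_lt// f00 add0r.
Qed.

Lemma lyapunov_trunc K : (0 < K)%N -> \sum_(k < K) trunc_law f K k.+1 * x ^+ k <= C0.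
Proof.
move=> K0; apply: le_trans (f_exp K); rewrite [leRHS]big_ord_recl/=.
rewrite trunc_law_lt// f00 mul0r add0r; apply: ler_sum => k _.
apply: ler_wpM2l; first exact: trunc_law_ge0.
by rewrite /bump/= add1n exprS ler_peMl ?exprn_ge0 ?ltW.
Qed.

(* The Hairer-Mattingly form of Harris' theorem: the Lyapunov function
   contracts where it is large, the common mass at 0 contracts elsewhere. *)
Lemma harris_contraction m (al : R) (phi : nat -> R) (D : R) K :
    (0 < m)%N -> (m < K)%N -> 0 < al <= 1 -> 0 <= D ->
    (forall r, x ^+ r < 8 * C1 / (1 - y) -> (r <= m)%N /\ al <= u (m - r)) ->
    let be : R := al / (2 * C1) in
    let ka : R := 1 - Num.min (al / 2) ((1 - y) / 2) in
    (forall r s, `|phi r - phi s| <= D * (2 + be * (x ^+ r + x ^+ s))) ->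
  let psi := iter m (residual_op (trunc_law f K) K) phi in
  forall r s, `|psi r - psi s| <= ka * D * (2 + be * (x ^+ r + x ^+ s)).
Proof.
move=> m0 mK al01 D0 small be ka Hphi psi.
have /andP[al0 al1] := al01.
have K0 : (0 < K)%N by apply: ltn_trans mK.
have g0 k := trunc_law_ge0 K k f_ge0 f_le1.
have be0 : 0 < be by rewrite divr_gt0// mulr_gt0.
have [c Hc] : exists c, forall r, `|phi r - c| <= D * (1 + be * x ^+ r).
  by apply: pair_bound_center => r s; apply: le_trans (Hphi r s) _; rewrite -mulrDr; lra.
have V m' := lyapunov_iter x_gt1 (ltW C0_gt0) g0 (sum_trunc_law_shift K0) (lyapunov_trunc K0) m'.
have Vm r : iter m (residual_op (trunc_law f K) K) (fun r => x ^+ r) r <= y * x ^+ r + C1.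
  apply: le_trans (V m r) _; rewrite lerD2r ler_wpM2r ?exprn_ge0 ?(ltW x_gt0)//.
  by rewrite -[leRHS]expr1 ler_wiXn2l// ltW.
set PV := iter m _ (fun r => x ^+ r) in Vm.
(* The iterates of these two nonnegative defects are minorized by their mass at 0. *)
pose up r : R := c * 1 + (D + (D * be) * x ^+ r) + (-1) * phi r.
pose dn r : R := phi r + (D + (D * be) * x ^+ r) + (- c) * 1.
have up0 r : 0 <= up r by have := Hc r; rewrite ler_norml => /andP[_]; rewrite /up; lra.
have dn0 r : 0 <= dn r by have := Hc r; rewrite ler_norml => /andP[]; rewrite /dn; lra.
have upE r : iter m (residual_op (trunc_law f K) K) up r = c + D + D * be * PV r - psi r.
  rewrite /up !(iter_residualD, iter_residualZ) !iter_residual_cst ?sum_trunc_law_shift//.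
  rewrite -/psi -/PV; ring.
have dnE r : iter m (residual_op (trunc_law f K) K) dn r = psi r + D + D * be * PV r - c.
  rewrite /dn !(iter_residualD, iter_residualZ) !iter_residual_cst ?sum_trunc_law_shift//.
  rewrite -/psi -/PV; ring.
have upP r : 0 <= iter m (residual_op (trunc_law f K) K) up r.
  by have := iter_residual_le K g0 m up0 r; rewrite iter_residual_cst// sum_trunc_law_shift.
have dnP r : 0 <= iter m (residual_op (trunc_law f K) K) dn r.
  by have := iter_residual_le K g0 m dn0 r; rewrite iter_residual_cst// sum_trunc_law_shift.
have updn0 : 2 * D <= up 0%N + dn 0%N.
  have : 0 <= D * be by rewrite mulr_ge0// ltW.
  by rewrite /up /dn expr0; lra.
have beC : be * C1 = al / 2 by rewrite /be; field; rewrite gt_eqF.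
have ka1 : 1 - ka <= al / 2 by rewrite /ka opprB addrC subrK ge_min lexx.
have ka2 : 1 - ka <= (1 - y) / 2 by rewrite /ka opprB addrC subrK ge_min lexx orbT.
clearbody ka be.
suff main r s : psi r - psi s <= ka * D * (2 + be * (x ^+ r + x ^+ s)).
  move=> r s; rewrite ler_norml main andbT lerNl opprB.
  by apply: le_trans (main s r) _; rewrite [x ^+ s + _]addrC.
have Xp : 0 < x ^+ r + x ^+ s by rewrite addr_gt0// exprn_gt0.
set X := x ^+ r + x ^+ s in Xp *.
(* [be] is chosen so that the additive part of the drift, 2 [be] [C1], equals [al]. *)
have VX : be * (PV r + PV s) <= be * y * X + al.
  have /(ler_wpM2l (ltW be0)) /le_trans := lerD (Vm r) (Vm s); apply.
  suff -> : be * (y * x ^+ r + C1 + (y * x ^+ s + C1)) = be * y * X + 2 * (be * C1) by rewrite beC; lra.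
  by rewrite /X; ring.
(* Beyond this threshold half of the drift gain, be (1 - y) / 2 X, is at least 4 be C1 = 2 al. That
   covers the additive cost [al] and the loss 2 (1 - ka) <= al on the constant 2. *)
have [XM|XM] := leP (8 * C1 / (1 - y)) X.
  have : psi r - psi s <= D * (2 + be * (PV r + PV s)).
    by have := lerD (upP s) (dnP r) => _; have := lerD (upP r) (dnP s); rewrite upE dnE => _;
       have := upP r; have := dnP s; have := upP s; have := dnP r; rewrite !upE !dnE; lra.
  move=> /le_trans; apply; rewrite (mulrC ka D) -(mulrA D); apply: ler_wpM2l => //.
  have : be * (1 - y) / 2 * X >= 2 * al.
    apply: (@le_trans _ _ (be * (1 - y) / 2 * (8 * C1 / (1 - y)))).
      suff -> : be * (1 - y) / 2 * (8 * C1 / (1 - y)) = 4 * (be * C1).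
        by rewrite beC; lra.
      by field; rewrite subr_eq0 gt_eqF.
    by rewrite ler_wpM2l// divr_ge0// mulr_ge0 ?ltW// subr_gt0.
  move=> XB; have : be * (ka - (1 + y) / 2) * X >= 0.
    rewrite mulr_ge0 ?mulr_ge0 ?(ltW Xp) ?(ltW be0)//; lra.
  by move: XB VX; lra.
have small' t : x ^+ t < 8 * C1 / (1 - y) ->
    al * up 0%N <= iter m (residual_op (trunc_law f K) K) up t /\
    al * dn 0%N <= iter m (residual_op (trunc_law f K) K) dn t.
  move=> /small[tm alu]; split; (apply: le_trans (iter_residual_ge _ _ _ mK tm _) => //);
    by rewrite ler_wpM2r.
have [ur _] : al * up 0%N <= iter m (residual_op (trunc_law f K) K) up r /\
    al * dn 0%N <= iter m (residual_op (trunc_law f K) K) dn r.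
  by apply: small'; apply: le_lt_trans XM; rewrite lerDl exprn_ge0// ltW.
have [_ ds] : al * up 0%N <= iter m (residual_op (trunc_law f K) K) up s /\
    al * dn 0%N <= iter m (residual_op (trunc_law f K) K) dn s.
  by apply: small'; apply: le_lt_trans XM; rewrite lerDr exprn_ge0// ltW.
have [dr us] : al * dn 0%N <= iter m (residual_op (trunc_law f K) K) dn r /\
   al * up 0%N <= iter m (residual_op (trunc_law f K) K) up s.
  split; first by apply: (small' r _).2; apply: le_lt_trans XM; rewrite lerDl exprn_ge0// ltW.
  by apply: (small' s _).1; apply: le_lt_trans XM; rewrite lerDr exprn_ge0// ltW.
(* The masses of the two defects at 0 add up to at least 2 D, so the minorization gains 2 al D,
   twice the additive cost of the drift. *)
have : psi r - psi s <= D * (2 + be * (PV r + PV s) - 2 * al).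
  have : al * (2 * D) <= al * (up 0%N + dn 0%N) by rewrite ler_wpM2l// ltW.
  by move: ur ds; rewrite upE dnE; lra.
move=> /le_trans; apply; rewrite (mulrC ka D) -(mulrA D); apply: ler_wpM2l => //.
have kay : 0 <= ka - y by have := y_lt1; lra.
have : be * (ka - y) * X >= 0 by rewrite !mulr_ge0 ?(ltW Xp) ?(ltW be0).
by move: VX; lra.
Qed.

(** After n + 1 moves the indicator of 0 takes the value u_(n+1) at state 0 and u_n at state 1, so
    the increment of [u] is an oscillation of an iterate. It contracts by the factor [ka] in every
    [m] moves. *)
Lemma renewal_rate : (exists n0, forall n, (n0 <= n)%N -> 0 < u n) ->
  exists C rho, [/\ 0 < C, 0 < rho < 1 & forall n, `|u n.+1 - u n| <= C * rho ^+ n].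
Proof.
move=> [n0 u_gt0].
have [R0 HR0] : exists R0, forall r, x ^+ r < 8 * C1 / (1 - y) -> (r <= R0)%N.
  have B0 : 0 <= 8 * C1 / (1 - y) by apply: divr_ge0; [apply: mulr_ge0 => //; exact: ltW | rewrite subr_ge0 ltW].
  exists (Num.truncn (8 * C1 / (1 - y) / (x - 1))).+1 => r.
  apply: contraTT; rewrite -ltnNge -leNgt => Rr.
  have xm : 0 < x - 1 by rewrite subr_gt0.
  have : 8 * C1 / (1 - y) / (x - 1) <= r%:R.
    by apply: le_trans (ltW (truncnS_gt _)) _; rewrite ler_nat ltnW.
  rewrite ler_pdivrMr// => /le_trans; apply.
  have := @bernoulli_le R (x - 1) r; rewrite [1 + (x - 1)]addrC subrK => H.
  by apply: le_trans (H _); lra.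
(* For [r <= R0] this leaves [m - r > n0], so that [u (m - r)] is positive and the finite minimum
   [al] is too. *)
pose m := (R0 + n0).+1.
pose al : R := \big[Num.min/1]_(r < R0.+1) u (m - r).
have al0 : 0 < al.
  by rewrite /al; elim/big_ind : _ => // [a b a0 b0|r _]; [rewrite lt_min a0|apply: u_gt0; rewrite /m; case: r => /= r; lia].
have al1 : al <= 1 by rewrite /al; elim/big_rec : _ => // r a _ a1; rewrite ge_min a1 orbT.
have small r : x ^+ r < 8 * C1 / (1 - y) -> (r <= m)%N /\ al <= u (m - r).
  move=> /HR0 rR; split; first by rewrite /m; lia.
  by rewrite /al (bigD1 (Ordinal (rR : (r < R0.+1)%N)))//= ge_min lexx.
have m0 : (0 < m)%N by [].
clearbody al m.
pose be : R := al / (2 * C1).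
pose ka : R := 1 - Num.min (al / 2) ((1 - y) / 2).
have be0 : 0 < be by rewrite divr_gt0// mulr_gt0.
have kaL : 1/2 <= ka.
  have : Num.min (al / 2) ((1 - y) / 2) <= 1/2 by rewrite ge_min; apply/orP; left; lra.
  by rewrite /ka; lra.
have ka1 : ka < 1.
  have : 0 < Num.min (al / 2) ((1 - y) / 2) by rewrite lt_min !divr_gt0// subr_gt0.
  by rewrite /ka; lra.
have iterB K j phi : (m < K)%N -> (forall r s, `|phi r - phi s| <= 1) ->
    forall r s, `|iter (j * m) (residual_op (trunc_law f K) K) phi r -
                  iter (j * m) (residual_op (trunc_law f K) K) phi s| <=
       ka ^+ j * (2 + be * (x ^+ r + x ^+ s)).
  move=> mK Hphi; elim: j => [|j IH] r s.
    rewrite mul0n expr0 mul1r/=; apply: le_trans (Hphi r s) _.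
    have : 0 <= be * (x ^+ r + x ^+ s) by rewrite mulr_ge0 ?ltW// addr_gt0// exprn_gt0.
    lra.
  rewrite mulSn iterD exprS; apply: (harris_contraction (al := al)) => //.
  - by rewrite al0.
  - by rewrite exprn_ge0//; lra.
(* By Bernoulli's inequality rho^m >= ka; this stands in for the m-th root of [ka]. *)
pose rho : R := 1 - (1 - ka) / m%:R.
have m1 : 1 <= m%:R :> R by rewrite ler1n.
have rho_le : ka <= rho.
  by rewrite /rho lerBrDl -lerBrDr ler_pdivrMr ?(lt_le_trans _ m1)// ler_peMr// subr_ge0 ltW.
have rho_m : ka <= rho ^+ m.
  apply: le_trans (bernoulli_le _ _); last by move: rho_le; rewrite /rho; lra.
  by rewrite mulrN mulrCA divff ?mulr1 ?gt_eqF ?(lt_le_trans _ m1)//; lra.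
have rho1 : rho < 1 by rewrite /rho ltrBlDr ltrDl divr_gt0 ?subr_gt0// (lt_le_trans _ m1).
(* The numerator is the weight of the pair of states 0 and 1; the division by [ka] pays for rounding
   n + 1 down to a multiple of [m]. *)
exists ((2 + be * (x + 1)) / ka), rho; split.
- apply: divr_gt0; last by lra.
  by apply: addr_gt0 => //; apply: mulr_gt0 => //; apply: addr_gt0.
- by rewrite rho1 andbT; lra.
(* The contraction factor does not depend on [K], so the truncation may be chosen after [n]. *)
move=> n; pose K := (n + m).+2.
have mK : (m < K)%N by rewrite /K ltnS leqW// leq_addl.
have Kn : (n.+1 < K)%N by rewrite /K !ltnS leq_addr.
have Kr : (n.+1 %% m < K)%N by rewrite (leq_ltn_trans (leq_mod _ _) Kn).
clearbody K.
pose phi := iter (n.+1 %% m) (residual_op (trunc_law f K) K) (fun r => (r == 0%N)%:R : R).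
have phi01 r : 0 <= phi r <= 1.
  rewrite /phi (iter_residual_renewal f00 _ Kr).
  by case: ifP => _; rewrite ?lexx ?ler01// renewal_seq_ge0//= renewal_seq_le1.
have phid r s : `|phi r - phi s| <= 1.
  by rewrite ler_norml; have := phi01 r; have := phi01 s; lra.
have := iterB K (n.+1 %/ m)%N phi mK phid 0%N 1%N.
rewrite /phi -iterD -divn_eq !(iter_residual_renewal f00 _ Kn) leq0n ltnS leq0n subn0 subSS subn0.
move=> /le_trans; apply.
rewrite expr1 expr0 (addrC x 1) (mulrC (ka ^+ _)) -(mulrA (2 + _)); apply: ler_wpM2l.
  by apply: addr_ge0 => //; apply: mulr_ge0; rewrite ltW// addr_gt0.
rewrite mulrC ler_pdivlMr; last by lra.
rewrite -exprSr.
apply: le_trans (_ : (rho ^+ m) ^+ (n.+1 %/ m).+1 <= _).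
  by rewrite lerXn2r// nnegrE ?exprn_ge0//; lra.
rewrite -exprM ler_wiXn2l//; try lra.
move: (divn_eq n.+1 m) (ltn_pmod n.+1 m0); rewrite mulnS (mulnC m); clear; lia.
Qed.

End geometric_ergodicity.

Lemma geometric_cauchy {R : realType} (u : nat -> R) (C rho : R) :
    0 < rho < 1 -> (forall n, `|u n.+1 - u n| <= C * rho ^+ n) ->
  forall n j, `|u (n + j)%N - u n| <= C / (1 - rho) * rho ^+ n.
Proof.
move=> /andP[rho0 rho1] Hu n j.
have r1 : 0 < 1 - rho by rewrite subr_gt0.
have C0 : 0 <= C by have := Hu 0%N; rewrite expr0 mulr1; apply: le_trans.
(* The factor 1 - rho^j, the exact partial sum of the geometric series, makes the induction on [j]
   go through. *)
have : `|u (n + j)%N - u n| <= C / (1 - rho) * rho ^+ n * (1 - rho ^+ j).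
  elim: j => [|j IH]; first by rewrite addn0 subrr normr0 expr0 subrr mulr0.
  rewrite -(subrK (u (n + j)%N) (u (n + j.+1)%N)) -addrA.
  apply: le_trans (ler_normD _ _) _; rewrite addnS.
  apply: le_trans (lerD (Hu _) IH) _; rewrite exprD exprS.
  by rewrite le_eqVlt; apply/orP; left; apply/eqP; field; rewrite gt_eqF.
move=> /le_trans; apply; rewrite ler_piMr//.
  by rewrite mulr_ge0 ?exprn_ge0 ?(ltW rho0)// divr_ge0// ltW.
by rewrite lerBlDr lerDl exprn_ge0// ltW.
Qed.

(** When [f] is the law of a step, the summand is the probability that [k] is the last renewal up to
    [n]. *)
Lemma renewal_equation_one {R : realType} (f : nat -> R) n : f 0%N = 0 ->
  \sum_(k < n.+1) renewal_seq f k * (1 - \sum_(j < (n - k).+1) f j) = 1.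
Proof.
move=> f00; elim: n => [|n IH].
  by rewrite !big_ord1 f00 subr0 mulr1 renewal_seq0.
rewrite big_ord_recr/= subnn big_ord1 f00 subr0 mulr1.
have E k : (k < n.+1)%N -> renewal_seq f k * (1 - \sum_(j < (n.+1 - k).+1) f j) =
    renewal_seq f k * (1 - \sum_(j < (n - k).+1) f j) - f (n - k).+1 * renewal_seq f k.
  by move=> kn; rewrite subSn// big_ord_recr/=; ring.
under eq_bigr => k _ do rewrite E//.
rewrite big_split/= IH sumrN -addrA (_ : - _ + _ = 0) ?addr0//.
rewrite renewal_seqS addrC; apply/eqP; rewrite subr_eq0; apply/eqP.
rewrite (reindex_inj rev_ord_inj)/=; apply: eq_bigr => k _.
by rewrite subSS subKn// -ltnS.
Qed.

(** * Renewal probabilities bounded away from zero *)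

Section renewal_lower_bound.
Context {R : realType}.
Variables (f : nat -> R) (x C0 : R).
Hypotheses (f00 : f 0%N = 0) (f_ge0 : forall k, 0 <= f k)
  (f_le1 : forall n, \sum_(j < n) f j <= 1) (x_gt1 : 1 < x) (C0_gt0 : 0 < C0)
  (f_exp : forall K, \sum_(k < K.+1) trunc_law f K k * x ^+ k <= C0).
Local Notation u := (renewal_seq f).

(** Truncation at [n.+1] puts the whole tail into one atom, so the last term of the moment bound is
    already Markov's inequality. *)
Lemma tail_bound n : 1 - \sum_(j < n.+1) f j <= C0 * x^-1 ^+ n.
Proof.
have x0 : 0 < x by exact: lt_trans x_gt1.
rewrite exprVn ler_pdivlMr ?exprn_gt0//.
apply: le_trans (f_exp n.+1); rewrite [leRHS]big_ord_recr/=.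
rewrite (_ : trunc_law f n.+1 n.+1 = 1 - \sum_(j < n.+1) f j); last first.
  by rewrite /trunc_law ltnn eqxx.
apply: le_trans (_ : (1 - \sum_(j < n.+1) f j) * x ^+ n.+1 <= _).
  by rewrite ler_wpM2l ?subr_ge0 ?f_le1// exprS ler_peMl ?exprn_ge0 ?ltW.
rewrite lerDr; apply: sumr_ge0 => k _; apply: mulr_ge0; last by rewrite exprn_ge0 ?ltW.
by rewrite trunc_law_lt.
Qed.

(** If [u N] ever exceeds twice the Cauchy bound at [N], then [u] stays above half of that forever.
    Otherwise [u] decays like rho^k, and with the exponential tails of [f] the sum in
    [renewal_equation_one] is at most a constant times (n + 1) max(rho, 1/x)^n, which drops below
    1. *)
Lemma renewal_lower (C rho : R) : 0 < rho < 1 ->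
    (forall n, `|u n.+1 - u n| <= C * rho ^+ n) ->
  exists2 c, 0 < c & exists n1, forall n, (n1 <= n)%N -> c <= u n.
Proof.
move=> rho01 Hu; have /andP[rho0 rho1] := rho01.
have x0 : 0 < x by exact: lt_trans x_gt1.
have Hc := geometric_cauchy rho01 Hu.
have C_ge0 : 0 <= C by have := Hu 0%N; rewrite expr0 mulr1; apply: le_trans.
pose C' := C / (1 - rho) + 1.
have C'0 : 0 < C' by rewrite ltr_pwDr// divr_ge0// subr_ge0 ltW.
have [[N HN]|Hno] := pselect (exists N, 2 * C' * rho ^+ N < u N).
  exists (C' * rho ^+ N); first by rewrite mulr_gt0// exprn_gt0.
  exists N => n Nn; have := Hc N (n - N)%N; rewrite subnKC// ler_norml => /andP[+ _].
  have : 0 < rho ^+ N by rewrite exprn_gt0.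
  by rewrite /C' in HN *; lra.
have Hle k : u k <= 2 * C' * rho ^+ k.
  by rewrite leNgt; apply/negP => h; apply: Hno; exists k.
pose t := Num.max rho x^-1.
have t01 : 0 < t < 1 by rewrite lt_max rho0/= gt_max rho1 invf_lt1.
have [n Hn] := geometric_times_linear (2 * C' * C0) t01.
exfalso; move: Hn; apply/negP; rewrite -leNgt -[leLHS](renewal_equation_one n f00).
apply: le_trans (_ : \sum_(k < n.+1) 2 * C' * C0 * t ^+ n <= _).
  apply: ler_sum => -[k]/= kn _; rewrite ltnS in kn.
  apply: le_trans (_ : (2 * C' * rho ^+ k) * (C0 * x^-1 ^+ (n - k)) <= _).
    by apply: ler_pM; rewrite ?renewal_seq_ge0 ?subr_ge0 ?f_le1 ?Hle ?tail_bound.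
  rewrite mulrACA ler_wpM2l ?mulr_ge0 ?(ltW C'0) ?(ltW C0_gt0)//.
  rewrite -(subnKC kn) exprD subnKC//; apply: ler_pM; rewrite ?exprn_ge0 ?invr_ge0 ?(ltW rho0) ?(ltW x0)//.
    by rewrite lerXn2r ?nnegrE ?(ltW rho0)// /t ?le_max ?lexx// (ltW rho0).
  by rewrite lerXn2r ?nnegrE ?invr_ge0 ?(ltW x0)// /t le_max ?(ltW rho0) ?lexx ?orbT.
by rewrite sumr_const card_ord -[leLHS]mulr_natr mulrAC.
Qed.

End renewal_lower_bound.

(** * A martingale estimate for the characteristic function *)

Section taylor.
Context {R : realType}.
Implicit Types x a b t : R.

(** The Taylor inequalities for sine and cosine that follow are obtained by integration: the
    derivative of each is an earlier one. *)
Lemma derive_ge0_ge0 (F dF : R -> R) : (forall x, is_derive x 1 F (dF x)) ->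
  0 <= F 0 -> (forall x, 0 <= x -> 0 <= dF x) -> forall x, 0 <= x -> 0 <= F x.
Proof.
move=> HF F0 dF0 x; rewrite le_eqVlt => /predU1P[<-//|x0].
have cF : {within `[0, x], continuous F}.
  by apply: derivable_within_continuous => y _; apply: ex_derive.
have [c /[!in_itv]/= /andP[c0 _] E] := MVT x0 (fun y _ => HF y) cF.
rewrite -(subrK (F 0) (F x)) E addr_ge0// subr0 mulr_ge0 ?dF0// ltW//.
Qed.

Lemma sin_le_id x : 0 <= x -> sin x <= x.
Proof.
move=> x0; rewrite -subr_ge0; move: x x0; apply: (@derive_ge0_ge0 (fun x => x - sin x) (fun x => 1 - cos x)).
- by rewrite /= sin0 subr0.
- by move=> y _; rewrite subr_ge0 cos_le1.
Qed.

Lemma cos_ge_quadratic x : 0 <= cos x - 1 + x ^+ 2 / 2.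
Proof.
wlog x0 : x / 0 <= x => [H|].
  have [/H//|x0] := leP 0 x.
  by rewrite -cosN -sqrrN; apply: H; rewrite oppr_ge0 ltW.
move: x x0; apply: (@derive_ge0_ge0 _ (fun x => x - sin x)).
- by move=> y; apply: is_derive_eq; rewrite /GRing.scale/=; field.
- by rewrite /= cos0 expr0n/= mul0r addr0 subrr.
- by move=> y y0; rewrite subr_ge0 sin_le_id.
Qed.

Lemma sin_ge_cubic x : 0 <= x -> 0 <= sin x - x + x ^+ 3 / 6.
Proof.
move: x; apply: (@derive_ge0_ge0 _ (fun x => cos x - 1 + x ^+ 2 / 2)).
- by move=> y; apply: is_derive_eq; rewrite /GRing.scale/=; field.
- by rewrite /= sin0 expr0n/= mul0r addr0 subrr.
- by move=> y _; exact: cos_ge_quadratic.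
Qed.

Lemma cos_ge_linear x : 0 <= x -> 0 <= x - 1 + cos x.
Proof.
move: x; apply: (@derive_ge0_ge0 _ (fun x => 1 - sin x)).
- by move=> y; apply: is_derive_eq; rewrite /GRing.scale/=; field.
- by rewrite /= cos0 sub0r addNr.
- by move=> y _; rewrite subr_ge0 sin_le1.
Qed.

Lemma sin_ge_quadratic x : 0 <= x -> 0 <= x ^+ 2 / 2 - x + sin x.
Proof.
move: x; apply: (@derive_ge0_ge0 _ (fun x => x - 1 + cos x)).
- by move=> y; apply: is_derive_eq; rewrite /GRing.scale/=; field.
- by rewrite /= sin0 expr0n/= mul0r !addr0 subrr.
- by move=> y y0; exact: cos_ge_linear.
Qed.

Lemma cos_le_cubic x : 0 <= x -> 0 <= x ^+ 3 / 6 - x ^+ 2 / 2 + 1 - cos x.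
Proof.
move: x; apply: (@derive_ge0_ge0 _ (fun x => x ^+ 2 / 2 - x + sin x)).
- by move=> y; apply: is_derive_eq; rewrite /GRing.scale/=; field.
- by rewrite /= cos0 !expr0n/= !mul0r subrr add0r subrr.
- by move=> y y0; exact: sin_ge_quadratic.
Qed.

Lemma norm_sin_le x : `|sin x| <= `|x|.
Proof.
wlog x0 : x / 0 <= x => [H|].
  have [/H//|x0] := leP 0 x.
  by rewrite -normrN -sinN -(normrN x); apply: H; rewrite oppr_ge0 ltW.
rewrite (ger0_norm x0) ler_norml sin_le_id// andbT.
have [x1|x1] := leP x 1; last by apply: le_trans (sin_geN1 x); rewrite lerN2 ltW.
have := sin_ge_quadratic x0; have : x ^+ 2 <= x by rewrite expr2 ler_piMr.
lra.
Qed.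

Lemma norm_sinB_le x : `|sin x - x| <= `|x| ^+ 3 / 6.
Proof.
wlog x0 : x / 0 <= x => [H|].
  have [/H//|x0] := leP 0 x.
  have := H (- x); rewrite sinN normrN -opprD normrN; apply.
  by rewrite oppr_ge0 ltW.
rewrite (ger0_norm x0) ler_norml; have := sin_ge_cubic x0; have := sin_le_id x0.
have : 0 <= x ^+ 3 by rewrite exprn_ge0.
lra.
Qed.

Lemma cos_quadratic_norm x : `|cos x - 1 + x ^+ 2 / 2| <= `|x| ^+ 3 / 6.
Proof.
rewrite ger0_norm ?cos_ge_quadratic//.
wlog x0 : x / 0 <= x => [H|].
  have [/H//|x0] := leP 0 x.
  by rewrite -cosN -normrN -(sqrrN x); apply: H; rewrite oppr_ge0 ltW.
by rewrite (ger0_norm x0); have := cos_le_cubic x0; lra.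
Qed.

Lemma cosB_le x t : `|cos (x + t) - cos x| <= `|t|.
Proof.
have -> : cos (x + t) - cos x = - 2 * sin (x + t / 2) * sin (t / 2).
  have {1}-> : x + t = (x + t / 2) + t / 2 by field.
  have {2}-> : x = (x + t / 2) - t / 2 by ring.
  rewrite cosB cosD; ring.
rewrite !normrM normrN normr_nat.
apply: le_trans (_ : 2 * 1 * `|t / 2| <= _).
  apply: ler_pM => //; [|exact: norm_sin_le].
  by rewrite ler_wpM2l// sin_max.
by rewrite normrM normfV normr_nat; lra.
Qed.

Lemma cos_taylor2 x t :
  `|cos (x + t) - (cos x - t * sin x - t ^+ 2 / 2 * cos x)| <= `|t| ^+ 3.
Proof.
have -> : cos (x + t) - (cos x - t * sin x - t ^+ 2 / 2 * cos x) =
    cos x * (cos t - 1 + t ^+ 2 / 2) - sin x * (sin t - t) by rewrite cosD; ring.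
apply: le_trans (ler_normB _ _) _; rewrite !normrM.
have : `|cos x| * `|cos t - 1 + t ^+ 2 / 2| <= 1 * (`|t| ^+ 3 / 6).
  by apply: ler_pM => //; [exact: cos_max|exact: cos_quadratic_norm].
have : `|sin x| * `|sin t - t| <= 1 * (`|t| ^+ 3 / 6).
  by apply: ler_pM => //; [exact: sin_max|exact: norm_sinB_le].
have : 0 <= `|t| ^+ 3 by rewrite exprn_ge0.
lra.
Qed.

Lemma expRB_lip a b : 0 <= a -> 0 <= b -> `|expR (- a) - expR (- b)| <= `|a - b|.
Proof.
wlog ab : a b / a <= b => [H a0 b0|a0 b0].
  have [ab|/ltW ba] := leP a b; first exact: H.
  by rewrite distrC (distrC a); apply: H.
rewrite ger0_norm; last by rewrite subr_ge0 ler_expR lerN2.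
rewrite ler0_norm ?subr_le0// opprB.
have -> : expR (- b) = expR (- a) * expR (a - b) by rewrite -expRD; congr expR; ring.
have := expR_ge1Dx (a - b).
have e1 : expR (- a) <= 1 by rewrite expR_le1 oppr_le0.
have e0 := expR_ge0 (- a).
move=> h; have : expR (- a) * (1 + (a - b)) <= expR (- a) * expR (a - b) by rewrite ler_wpM2l.
have : expR (- a) * (b - a) <= 1 * (b - a) by rewrite ler_wpM2r// subr_ge0.
lra.
Qed.

(** No smallness of t = b - a is required. For t >= 0 the remainder e^t - 1 - t is at most t^2 e^t,
    and e^(-b) e^t = e^(-a) <= 1; for t < 0 it is at most t^2. *)
Lemma expR_taylor1 a b : 0 <= a -> 0 <= b ->
  `|expR (- a) - expR (- b) * (1 + (b - a))| <= (b - a) ^+ 2.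
Proof.
move=> a0 b0; set t := b - a.
have Ea : expR (- a) = expR (- b) * expR t by rewrite -expRD /t; congr expR; ring.
have eb0 := expR_ge0 (- b).
have eb1 : expR (- b) <= 1 by rewrite expR_le1 oppr_le0.
have ea1 : expR (- a) <= 1 by rewrite expR_le1 oppr_le0.
have t1 := expR_ge1Dx t.
rewrite {1}Ea -mulrBr ger0_norm; last by rewrite mulr_ge0// subr_ge0.
have [t0|t0] := leP 0 t.
  have : expR t - (1 + t) <= t ^+ 2 * expR t.
    have := expR_ge1Dx (- t) => h.
    have : (1 + t) * expR t * (1 - t) <= (1 + t) * expR t * expR (- t).
      by rewrite ler_wpM2l// mulr_ge0 ?expR_ge0// addr_ge0.
    by rewrite -(mulrA _ _ (expR (- t))) expRxMexpNx_1; nra.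
  move=> /(ler_wpM2l eb0)/le_trans; apply.
  by rewrite mulrCA -Ea ler_piMr// sqr_ge0.
apply: le_trans (_ : 1 * t ^+ 2 <= _); last by rewrite mul1r.
apply: ler_pM => //; first by rewrite subr_ge0.
have := expR_ge1Dx (- t) => h.
have et := expR_gt0 t.
have : expR t * (1 - t) <= 1.
  by rewrite -[leRHS](expRxMexpNx_1 t) ler_wpM2l// ltW.
nra.
Qed.

(** Here [b] and [a] are the Gaussian exponents before and after a block and [t] is the scaled
    martingale increment. The exponent is expanded to first order only, since [b - a] is of the size
    of t^2. *)
Lemma expR_cos_taylor a b x t : 0 <= a -> 0 <= b ->
  `|expR (- a) * cos (x + t) -
    expR (- b) * (cos x - t * sin x - t ^+ 2 / 2 * cos x + (b - a) * cos x)| <=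
  `|t| ^+ 3 + `|b - a| * `|t| + (b - a) ^+ 2.
Proof.
move=> a0 b0.
have -> : expR (- a) * cos (x + t) -
    expR (- b) * (cos x - t * sin x - t ^+ 2 / 2 * cos x + (b - a) * cos x) =
  expR (- b) * (cos (x + t) - (cos x - t * sin x - t ^+ 2 / 2 * cos x)) +
  expR (- b) * ((b - a) * (cos (x + t) - cos x)) +
  (expR (- a) - expR (- b) * (1 + (b - a))) * cos (x + t) by ring.
have eb1 : `|expR (- b)| <= 1 by rewrite ger0_norm ?expR_ge0// expR_le1 oppr_le0.
apply: le_trans (ler_normD _ _) _; apply: lerD.
  apply: le_trans (ler_normD _ _) _; apply: lerD; rewrite normrM -[leRHS]mul1r; apply: ler_pM => //.
    exact: cos_taylor2.
  by rewrite normrM ler_wpM2l// cosB_le.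
by rewrite normrM -[leRHS]mulr1; apply: ler_pM => //; [exact: expR_taylor1|exact: cos_max].
Qed.

End taylor.

(** * Expectations over independent Bernoulli trials *)

Section bernoulli_sums.
Context {R : realType}.
Implicit Types (l : seq R) (F G : nat -> R) (x : nat).

(* [bern l F x] is the expectation of [F (x + B)], where [B] is a sum of
   independent Bernoulli variables with parameters [l]. *)
Fixpoint bern l F x : R :=
  if l is p :: l' then (1 - p) * bern l' F x + p * bern l' F x.+1 else F x.

Lemma bern_cat l1 l2 F x : bern (l1 ++ l2) F x = bern l1 (bern l2 F) x.
Proof. by elim: l1 x => [//|p l1 IH] x /=; rewrite !IH. Qed.

Lemma bern_sum l n (a : nat -> R) (G : nat -> nat -> R) x :
  bern l (fun z => \sum_(i < n) a i * G i z) x = \sum_(i < n) a i * bern l (G i) x.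
Proof.
elim: l x => [//|p l IH] x /=; rewrite !IH !mulr_sumr -big_split/=.
by apply: eq_bigr => i _; ring.
Qed.

Lemma bernD l F G x : bern l (fun z => F z + G z) x = bern l F x + bern l G x.
Proof. by elim: l x => [//|p l IH] x /=; rewrite !IH; ring. Qed.

Lemma bernZ l a F x : bern l (fun z => a * F z) x = a * bern l F x.
Proof. by elim: l x => [//|p l IH] x /=; rewrite !IH; ring. Qed.

Lemma bern_cst l a x : bern l (fun=> a) x = a.
Proof. by elim: l x => [//|p l IH] x /=; rewrite !IH; ring. Qed.

Lemma bern_shift l F x : bern l F x = bern l (fun z => F (x + z)%N) 0.
Proof.
elim: l F x => [|p l IH] F x /=; first by rewrite addn0.
congr (_ * _ + _ * _); first exact: IH.
by rewrite IH [RHS]IH; under [in RHS]eq_fun do rewrite add1n addnS -addSn.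
Qed.

Lemma bern_mean l x : bern l (fun z => z%:R) x = x%:R + \sum_(p <- l) p.
Proof.
elim: l x => [|p l IH] x /=; first by rewrite big_nil addr0.
by rewrite !IH big_cons -natr1; ring.
Qed.

(** Trials with parameter 0 never contribute, so it suffices to compare up to the number of nonzero
    parameters. For a block this is at most the number of its observed sites, however long the block
    is. *)
Lemma bern_le l F G x : all (fun p => 0 <= p <= 1) l ->
    (forall z, (x <= z <= x + count (fun p : R => p != 0%R) l)%N -> F z <= G z) ->
  bern l F x <= bern l G x.
Proof.
elim: l x => [|p l IH] x /=; first by move=> _ H; apply: H; rewrite addn0 leqnn.
move=> /andP[/andP[p0 p1] lP] FG; apply: lerD.
  apply: ler_wpM2l; first by rewrite subr_ge0.
  apply: IH => // z zP; apply: FG; lia.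
have [->|p_neq0] := eqVneq p 0; first by rewrite !mul0r.
apply: ler_wpM2l => //; apply: IH => // z zP; apply: FG.
by rewrite p_neq0; lia.
Qed.

Lemma bern_ext l F G x :
    (forall z, (x <= z <= x + size l)%N -> F z = G z) ->
  bern l F x = bern l G x.
Proof.
elim: l x => [|p l IH] x /= FG; first by apply: FG; lia.
by rewrite !(IH _ _) // => z zP; apply: FG; lia.
Qed.

Lemma bern_nseq0 l F x : all (fun p => p == 0) l -> bern l F x = F x.
Proof.
elim: l x => [//|p l IH] x /= /andP[/eqP-> l0].
by rewrite mul0r addr0 subr0 mul1r IH.
Qed.

End bernoulli_sums.

Section block_expectation.
Context {R : realType}.
Implicit Types (T U : nat -> nat -> R).

(* The expectation of [T k z], where [k] is drawn from [g] and then [z] is a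
   sum of independent Bernoulli variables with parameters [pr k]. *)
Definition block_expect K (g : nat -> R) (pr : nat -> seq R) T : R :=
  \sum_(k < K.+1) g k * bern (pr k) (T k) 0.

Variables (K : nat) (g : nat -> R) (pr : nat -> seq R).
Local Notation E := (block_expect K g pr).

Lemma block_expectD T U : E (fun k z => T k z + U k z) = E T + E U.
Proof.
by rewrite -big_split/=; apply: eq_bigr => k _; rewrite bernD mulrDr.
Qed.

Lemma block_expectZ a T : E (fun k z => a * T k z) = a * E T.
Proof.
by rewrite mulr_sumr; apply: eq_bigr => k _; rewrite bernZ mulrCA.
Qed.

Lemma block_expectB T U : E (fun k z => T k z - U k z) = E T - E U.
Proof.
rewrite -[- E U]mulN1r -block_expectZ -block_expectD.
by congr E; apply/funext => k; apply/funext => z; rewrite mulN1r.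
Qed.

Hypotheses (g_ge0 : forall k, 0 <= g k) (g_sum : \sum_(k < K.+1) g k = 1).
Hypothesis pr01 : forall k, all (fun p => 0 <= p <= 1) (pr k).

Lemma block_expect_fst (v : nat -> R) :
  E (fun k _ => v k) = \sum_(k < K.+1) g k * v k.
Proof. by apply: eq_bigr => k _; rewrite bern_cst. Qed.

Lemma block_expect_cst a : E (fun _ _ => a) = a.
Proof. by rewrite block_expect_fst -mulr_suml g_sum mul1r. Qed.

Lemma block_expect_le T U :
    (forall k z, (z <= count (fun p : R => p != 0%R) (pr k))%N -> T k z <= U k z) ->
  E T <= E U.
Proof.
move=> TU; apply: ler_sum => k _; apply: ler_wpM2l => //.
by apply: bern_le => // z /andP[_ zk]; apply: TU.
Qed.

Lemma block_expect_dist T U (B : nat -> nat -> R) :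
    (forall k z, (z <= count (fun p : R => p != 0%R) (pr k))%N ->
      `|T k z - U k z| <= B k z) ->
  `|E T - E U| <= E B.
Proof.
move=> TU; rewrite -block_expectB ler_norml; apply/andP; split.
  rewrite lerNl -mulN1r -block_expectZ; apply: block_expect_le => k z /TU.
  by rewrite mulN1r ler_norml lerNl => /andP[].
by apply: block_expect_le => k z /TU; rewrite ler_norml => /andP[].
Qed.

End block_expectation.

(** * Convolutions with the renewal sequence *)

Section tail_sums.
Context {R : realType}.
Implicit Types (w a u : nat -> R).

Lemma sum_nat_widen_zero w L N s : (L < N)%N -> (forall t, (L < t)%N -> w t = 0) ->
  \sum_(s <= t < L.+1) w t = \sum_(s <= t < N) w t.
Proof.
move=> LN w0; rewrite (big_nat_widen _ _ N)//= big_mkcond/=.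
by apply: eq_bigr => t _; case: ifPn => //; rewrite -leqNgt => /w0 ->.
Qed.

Lemma tail_sum_split w L s k : (forall t, (L < t)%N -> w t = 0) ->
  \sum_(s <= t < L.+1) w t =
  \sum_(s <= t < s + k) w t + \sum_(s + k <= t < L.+1) w t.
Proof.
move=> w0; rewrite !(@sum_nat_widen_zero w L (s + k + L.+1)) ?leq_addl//.
by rewrite -big_cat_nat ?leq_addr.
Qed.

Lemma geometric_sum_le (rho : R) m : 0 < rho < 1 -> \sum_(i < m) rho ^+ i <= (1 - rho)^-1.
Proof.
move=> /andP[r0 r1]; have r1' : 0 < 1 - rho by rewrite subr_gt0.
rewrite -[leRHS]mul1r ler_pdivlMr// mulrC -opprB mulNr -subrX1 opprB.
by rewrite gerBl exprn_ge0// ltW.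
Qed.

(** The truncated subtraction is 0 on the first [k] sites, each of which contributes 1; the others
    form a geometric series. This is the bound linear in [k]; [geometric_trunc_le] gives the
    exponential one. *)
Lemma geometric_trunc_sum_le (rho : R) s k N : 0 < rho < 1 ->
  \sum_(s <= t < N) rho ^+ (t - (s + k)) <= k%:R + (1 - rho)^-1.
Proof.
move=> r01; have /andP[r0 _] := r01.
rewrite -{1}[s]add0n big_addn big_mkord.
under eq_bigr => i _ do rewrite (addnC s k) subnDr.
apply: le_trans (_ : \sum_(i < k + (N - s)) rho ^+ (i - k) <= _).
  rewrite -!(big_mkord xpredT (fun i => rho ^+ (i - k))).
  rewrite [leRHS](@big_cat_nat _ _ _ (N - s)) ?leq_addl//=.
  by rewrite lerDl sumr_ge0// => i _; rewrite exprn_ge0// ltW.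
rewrite big_split_ord/=; apply: lerD.
  rewrite (eq_bigr (fun=> 1)) ?sumr_const ?card_ord// => i _.
  by rewrite (_ : (i - k = 0)%N) ?expr0//; case: i => /= i; lia.
under eq_bigr => i _ do rewrite addKn.
exact: geometric_sum_le.
Qed.

Lemma geometric_trunc_le (rho : R) t s k : 0 < rho < 1 ->
  rho ^+ (t - (s + k)) <= rho^-1 ^+ k * rho ^+ (t - s).
Proof.
move=> /andP[r0 r1]; rewrite exprVn ler_pdivlMl ?exprn_gt0// -exprD.
by rewrite ler_wiXn2l ?ltW//; lia.
Qed.

Definition geometric_tail (rho : R) L w s : R :=
  \sum_(s <= t < L.+1) w t * rho ^+ (t - s).

Lemma geometric_tail_ge0 rho L w s : 0 < rho < 1 -> (forall t, 0 <= w t) ->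
  0 <= geometric_tail rho L w s.
Proof.
by move=> /andP[r0 _] w0; apply: sumr_ge0 => t _; rewrite mulr_ge0// exprn_ge0// ltW.
Qed.

Lemma geometric_tail_le rho L w s M : 0 < rho < 1 ->
  (forall t, w t <= M) -> 0 <= M -> geometric_tail rho L w s <= M / (1 - rho).
Proof.
move=> r01 wM M0; have /andP[r0 _] := r01.
apply: le_trans (_ : \sum_(s <= t < L.+1) M * rho ^+ (t - s) <= _).
  by apply: ler_sum => t _; rewrite ler_wpM2r// exprn_ge0// ltW.
rewrite -mulr_sumr ler_wpM2l//.
by have := geometric_trunc_sum_le s 0 L.+1 r01; rewrite addn0 add0r.
Qed.

Lemma sum_geometric_tail_le rho L w : 0 < rho < 1 -> (forall t, 0 <= w t) ->
  \sum_(0 <= s < L.+1) geometric_tail rho L w s <=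
  (\sum_(0 <= t < L.+1) w t) / (1 - rho).
Proof.
move=> r01 w0; have /andP[r0 _] := r01.
rewrite !big_mkord.
under eq_bigr => s _ do rewrite /geometric_tail big_geq_mkord.
rewrite (exchange_big_dep xpredT)//= mulr_suml; apply: ler_sum => t _.
rewrite -mulr_sumr ler_wpM2l//; apply: le_trans (geometric_sum_le t.+1 r01).
rewrite -(big_mkord (fun s => (s <= t)%N) (fun s => rho ^+ (t - s))).
rewrite (_ : \sum_(0 <= s < L.+1 | (s <= t)%N) _ = \sum_(0 <= s < t.+1) rho ^+ (t - s)); last first.
  by rewrite (big_nat_widen _ t.+1 L.+1)//=.
rewrite big_nat_rev/= add0n big_mkord le_eqVlt; apply/orP; left; apply/eqP.
by apply: eq_bigr => s _; rewrite subSS subKn// -ltnS.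
Qed.

(** With [u] the renewal probabilities, this is the mean of [a] summed over the renewals in [s, L],
    given a renewal at [s]. *)
Definition tail_conv L u a s : R := \sum_(s <= t < L.+1) a t * u (t - s)%N.

Lemma tail_conv_widen L u a s k :
  tail_conv L u a (s + k) = \sum_(s <= t < L.+1 | (s + k <= t)%N) a t * u (t - (s + k))%N.
Proof. by rewrite /tail_conv (big_nat_widenl _ s)//= leq_addr. Qed.

(** Beyond [s + k] the two terms differ by an increment of [u], which is geometrically small. Inside
    the block only the unshifted term is present; there [u <= 1] and the truncated subtraction makes
    the power of [rho] equal to 1. *)
Lemma tail_conv_shift L u a w rho C s k : 0 < rho < 1 -> 0 <= C ->
    (forall n, 0 <= u n <= 1) -> (forall t, `|a t| <= w t) ->
    (forall n j, `|u (n + j)%N - u n| <= C * rho ^+ n) ->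
  `|tail_conv L u a (s + k) - tail_conv L u a s| <=
  (1 + C) * \sum_(s <= t < L.+1) w t * rho ^+ (t - (s + k)).
Proof.
move=> /andP[r0 r1] C0 u01 aw uC; rewrite tail_conv_widen big_mkcond/= -sumrB mulr_sumr.
apply: le_trans (ler_norm_sum _ _ _) _; rewrite big_seq [leRHS]big_seq.
apply: ler_sum => t /[!mem_index_iota]/andP[st _].
have w0 : 0 <= w t by apply: le_trans (aw t).
case: ifPn => skt.
  rewrite -mulrBr normrM mulrCA; apply: ler_pM => //.
  have := uC (t - (s + k))%N k.
  rewrite (_ : (t - (s + k) + k = t - s)%N); last by lia.
  rewrite distrC => /le_trans; apply; rewrite ler_wpM2r ?exprn_ge0 ?(ltW r0)//.
  by rewrite lerDr.
rewrite sub0r normrN normrM (_ : (t - (s + k) = 0)%N); last by lia.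
rewrite expr0 mulr1 mulrC; apply: ler_pM => //.
have /andP[u0 u1] := u01 (t - s)%N; rewrite ger0_norm// (le_trans u1)//.
by rewrite lerDl.
Qed.

Lemma tail_conv_gt L u a s : (L < s)%N -> tail_conv L u a s = 0.
Proof. by move=> Ls; rewrite /tail_conv big_geq. Qed.

(** Conditioning on the first step: the renewals from the next one on carry everything except the
    weight at [s] itself. *)
Lemma tail_conv_rec K L u a (g : nat -> R) s : (L < K)%N -> g 0%N = 0 -> u 0%N = 1 ->
    (forall n, (n < L)%N -> u n.+1 = \sum_(k < n.+1) g k.+1 * u (n - k)%N) ->
    (forall t, (L < t)%N -> a t = 0) ->
  \sum_(k < K.+1) g k * tail_conv L u a (s + k) = tail_conv L u a s - a s.
Proof.
move=> LK g0 u0 uS a0; have [Ls|sL] := ltnP L s.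
  rewrite tail_conv_gt// a0// subrr big1// => k _.
  by rewrite tail_conv_gt ?mulr0// ltn_addr.
(* At [n = 0] only [g 0 = 0] enters the sum, while [u 0 = 1]; this mismatch produces the missing
   [a s]. *)
have uconv n : (n <= L)%N ->
    \sum_(k < K.+1 | (k <= n)%N) g k * u (n - k)%N = if n == 0%N then 0 else u n.
  move=> nL; rewrite -(big_mkord (fun k => (k <= n)%N) (fun k => g k * u (n - k)%N)).
  transitivity (\sum_(0 <= k < n.+1) g k * u (n - k)%N).
    by rewrite [RHS](big_nat_widen _ n.+1 K.+1)//; lia.
  rewrite big_mkord big_ord_recl/= g0 mul0r add0r.
  case: n nL => [|n] nL /=; first by rewrite big_ord0.
  by rewrite uS//; apply: eq_bigr => k _; rewrite /bump/= add1n subSS.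
under eq_bigr => k _ do rewrite tail_conv_widen mulr_sumr.
rewrite (exchange_big_dep xpredT)//=.
transitivity (\sum_(s <= t < L.+1) a t * (if (t - s)%N == 0%N then 0 else u (t - s)%N)).
  rewrite big_seq [RHS]big_seq; apply: eq_bigr => t /[!mem_index_iota]/andP[st tL].
  rewrite -uconv; last by lia.
  rewrite mulr_sumr; apply: eq_big => [k|k kt]; first by apply/idP/idP; lia.
  rewrite mulrCA; congr (_ * (_ * u _)); lia.
rewrite /tail_conv !(@big_ltn _ _ _ s)// subnn eqxx mulr0 add0r u0 mulr1.
rewrite [RHS]addrC addKr big_seq [RHS]big_seq; apply: eq_bigr => t /[!mem_index_iota]/andP[st tL].
by case: ifPn => //; lia.
Qed.

End tail_sums.

Section noisy_renewal.
Context {R : realType}.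
Implicit Types (b c g : nat -> R).

(* Parameters of the sites [s, s + k), when [s] is the only renewal there. *)
Definition site_probs b c s k : seq R :=
  if k is k'.+1 then c s :: [seq b t | t <- iota s.+1 k'] else [::].

Definition empty_probs b k : seq R := [seq b t | t <- iota 0 k].

(* [renewal_expect K g b c n s F x] is the expectation of [F (x + N)], where
   [N] counts the noisy points in the first [n] blocks after a renewal at [s]. *)
Fixpoint renewal_expect K g b c n s (F : nat -> R) : nat -> R :=
  if n is n'.+1 then fun x =>
    \sum_(k < K.+1) g k * bern (site_probs b c s k) (renewal_expect K g b c n' (s + k) F) x
  else F.

Definition delayed_expect K g0 g b c n (F : nat -> R) : R :=
  \sum_(k < K.+1) g0 k * bern (empty_probs b k) (renewal_expect K g b c n k F) 0.

End noisy_renewal.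

(** * Doob decomposition along the renewals *)

Section core.
Context {R : realType}.
(** [b t] and [c t] are the probabilities of a noisy point at [t] when [t] is empty and when it is a
    renewal; [e t] marks the observed sites, all at most [L]. Only [rho], [C1] and [C0] will enter
    the constants of the block estimates, which makes these uniform in the observed set and in
    [K]. *)
Variables (K L : nat) (g u b c : nat -> R) (e : nat -> bool) (rho C1 C0 : R).
Hypotheses (LK : (L < K)%N) (g_ge0 : forall k, 0 <= g k) (g00 : g 0%N = 0)
  (g_sum : \sum_(k < K.+1) g k = 1)
  (u0 : u 0%N = 1) (u01 : forall n, 0 <= u n <= 1)
  (uS : forall n, (n < L)%N -> u n.+1 = \sum_(k < n.+1) g k.+1 * u (n - k)%N)
  (rho01 : 0 < rho < 1) (C1_ge0 : 0 <= C1)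
  (u_cauchy : forall n j, `|u (n + j)%N - u n| <= C1 * rho ^+ n)
  (g_mom : \sum_(k < K.+1) g k * rho^-1 ^+ (4 * k) <= C0)
  (b01 : forall t, 0 <= b t <= 1) (c01 : forall t, 0 <= c t <= 1)
  (be : forall t, ~~ e t -> b t = 0) (ce : forall t, ~~ e t -> c t = 0)
  (eL : forall t, e t -> (t <= L)%N).

Let a t := c t - b t.
Let w t : R := (e t)%:R.
Local Notation conv := (tail_conv L u).
(* Given a renewal at [s], [h s] is the mean and [H s] the variance of the number
   of noisy points from [s] on; [D s k z] is the increment of the Doob martingale
   over a block of length [k] with [z] points, and [v2 s] its variance. *)
Let h s := \sum_(s <= t < L.+1) b t + conv a s.
Let D s k (z : nat) := z%:R + (h (s + k)%N - h s).
Local Notation Ex s := (block_expect K g (site_probs b c s)).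
Let v2 s := Ex s (fun k z => D s k z ^+ 2).
Let H s := conv v2 s.
(** The observed sites of the block, plus the later ones with geometric discount. Up to constants it
    bounds both the points of the block and the shift of [h] across it. *)
Let S s k := \sum_(s <= t < L.+1) w t * rho ^+ (t - (s + k)).
Local Notation eps := (geometric_tail rho L w).
Local Notation G := (geometric_tail rho L v2).
Let ri := rho^-1.
Let q := (1 - rho)^-1.
Let M0 := 2 + C1.
Let Mg := M0 ^+ 2 * C0 * q ^+ 2.

Let r0 : 0 < rho. Proof. by case/andP: rho01. Qed.
Let r1 : rho < 1. Proof. by case/andP: rho01. Qed.
Let ri_ge1 : 1 <= ri. Proof. by rewrite invf_ge1// ltW. Qed.
Let q_gt0 : 0 < q. Proof. by rewrite invr_gt0 subr_gt0. Qed.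
Let q_ge1 : 1 <= q.
Proof. by rewrite invf_ge1 ?subr_gt0// gerBl ltW. Qed.
Let M0_ge1 : 1 <= M0. Proof. by have := C1_ge0; rewrite /M0; lra. Qed.

Let ri_ge0 : 0 <= ri. Proof. exact: le_trans ri_ge1. Qed.
Let q_ge0 : 0 <= q. Proof. exact: ltW. Qed.
Let M0_ge0 : 0 <= M0. Proof. exact: le_trans M0_ge1. Qed.

Let b_gt t : (L < t)%N -> b t = 0.
Proof. by move=> Lt; apply: be; apply/negP => /eL; rewrite leqNgt Lt. Qed.
Let c_gt t : (L < t)%N -> c t = 0.
Proof. by move=> Lt; apply: ce; apply/negP => /eL; rewrite leqNgt Lt. Qed.
Let a_gt t : (L < t)%N -> a t = 0.
Proof. by move=> Lt; rewrite /a b_gt// c_gt// subrr. Qed.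
Let w_gt t : (L < t)%N -> w t = 0.
Proof. by move=> Lt; rewrite /w; case et: (e t) => //; have := eL et; rewrite leqNgt Lt. Qed.
Let w_ge0 t : 0 <= w t. Proof. by rewrite ler0n. Qed.
Let w_le1 t : w t <= 1. Proof. by rewrite /w; case: (e t). Qed.

Let b_le t : b t <= w t.
Proof.
rewrite /w; case: (boolP (e t)) => [_|/be->//]; by case/andP: (b01 t).
Qed.

Let a_le t : `|a t| <= w t.
Proof.
rewrite /w /a; case: (boolP (e t)) => [_|et]; last by rewrite be// ce// subrr normr0.
by have := b01 t; have := c01 t; rewrite ler_norml /= mulr1n; lra.
Qed.

Lemma site_probs01 s k : all (fun p => 0 <= p <= 1) (site_probs b c s k).
Proof.
case: k => [//|k] /=; rewrite c01/=; apply/allP => p /mapP[t _ ->]; exact: b01.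
Qed.

Lemma empty_probs01 k : all (fun p => 0 <= p <= 1) (empty_probs b k).
Proof. by apply/allP => p /mapP[t _ ->]; exact: b01. Qed.

Let count_b s k : (count (fun p : R => p != 0%R) [seq b t | t <- iota s k])%:R <=
  \sum_(s <= t < s + k) w t.
Proof.
elim: k s => [|k IH] s /=; first by rewrite addn0 big_geq.
rewrite big_ltn ?natrD; last by rewrite addnS ltnS leq_addr.
apply: lerD; last by have := IH s.+1; rewrite addSnnS.
rewrite /w; case: (boolP (e s)) => [_|/be->]; last by rewrite eqxx.
by rewrite lern1; case: (_ == _).
Qed.

Let count_site s k : (count (fun p : R => p != 0%R) (site_probs b c s k))%:R <=
  \sum_(s <= t < s + k) w t.
Proof.
case: k => [|k] /=; first by rewrite addn0 big_geq.
rewrite big_ltn ?natrD; last by rewrite addnS ltnS leq_addr.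
apply: lerD; last by have := count_b s.+1 k; rewrite addSnnS.
rewrite /w; case: (boolP (e s)) => [_|/ce->]; last by rewrite eqxx.
by rewrite lern1; case: (_ == _).
Qed.

Let w_block_le s k : \sum_(s <= t < s + k) w t <= S s k.
Proof.
rewrite /S (@tail_sum_split _ (fun t => w t * rho ^+ (t - (s + k))) L s k); last first.
  by move=> t /w_gt ->; rewrite mul0r.
rewrite -[leLHS]addr0; apply: lerD.
  rewrite big_seq [leRHS]big_seq; apply: ler_sum => t /[!mem_index_iota]/andP[_ tk].
  by rewrite (_ : (t - (s + k) = 0)%N) ?expr0 ?mulr1//; apply/eqP; rewrite subn_eq0 ltnW.
by apply: sumr_ge0 => t _; rewrite mulr_ge0 ?exprn_ge0 ?(ltW r0).
Qed.

Let S_linear s k : S s k <= q * k.+1%:R.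
Proof.
apply: le_trans (_ : \sum_(s <= t < L.+1) rho ^+ (t - (s + k)) <= _).
  by apply: ler_sum => t _; rewrite ler_piMl ?w_le1// exprn_ge0// ltW.
apply: le_trans (geometric_trunc_sum_le _ _ _ rho01) _.
rewrite -/q -natr1 mulrDr mulr1 lerD2r ler_peMl//.
Qed.

Let S_exp s k : S s k <= ri ^+ k * eps s.
Proof.
rewrite /S /geometric_tail mulr_sumr; apply: ler_sum => t _.
by rewrite mulrCA ler_wpM2l//; exact: geometric_trunc_le.
Qed.

Let eps_ge0 s : 0 <= eps s. Proof. exact: geometric_tail_ge0. Qed.
Let eps_le s : eps s <= q.
Proof. by rewrite -[q]mul1r; apply: geometric_tail_le. Qed.

Let b_block s k : \sum_(s <= t < s + k) b t =
  \sum_(s <= t < L.+1) b t - \sum_(s + k <= t < L.+1) b t.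
Proof. by rewrite (@tail_sum_split _ b L s k) ?addrK. Qed.

(** In [M0] the share 1 pays for the points of the block against their mean under [b], and 1 + C1
    for the shift of [conv a]. *)
Let D_le s k z : z%:R <= \sum_(s <= t < s + k) w t -> `|D s k z| <= M0 * S s k.
Proof.
move=> zw; have wS := w_block_le s k.
have -> : D s k z = (z%:R - \sum_(s <= t < s + k) b t) + (conv a (s + k) - conv a s).
  by rewrite /D /h b_block; ring.
have -> : M0 * S s k = S s k + (1 + C1) * S s k by rewrite /M0; ring.
apply: le_trans (ler_normD _ _) _; apply: lerD.
  have b_ge0 : 0 <= \sum_(s <= t < s + k) b t by apply: sumr_ge0 => t _; case/andP: (b01 t).
  have b_w : \sum_(s <= t < s + k) b t <= \sum_(s <= t < s + k) w t by apply: ler_sum.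
  by have z0 : 0 <= z%:R :> R by []; rewrite ler_norml; lra.
exact: tail_conv_shift.
Qed.

Let D_site s k z : (z <= count (fun p : R => p != 0%R) (site_probs b c s k))%N ->
  `|D s k z| <= M0 * S s k.
Proof.
by move=> zc; apply: D_le; apply: le_trans (count_site s k); rewrite ler_nat.
Qed.

Let D_exp s k z : (z <= count (fun p : R => p != 0%R) (site_probs b c s k))%N ->
  `|D s k z| <= M0 * eps s * ri ^+ k.
Proof.
move=> /D_site/le_trans; apply; rewrite -mulrA ler_wpM2l ?(le_trans ler01)//.
by rewrite mulrC S_exp.
Qed.

Let ri_mom j : (j <= 4)%N -> \sum_(k < K.+1) g k * ri ^+ (j * k) <= C0.
Proof.
move=> j4; apply: le_trans g_mom; apply: ler_sum => k _; rewrite ler_wpM2l//.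
by rewrite ler_weXn2l// leq_mul2r j4 orbT.
Qed.

Let C0_ge1 : 1 <= C0.
Proof.
rewrite -g_sum; apply: le_trans (ri_mom (leq0n _)); apply: ler_sum => k _.
by rewrite mul0n expr0 mulr1.
Qed.

Let Ex_le1 s (T T' : nat -> nat -> R) :
    (forall k z, (z <= count (fun p : R => p != 0%R) (site_probs b c s k))%N ->
      T k z <= T' k z) ->
  Ex s T <= Ex s T'.
Proof. by apply: block_expect_le => //; exact: site_probs01. Qed.

Let Ex_ri s j A : (j <= 4)%N -> 0 <= A -> Ex s (fun k _ => A * ri ^+ (j * k)) <= A * C0.
Proof.
move=> j4 A0; rewrite block_expectZ ler_wpM2l//.
rewrite (block_expect_fst K g (site_probs b c s) (fun k => ri ^+ (j * k))).
exact: ri_mom.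
Qed.

Let v2_ge0 s : 0 <= v2 s.
Proof.
rewrite -[leLHS](block_expect_cst (site_probs b c s) g_sum); apply: Ex_le1 => k z _.
exact: sqr_ge0.
Qed.

Let v2_le_eps s : v2 s <= M0 ^+ 2 * C0 * eps s ^+ 2.
Proof.
have -> : M0 ^+ 2 * C0 * eps s ^+ 2 = (M0 * eps s) ^+ 2 * C0 by ring.
apply: le_trans (Ex_ri s (isT : (2 <= 4)%N) _); last exact: sqr_ge0.
apply: Ex_le1 => k z /D_exp DM.
rewrite -(real_normK (num_real (D s k z))) (mulnC 2%N k) exprM -exprMn.
by rewrite lerXn2r ?nnegrE//; apply: le_trans DM.
Qed.

Let v2_gt s : (L < s)%N -> v2 s = 0.
Proof.
move=> Ls; apply/eqP; rewrite eq_le v2_ge0 andbT.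
by apply: le_trans (v2_le_eps s) _; rewrite /geometric_tail big_geq// expr0n mulr0.
Qed.

Let v2_le s : v2 s <= Mg.
Proof.
apply: le_trans (v2_le_eps s) _; rewrite ler_wpM2l//.
  by rewrite mulr_ge0 ?sqr_ge0// (le_trans ler01).
by rewrite lerXn2r ?nnegrE ?eps_le ?eps_ge0// (le_trans ler01).
Qed.

Let Mg_ge0 : 0 <= Mg. Proof. exact: le_trans (v2_le 0). Qed.

Let G_ge0 s : 0 <= G s. Proof. exact: geometric_tail_ge0. Qed.
Let G_le s : G s <= Mg * q. Proof. exact: geometric_tail_le. Qed.

Let H_ge0 s : 0 <= H s.
Proof. by apply: sumr_ge0 => t _; rewrite mulr_ge0//; case/andP: (u01 (t - s)). Qed.

Let H_shift s k : `|H (s + k) - H s| <= M0 * \sum_(s <= t < L.+1) v2 t * rho ^+ (t - (s + k)).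
Proof.
apply: le_trans (tail_conv_shift L s k rho01 C1_ge0 u01 (w := v2) _ u_cauchy) _.
  by move=> t; rewrite ger0_norm.
rewrite ler_wpM2r//; last by rewrite /M0; lra.
by apply: sumr_ge0 => t _; rewrite mulr_ge0 ?exprn_ge0 ?(ltW r0).
Qed.

Let H_exp s k : `|H (s + k) - H s| <= M0 * G s * ri ^+ k.
Proof.
apply: le_trans (H_shift s k) _; rewrite -mulrA ler_wpM2l ?(le_trans ler01)//.
rewrite mulrC /geometric_tail mulr_sumr; apply: ler_sum => t _.
by rewrite mulrCA ler_wpM2l//; exact: geometric_trunc_le.
Qed.

Let H_linear s k : `|H (s + k) - H s| <= M0 * Mg * q * k.+1%:R.
Proof.
apply: le_trans (H_shift s k) _; rewrite -(mulrA _ q) -(mulrA M0) ler_wpM2l ?(le_trans ler01)//.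
apply: le_trans (_ : \sum_(s <= t < L.+1) Mg * rho ^+ (t - (s + k)) <= _).
  by apply: ler_sum => t _; rewrite ler_wpM2r ?v2_le// exprn_ge0// ltW.
rewrite -mulr_sumr ler_wpM2l//; apply: le_trans (geometric_trunc_sum_le _ _ _ rho01) _.
by rewrite -/q -natr1 mulrDr mulr1 lerD2r ler_peMl.
Qed.

Let h_gt s : (L < s)%N -> h s = 0.
Proof. by move=> Ls; rewrite /h tail_conv_gt// big_geq// addr0. Qed.

Let H_gt s : (L < s)%N -> H s = 0.
Proof. by move=> Ls; rewrite /H tail_conv_gt. Qed.

(** The first site of a block is the renewal, with parameter [c s] in place of [b s]; the difference
    [a s] is exactly what [tail_conv_rec] takes away. *)
Let D_mean s : Ex s (D s) = 0.
Proof.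
have E k : (k < K.+1)%N -> g k * bern (site_probs b c s k) (D s k) 0 =
    g k * (a s + \sum_(s <= t < L.+1) b t - h s) + g k * conv a (s + k).
  move=> _; rewrite /D bernD bern_mean bern_cst add0r -mulrDr.
  case: k => [|k]; first by rewrite g00 !mul0r.
  congr (_ * _); rewrite /= big_cons big_map.
  have -> : \sum_(t <- iota s.+1 k) b t = \sum_(s <= t < s + k.+1) b t - b s.
    rewrite [in RHS]big_ltn; last by rewrite addnS ltnS leq_addr.
    by rewrite addrC addKr /index_iota addnS subSS addKn.
  by rewrite b_block /h /a; ring.
rewrite /block_expect; under eq_bigr => k _ do rewrite E//.
rewrite big_split/= (tail_conv_rec s LK g00 u0 uS a_gt) -mulr_suml g_sum /h; ring.
Qed.

Let H_mean s : Ex s (fun k _ => H s - H (s + k)) = v2 s.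
Proof.
rewrite block_expect_fst; under eq_bigr => k _ do rewrite mulrBr.
rewrite sumrB -mulr_suml g_sum (tail_conv_rec s LK g00 u0 uS v2_gt) /H; ring.
Qed.

Section characteristic_function.
Variables (v : R) (kap : nat).

(* The value of [E cos (y + v N)] for [N] normal with mean [h s] and variance [H s]. *)
Let U s y := expR (- (v ^+ 2 / 2 * H s)) * cos (y + v * h s).

(** The first line is the third moment of the increment. The second collects the two terms with the
    shift of [H]; where this shift is squared, one factor [G] has been replaced by its bound
    [Mg * q]. *)
Let err s := `|v| ^+ 3 * (M0 * q * kap.+1%:R * v2 s + M0 ^+ 3 * q ^+ 2 * C0 * rho ^+ kap * eps s)
  + (`|v| ^+ 3 * (M0 ^+ 2 * C0 * q) + v ^+ 4 * (M0 ^+ 2 * C0 * Mg * q)) * G s.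

(* Blocks of length at most [kap] are controlled by [v2], longer ones are
   exponentially rare. *)
Let D3_le s : Ex s (fun k z => `|D s k z| ^+ 3) <=
  M0 * q * kap.+1%:R * v2 s + M0 ^+ 3 * q ^+ 2 * C0 * rho ^+ kap * eps s.
Proof.
pose A := M0 ^+ 3 * q ^+ 2 * rho ^+ kap * eps s.
have A0 : 0 <= A.
  by apply: mulr_ge0 => //; apply: mulr_ge0; [apply: mulr_ge0|]; rewrite exprn_ge0// ltW.
have -> : M0 ^+ 3 * q ^+ 2 * C0 * rho ^+ kap * eps s = A * C0 by rewrite /A; ring.
apply: le_trans (lerD (lexx _) (Ex_ri s (leqnn 4) A0)).
rewrite -block_expectZ -block_expectD; apply: Ex_le1 => k z zk.
have Dn : `|D s k z| ^+ 3 = `|D s k z| * D s k z ^+ 2.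
  by rewrite exprS real_normK ?num_real.
have [kk|kk] := leqP k kap.
  rewrite -[leLHS]addr0; apply: lerD; last by apply: mulr_ge0 => //; exact: exprn_ge0.
  rewrite Dn; apply: ler_wpM2r; first exact: sqr_ge0.
  apply: le_trans (D_site zk) _.
  rewrite -(mulrA M0); apply: ler_wpM2l => //; apply: le_trans (S_linear s k) _.
  by apply: ler_wpM2l => //; rewrite ler_nat.
rewrite -[leLHS]add0r; apply: lerD.
  by apply: mulr_ge0; [apply: mulr_ge0 => //; exact: mulr_ge0|exact: sqr_ge0].
apply: le_trans (_ : (M0 * eps s * ri ^+ k) ^+ 3 <= _).
  by rewrite lerXn2r ?nnegrE ?(D_exp zk)// (le_trans _ (D_exp zk)).
have -> : (M0 * eps s * ri ^+ k) ^+ 3 = M0 ^+ 3 * eps s ^+ 2 * eps s * ri ^+ (3 * k).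
  by rewrite !exprMn -exprM (mulnC k 3%N); ring.
have -> : A * ri ^+ (4 * k) = M0 ^+ 3 * q ^+ 2 * eps s * (rho ^+ kap * ri ^+ (4 * k)).
  by rewrite /A; ring.
apply: ler_pM.
- by apply: mulr_ge0 => //; apply: mulr_ge0; rewrite ?exprn_ge0.
- exact: exprn_ge0.
- apply: ler_wpM2r => //; apply: ler_wpM2l; first exact: exprn_ge0.
  by rewrite lerXn2r ?nnegrE.
(* The fourth factor [ri ^+ k] is spare: on blocks longer than [kap] it is at least rho^(-kap),
   which cancels the gain rho^kap. *)
- have -> : (4 * k = k + 3 * k)%N by rewrite -mulSn.
rewrite exprD mulrA; apply: ler_peMl; first exact: exprn_ge0.
rewrite /ri exprVn ler_pdivlMr ?exprn_gt0// mul1r ler_wiXn2l ?(ltW r0) ?(ltW r1) ?(ltnW kk)//.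
Qed.

Let step_err s y : `|Ex s (fun k z => U (s + k) (y + v * z%:R)) - U s y| <= err s.
Proof.
set X := y + v * h s; set B := expR (- (v ^+ 2 / 2 * H s)).
have v0 : 0 <= v ^+ 2 / 2 by rewrite divr_ge0// sqr_ge0.
(* In the mean the term linear in [D] vanishes by [D_mean], and the two terms with v^2 / 2 cancel,
   because [D ^+ 2] and [H s - H (s + k)] both have mean [v2 s]. *)
pose main k z := B * cos X + - (B * v * sin X) * D s k z +
  - (B * v ^+ 2 / 2 * cos X) * D s k z ^+ 2 +
  (B * cos X * (v ^+ 2 / 2)) * (H s - H (s + k)).
have mainE : Ex s main = U s y.
  rewrite /main !block_expectD !block_expectZ D_mean -/(v2 s) H_mean.
  by rewrite block_expect_cst// /U -/X -/B; field.
rewrite -mainE.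
pose bd k z := `|v| ^+ 3 * `|D s k z| ^+ 3 +
  (`|v| ^+ 3 * (M0 ^+ 2 * q * G s) + v ^+ 4 * (M0 ^+ 2 * (Mg * q) * G s)) * ri ^+ (2 * k).
apply: le_trans (_ : Ex s bd <= _).
  apply: block_expect_dist => // [|k z zk]; first exact: site_probs01.
  rewrite /U; have -> : y + v * z%:R + v * h (s + k) = X + v * D s k z.
    by rewrite /X /D; ring.
  set ak := v ^+ 2 / 2 * H (s + k); set bk := v ^+ 2 / 2 * H s.
  have ak0 : 0 <= ak by rewrite mulr_ge0.
  have bk0 : 0 <= bk by rewrite mulr_ge0.
  have := expR_cos_taylor X (v * D s k z) ak0 bk0.
  have -> : expR (- bk) * (cos X - v * D s k z * sin X - (v * D s k z) ^+ 2 / 2 * cos X + (bk - ak) * cos X) = main k z.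
    rewrite /main /B -/bk (_ : bk - ak = v ^+ 2 / 2 * (H s - H (s + k))); last by rewrite /bk /ak; ring.
    by field.
  move=> /le_trans; apply.
  have dH := H_exp s k; have dD := D_exp zk.
  have bka : `|bk - ak| <= v ^+ 2 / 2 * (M0 * G s * ri ^+ k).
    rewrite /bk /ak -mulrBr normrM (ger0_norm v0) ler_wpM2l//.
    by rewrite distrC.
  have rk0 : 0 <= ri ^+ k by rewrite exprn_ge0.
  have vn0 : 0 <= `|v| by [].
  have v2E : v ^+ 2 = `|v| ^+ 2 by rewrite real_normK ?num_real.
  rewrite /bd normrM exprMn -addrA lerD2l mulrDl; apply: lerD.
    apply: le_trans (_ : (v ^+ 2 / 2 * (M0 * G s * ri ^+ k)) * (`|v| * (M0 * q * ri ^+ k)) <= _).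
      apply: ler_pM; [exact: normr_ge0|by apply: mulr_ge0|exact: bka|].
      rewrite ler_wpM2l//; apply: le_trans dD _; rewrite ler_wpM2r// ler_wpM2l//.
    rewrite v2E (mulnC 2%N k) exprM.
    have -> : `|v| ^+ 2 / 2 * (M0 * G s * ri ^+ k) * (`|v| * (M0 * q * ri ^+ k)) =
      (`|v| ^+ 3 * (M0 ^+ 2 * q * G s) * (ri ^+ k) ^+ 2) / 2 by field.
    rewrite ler_pdivrMr// ler_peMr ?ler1n// !mulr_ge0 ?exprn_ge0 ?(ltW q_gt0)//.
  rewrite -(real_normK (num_real (bk - ak))).
  apply: le_trans (_ : (v ^+ 2 / 2 * (M0 * G s * ri ^+ k)) ^+ 2 <= _).
    by rewrite lerXn2r ?nnegrE//; apply: le_trans bka.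
  rewrite (mulnC 2%N k) exprM.
  have -> : (v ^+ 2 / 2 * (M0 * G s * ri ^+ k)) ^+ 2 =
     (v ^+ 4 * (M0 ^+ 2 * G s * G s) * (ri ^+ k) ^+ 2) / 4 by field.
  rewrite ler_pdivrMr//.
  apply: le_trans (_ : (v ^+ 4 * (M0 ^+ 2 * (Mg * q) * G s)) * (ri ^+ k) ^+ 2 <= _).
    rewrite ler_wpM2r ?sqr_ge0// ler_wpM2l ?exprn_even_ge0// ler_wpM2r//.
    by rewrite ler_wpM2l ?sqr_ge0.
  rewrite ler_peMr ?ler1n// mulr_ge0 ?sqr_ge0// mulr_ge0 ?exprn_even_ge0//.
  by apply: mulr_ge0 => //; apply: mulr_ge0; [exact: sqr_ge0|exact: mulr_ge0].
rewrite /bd block_expectD block_expectZ; apply: lerD.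
  by rewrite ler_wpM2l ?exprn_ge0// D3_le.
apply: le_trans (Ex_ri s (isT : (2 <= 4)%N) _) _.
  apply: addr_ge0; apply: mulr_ge0; [exact: exprn_ge0| |exact: exprn_even_ge0|].
    by apply: mulr_ge0 => //; apply: mulr_ge0; [exact: sqr_ge0|].
  by apply: mulr_ge0 => //; apply: mulr_ge0; [exact: sqr_ge0|exact: mulr_ge0].
rewrite le_eqVlt; apply/orP; left; apply/eqP; ring.
Qed.

Let err_ge0 s : 0 <= err s.
Proof. exact: le_trans (step_err s 0). Qed.

(** Blocks have length at least 1, so [n] of them lead beyond [L], where [h] and [H] vanish and [U]
    is the cosine itself. Renewals strictly increase, hence each site is charged with its error at
    most once. *)
Let renewal_expect_cos n s x be' : (L < s + n)%N ->
  `|renewal_expect K g b c n s (fun z => cos (be' + v * z%:R)) x - U s (be' + v * x%:R)| <=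
  \sum_(s <= t < L.+1) err t.
Proof.
elim: n s x => [|n IH] s x; rewrite ?addn0 => Ls.
  rewrite /= /U h_gt// H_gt// !mulr0 oppr0 expR0 mul1r addr0 subrr normr0.
  by apply: sumr_ge0.
set F := (fun z => cos (be' + v * z%:R)).
have gK : \sum_(0 <= k < K.+1) g k = 1 by rewrite big_mkord.
have step := step_err s (be' + v * x%:R).
have -> : renewal_expect K g b c n.+1 s F x =
    Ex s (fun k z => renewal_expect K g b c n (s + k) F (x + z)%N).
  by rewrite /=; apply: eq_bigr => k _; rewrite bern_shift.
rewrite -(subrKA (Ex s (fun k z => U (s + k) (be' + v * x%:R + v * z%:R)))).
apply: le_trans (ler_normD _ _) _.
have [Ls'|sL] := ltnP L s.
  rewrite [leRHS]big_geq//.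
  have Z1 : Ex s (fun k z => renewal_expect K g b c n (s + k) F (x + z)%N) =
     Ex s (fun k z => U (s + k) (be' + v * x%:R + v * z%:R)).
    apply/eqP; rewrite -subr_eq0 -normr_le0.
    rewrite -[leRHS](block_expect_cst (site_probs b c s) g_sum).
    apply: block_expect_dist => // [|k z _]; first exact: site_probs01.
    have := IH (s + k)%N (x + z)%N; rewrite big_geq; last by rewrite (leq_trans Ls')// leq_addr.
    by rewrite natrD mulrDr addrA; apply; rewrite (leq_trans Ls')// -addnA leq_addr.
  rewrite Z1 subrr normr0 add0r; apply: le_trans step _.
  by rewrite /err v2_gt// /geometric_tail !big_geq// !(mulr0, addr0).
rewrite [leRHS]big_ltn// addrC; apply: lerD => //.
rewrite -[leRHS](block_expect_cst (site_probs b c s) g_sum).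
(* Blocks of length 0 have weight [g 0 = 0]. Discarding them lets the induction hypothesis apply and
   keeps [err s] from being charged twice. *)
have Esplit (T T' : nat -> nat -> R) B : 0 <= B ->
    (forall k z, (0 < k)%N -> `|T k z - T' k z| <= B) -> `|Ex s T - Ex s T'| <= Ex s (fun _ _ => B).
  move=> B0 TB.
  have E0 V : Ex s V = Ex s (fun k z => if k == 0%N then 0 else V k z).
    by apply: eq_bigr => -[[|k]//= _] _; rewrite g00 !mul0r.
  rewrite (E0 T) (E0 T'); apply: block_expect_dist => // [|k z _]; first exact: site_probs01.
  by case: k => [|k] /=; [rewrite subrr normr0|exact: TB].
apply: Esplit; first exact: sumr_ge0.
move=> k z k0; rewrite -addrA -mulrDr -natrD.
apply: le_trans (IH _ _ _) _; first by move: Ls k0; clear; lia.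
have -> : \sum_(s.+1 <= t < L.+1) err t = \sum_(s.+1 <= t < (L + k).+1 | (t < L.+1)%N) err t.
  by rewrite (big_nat_widen _ _ (L + k).+1)// ltnS leq_addr.
rewrite (big_nat_widen _ L.+1 (L + k).+1)/=; last by rewrite ltnS leq_addr.
rewrite (big_nat_widenl _ s.+1)/=; last by move: k0; clear; lia.
rewrite big_mkcond [leRHS]big_mkcond; apply: ler_sum => t _.
by case: (t < L.+1)%N; case: (s + k <= t)%N => /=.
Qed.

Let sum_err_le : \sum_(0 <= t < L.+1) err t <=
  M0 ^+ 3 * C0 * q ^+ 3 * (1 + Mg) *
  (`|v| ^+ 3 * (kap.+2%:R * (\sum_(0 <= t < L.+1) v2 t) +
                rho ^+ kap * (\sum_(0 <= t < L.+1) w t)) +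
   v ^+ 4 * (\sum_(0 <= t < L.+1) v2 t)).
Proof.
have C00 : 0 <= C0 by apply: le_trans C0_ge1.
have q0 := ltW q_gt0.
set Ga := \sum_(0 <= t < L.+1) v2 t; set n := \sum_(0 <= t < L.+1) w t.
have Ga0 : 0 <= Ga by apply: sumr_ge0.
have n0 : 0 <= n by apply: sumr_ge0.
have SG : \sum_(0 <= s < L.+1) G s <= q * Ga.
  by rewrite mulrC; apply: sum_geometric_tail_le.
have Se : \sum_(0 <= s < L.+1) eps s <= q * n.
  by rewrite mulrC; apply: sum_geometric_tail_le.
rewrite /err big_split/= -!mulr_sumr big_split/= -!mulr_sumr.
have v3 : 0 <= `|v| ^+ 3 by rewrite exprn_ge0.
have v4 : 0 <= v ^+ 4 by rewrite exprn_even_ge0.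
set M := _ * _ * _ * (1 + Mg).
have MM A : A <= M0 ^+ 3 * C0 * q ^+ 3 -> A <= M.
  by move=> /le_trans; apply; rewrite /M ler_peMr ?lerDl// !mulr_ge0 ?exprn_ge0.
have le1 : M0 * q <= M.
  apply: MM; have -> : M0 ^+ 3 * C0 * q ^+ 3 = M0 * q * (M0 ^+ 2 * C0 * q ^+ 2) by ring.
  by rewrite ler_peMr ?mulr_ge0// !mulr_ege1 ?exprn_ege1.
have le2 : M0 ^+ 3 * q ^+ 2 * C0 * q <= M by apply: MM; rewrite le_eqVlt; apply/orP; left; apply/eqP; ring.
have le3 : M0 ^+ 2 * C0 * q * q <= M.
  apply: MM; have -> : M0 ^+ 3 * C0 * q ^+ 3 = M0 ^+ 2 * C0 * q * q * (M0 * q) by ring.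
  by rewrite ler_peMr ?mulr_ge0 ?sqr_ge0// !mulr_ege1.
have le4 : M0 ^+ 2 * C0 * Mg * q * q <= M.
  have -> : M0 ^+ 2 * C0 * Mg * q * q = M0 ^+ 2 * C0 * q ^+ 2 * Mg by ring.
  rewrite /M; apply: ler_pM => //; rewrite ?mulr_ge0 ?sqr_ge0//; last by rewrite lerDr.
  have -> : M0 ^+ 3 * C0 * q ^+ 3 = M0 ^+ 2 * C0 * q ^+ 2 * (M0 * q) by ring.
  by rewrite ler_peMr ?mulr_ge0 ?sqr_ge0// !mulr_ege1.
have rk0 : 0 <= rho ^+ kap by rewrite exprn_ge0// ltW.
have T1 : M0 * q * kap.+1%:R * Ga <= M * (kap.+1%:R * Ga).
  by rewrite -mulrA ler_wpM2r// mulr_ge0.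
have T2 : M0 ^+ 3 * q ^+ 2 * C0 * rho ^+ kap * (\sum_(0 <= i < L.+1) eps i) <= M * (rho ^+ kap * n).
  apply: le_trans (_ : M0 ^+ 3 * q ^+ 2 * C0 * rho ^+ kap * (q * n) <= _).
    by rewrite ler_wpM2l// !mulr_ge0 ?exprn_ge0 ?(ltW r0).
  have -> : M0 ^+ 3 * q ^+ 2 * C0 * rho ^+ kap * (q * n) = (M0 ^+ 3 * q ^+ 2 * C0 * q) * (rho ^+ kap * n) by ring.
  by rewrite ler_wpM2r// mulr_ge0.
have T3 : M0 ^+ 2 * C0 * q * (\sum_(0 <= i < L.+1) G i) <= M * Ga.
  apply: le_trans (_ : M0 ^+ 2 * C0 * q * (q * Ga) <= _).
    by rewrite ler_wpM2l// !mulr_ge0 ?exprn_ge0.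
  by rewrite mulrA ler_wpM2r.
have T4 : M0 ^+ 2 * C0 * Mg * q * (\sum_(0 <= i < L.+1) G i) <= M * Ga.
  apply: le_trans (_ : M0 ^+ 2 * C0 * Mg * q * (q * Ga) <= _).
    apply: ler_wpM2l => //; apply: mulr_ge0 => //; apply: mulr_ge0 => //.
    by apply: mulr_ge0 => //; exact: sqr_ge0.
  by rewrite mulrA ler_wpM2r.
have T12 := ler_wpM2l v3 (lerD T1 T2); have T3' := ler_wpM2l v3 T3; have T4' := ler_wpM2l v4 T4.
have -> : kap.+2%:R * Ga = kap.+1%:R * Ga + 1 * Ga by rewrite -mulrDl natr1.
have -> : M * (`|v| ^+ 3 * (kap.+1%:R * Ga + 1 * Ga + rho ^+ kap * n) + v ^+ 4 * Ga) =
  `|v| ^+ 3 * (M * (kap.+1%:R * Ga) + M * (rho ^+ kap * n)) +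
  (`|v| ^+ 3 * (M * Ga) + v ^+ 4 * (M * Ga)) by rewrite mul1r; ring.
apply: lerD => //.
have -> : (`|v| ^+ 3 * (M0 ^+ 2 * C0 * q) + v ^+ 4 * (M0 ^+ 2 * C0 * Mg * q)) * (\sum_(0 <= i < L.+1) G i) =
   `|v| ^+ 3 * (M0 ^+ 2 * C0 * q * (\sum_(0 <= i < L.+1) G i)) +
   v ^+ 4 * (M0 ^+ 2 * C0 * Mg * q * (\sum_(0 <= i < L.+1) G i)) by ring.
exact: lerD.
Qed.

Lemma renewal_expect_cos_sum n s x be' : (L < s + n)%N ->
  `|renewal_expect K g b c n s (fun z => cos (be' + v * z%:R)) x - U s (be' + v * x%:R)| <=
  M0 ^+ 3 * C0 * q ^+ 3 * (1 + Mg) *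
  (`|v| ^+ 3 * (kap.+2%:R * (\sum_(0 <= t < L.+1) v2 t) +
                rho ^+ kap * (\sum_(0 <= t < L.+1) w t)) +
   v ^+ 4 * (\sum_(0 <= t < L.+1) v2 t)).
Proof.
move=> Ls; apply: le_trans sum_err_le; apply: le_trans (renewal_expect_cos x be' Ls) _.
rewrite (big_nat_widenl _ 0%N)//= big_mkcond/=; apply: ler_sum => t _.
by case: ifP.
Qed.

End characteristic_function.

Let renewal_expectS n s F x : renewal_expect K g b c n.+1 s F x =
  Ex s (fun k z => renewal_expect K g b c n (s + k) F (x + z)%N).
Proof. by apply: eq_bigr => k _; rewrite bern_shift. Qed.

Let Ex_eq s (T T' : nat -> nat -> R) :
  (forall k z, (0 < k)%N -> T k z = T' k z) -> Ex s T = Ex s T'.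
Proof.
move=> TT'; apply: eq_bigr => -[[|k] kK] _; first by rewrite g00 !mul0r.
by congr (_ * bern _ _ _); apply/funext => z; apply: TT'.
Qed.

Lemma renewal_expect_mean n s x : (L < s + n)%N ->
  renewal_expect K g b c n s (fun z => z%:R) x = x%:R + h s.
Proof.
elim: n s x => [|n IH] s x; rewrite ?addn0 => Ls; first by rewrite /= h_gt ?addr0.
rewrite renewal_expectS (Ex_eq _ (T' := fun k z => (x%:R + h s) + D s k z)).
  by rewrite block_expectD block_expect_cst// D_mean addr0.
move=> k z k0; rewrite IH /D ?natrD; first by ring.
by move: Ls k0; clear; lia.
Qed.

Lemma renewal_expect_sqr n s x y : (L < s + n)%N ->
  renewal_expect K g b c n s (fun z => (z%:R + y) ^+ 2) x = (x%:R + y + h s) ^+ 2 + H s.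
Proof.
elim: n s x => [|n IH] s x; rewrite ?addn0 => Ls; first by rewrite /= h_gt ?H_gt ?addr0.
set X := x%:R + y + h s.
rewrite renewal_expectS (Ex_eq _ (T' := fun k z => X ^+ 2 + H s + 2 * X * D s k z +
    D s k z ^+ 2 - (H s - H (s + k)))); last first.
  move=> k z k0; rewrite IH /X /D ?natrD; first by ring.
  by move: Ls k0; clear; lia.
rewrite block_expectB H_mean !block_expectD block_expectZ D_mean -/(v2 s) !block_expect_cst//.
ring.
Qed.

(** * The block before the first renewal *)

Section delayed.
Variables (g0 : nat -> R) (n : nat) (C2 : R).
Hypotheses (g0_ge0 : forall k, 0 <= g0 k) (g0_sum : \sum_(k < K.+1) g0 k = 1)
  (g0_mom : \sum_(k < K.+1) g0 k * k.+1%:R ^+ 2 <= C2) (Ln : (L < n)%N).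
Local Notation E0 := (block_expect K g0 (empty_probs b)).
Local Notation E := (delayed_expect K g0 g b c n).
Let mu := E (fun z => z%:R).
Let sig2 := E (fun z => (z%:R - mu) ^+ 2).

Let E0_le (T T' : nat -> nat -> R) :
    (forall k z, (z <= count (fun p : R => p != 0%R) (empty_probs b k))%N ->
      T k z <= T' k z) -> E0 T <= E0 T'.
Proof. by apply: block_expect_le => // k; exact: empty_probs01. Qed.

Let E0_dist (T T' B : nat -> nat -> R) :
    (forall k z, (z <= count (fun p : R => p != 0%R) (empty_probs b k))%N ->
      `|T k z - T' k z| <= B k z) -> `|E0 T - E0 T'| <= E0 B.
Proof. by apply: block_expect_dist => // k; exact: empty_probs01. Qed.

Let E0_cst A : E0 (fun _ _ => A) = A. Proof. exact: block_expect_cst. Qed.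

Let delayedE F : E F = E0 (fun k z => renewal_expect K g b c n k F z).
Proof. by []. Qed.

Let Lkn k : (L < k + n)%N. Proof. by rewrite (leq_trans Ln)// leq_addl. Qed.

Let muE : mu = E0 (fun k z => z%:R + h k).
Proof.
rewrite /mu delayedE; congr (block_expect _ _ _ _).
by apply/funext => k; apply/funext => z; rewrite renewal_expect_mean.
Qed.

(** The law of total variance with respect to the first block. *)
Let sig2E : sig2 = E0 (fun k z => (z%:R + h k - mu) ^+ 2) + E0 (fun k _ => H k).
Proof.
rewrite /sig2 delayedE -block_expectD; congr (block_expect _ _ _ _).
apply/funext => k; apply/funext => z; rewrite renewal_expect_sqr//; congr (_ ^+ 2 + _); ring.
Qed.

Let E0_lin A : 0 <= A -> E0 (fun k _ => A * k.+1%:R) <= A * C2.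
Proof.
move=> A0; rewrite block_expectZ ler_wpM2l//; apply: le_trans g0_mom.
rewrite (block_expect_fst K g0 (empty_probs b) (fun k => k.+1%:R)).
apply: ler_sum => k _; rewrite ler_wpM2l// expr2 ler_peMr ?ler0n// ler1n//.
Qed.

Let E0_sq A : 0 <= A -> E0 (fun k _ => A * k.+1%:R ^+ 2) <= A * C2.
Proof.
move=> A0; rewrite block_expectZ ler_wpM2l//; apply: le_trans g0_mom.
by rewrite (block_expect_fst K g0 (empty_probs b) (fun k => k.+1%:R ^+ 2)).
Qed.

Let C2_ge0 : 0 <= C2.
Proof. by apply: le_trans g0_mom; apply: sumr_ge0 => k _; rewrite mulr_ge0 ?sqr_ge0. Qed.

Let A := M0 * q.
Let A_ge0 : 0 <= A. Proof. exact: mulr_ge0. Qed.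

(** [D_le] depends on a block only through its number of points, so it also serves the initial
    block, which starts at 0 without a renewal there. *)
Let D0_le k z : (z <= count (fun p : R => p != 0%R) (empty_probs b k))%N ->
  `|D 0 k z| <= A * k.+1%:R.
Proof.
move=> zk; apply: le_trans (D_le (s := 0) (k := k) _) _.
  by apply: le_trans (count_b 0 k); rewrite ler_nat.
by rewrite /A -mulrA ler_wpM2l.
Qed.

Let DE k z : D 0 k z = z%:R + h k - h 0.
Proof. by rewrite /D add0n addrA. Qed.

Let mu_h0 : `|mu - h 0| <= A * C2.
Proof.
rewrite muE -[h 0]E0_cst; apply: le_trans (E0_lin A_ge0).
by apply: E0_dist => k z /D0_le; rewrite DE.
Qed.

Let centred_le k z : (z <= count (fun p : R => p != 0%R) (empty_probs b k))%N ->
  `|z%:R + h k - mu| <= A * k.+1%:R + A * C2.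
Proof.
move=> /D0_le zk.
have -> : z%:R + h k - mu = D 0 k z - (mu - h 0) by rewrite DE; ring.
by apply: le_trans (ler_normB _ _) _; apply: lerD.
Qed.

Let V0 := 2 * A ^+ 2 * (C2 + C2 ^+ 2).

Let first_var_le : E0 (fun k z => (z%:R + h k - mu) ^+ 2) <= V0.
Proof.
have AA : 0 <= 2 * A ^+ 2 by rewrite mulr_ge0 ?sqr_ge0.
apply: le_trans (_ : E0 (fun k z => 2 * A ^+ 2 * k.+1%:R ^+ 2 + 2 * A ^+ 2 * C2 ^+ 2) <= _).
  apply: E0_le => k z /centred_le zk.
  rewrite -(real_normK (num_real (_ - mu))).
  apply: le_trans (_ : (A * k.+1%:R + A * C2) ^+ 2 <= _).
    by rewrite lerXn2r ?nnegrE// (le_trans _ zk).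
  have := sqr_ge0 (A * k.+1%:R - A * C2); rewrite !expr2; lra.
rewrite block_expectD E0_cst /V0 mulrDr lerD2r; exact: E0_sq.
Qed.

Let B := M0 * Mg * q.
Let B_ge0 : 0 <= B. Proof. by apply: mulr_ge0 => //; exact: mulr_ge0. Qed.

Let H_dev : E0 (fun k _ => `|H k - sig2|) <= V0 + 2 * B * C2.
Proof.
have HH k : `|H k - H 0| <= B * k.+1%:R by have := H_linear 0 k; rewrite add0n.
have EH : `|E0 (fun k _ => H k) - H 0| <= B * C2.
  rewrite -[H 0]E0_cst; apply: le_trans (E0_lin B_ge0).
  by apply: E0_dist => k z _; exact: HH.
have v0 : 0 <= E0 (fun k z => (z%:R + h k - mu) ^+ 2).
  by rewrite -[leLHS]E0_cst; apply: E0_le => k z _; exact: sqr_ge0.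
apply: le_trans (_ : E0 (fun k _ => (B * C2 + V0) + B * k.+1%:R) <= _).
  apply: E0_le => k z _; rewrite sig2E.
  have -> : H k - (E0 (fun k z => (z%:R + h k - mu) ^+ 2) + E0 (fun k _ => H k)) =
     (H k - H 0) - ((E0 (fun k _ => H k) - H 0) + E0 (fun k z => (z%:R + h k - mu) ^+ 2)) by ring.
  apply: le_trans (ler_normB _ _) _; rewrite addrC; apply: lerD => //.
  apply: le_trans (ler_normD _ _) _; apply: lerD => //.
  by rewrite ger0_norm.
rewrite block_expectD E0_cst; have := E0_lin B_ge0; lra.
Qed.

Let mu_dev : E0 (fun k z => `|z%:R + h k - mu|) <= 2 * A * C2.
Proof.
apply: le_trans (_ : E0 (fun k _ => A * C2 + A * k.+1%:R) <= _).
  by apply: E0_le => k z /centred_le; rewrite [X in _ <= X -> _]addrC.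
rewrite block_expectD E0_cst; have := E0_lin A_ge0; lra.
Qed.

Let sig2_ge0 : 0 <= sig2.
Proof.
rewrite sig2E addr_ge0//.
  by rewrite -[leLHS]E0_cst; apply: E0_le => k z _; exact: sqr_ge0.
by rewrite -[leLHS]E0_cst; apply: E0_le.
Qed.

(** Given the first renewal [k], the approximating normal law has its own mean and variance. Their
    distances from [mu] and [sig2] are bounded in the mean through the second moment of the first
    step, which costs terms in |v| and v^2 only. *)
Lemma delayed_cos v kap be' :
  `|E (fun z => cos (be' + v * z%:R)) - expR (- (v ^+ 2 / 2 * sig2)) * cos (be' + v * mu)| <=
  M0 ^+ 3 * C0 * q ^+ 3 * (1 + Mg) *
    (`|v| ^+ 3 * (kap.+2%:R * (\sum_(0 <= t < L.+1) v2 t) +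
                  rho ^+ kap * (\sum_(0 <= t < L.+1) w t)) +
     v ^+ 4 * (\sum_(0 <= t < L.+1) v2 t)) +
  (v ^+ 2 / 2 * (V0 + 2 * B * C2) + `|v| * (2 * A * C2)).
Proof.
pose U k y := expR (- (v ^+ 2 / 2 * H k)) * cos (y + v * h k).
have v0 : 0 <= v ^+ 2 / 2 by rewrite divr_ge0// sqr_ge0.
rewrite -(subrKA (E0 (fun k z => U k (be' + v * z%:R)))).
apply: le_trans (ler_normD _ _) _; apply: lerD.
  rewrite delayedE -[leRHS]E0_cst; apply: E0_dist => k z _.
  exact: renewal_expect_cos_sum.
rewrite -[X in _ - X]E0_cst.
apply: le_trans (_ : E0 (fun k z => v ^+ 2 / 2 * `|H k - sig2| + `|v| * `|z%:R + h k - mu|) <= _).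
  apply: E0_dist => k z _; rewrite /U.
  set a1 := v ^+ 2 / 2 * H k; set a2 := v ^+ 2 / 2 * sig2.
  have a10 : 0 <= a1 by rewrite mulr_ge0.
  have a20 : 0 <= a2 by rewrite mulr_ge0.
  have -> : expR (- a1) * cos (be' + v * z%:R + v * h k) - expR (- a2) * cos (be' + v * mu) =
    (expR (- a1) - expR (- a2)) * cos (be' + v * z%:R + v * h k) +
    expR (- a2) * (cos (be' + v * mu + v * (z%:R + h k - mu)) - cos (be' + v * mu)).
    have -> : be' + v * mu + v * (z%:R + h k - mu) = be' + v * z%:R + v * h k by ring.
    ring.
  apply: le_trans (ler_normD _ _) _; rewrite !normrM; apply: lerD.
    have -> : v ^+ 2 / 2 * `|H k - sig2| = `|a1 - a2|.
      by rewrite /a1 /a2 -mulrBr normrM (ger0_norm v0).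
    by rewrite -[leRHS]mulr1; apply: ler_pM => //; [exact: expRB_lip|exact: cos_max].
  rewrite -[leRHS]mul1r -(normrM v); apply: ler_pM => //; last exact: cosB_le.
  by rewrite ger0_norm ?expR_ge0// expR_le1 oppr_le0.
rewrite block_expectD (block_expectZ _ _ _ _ (fun k _ => `|H k - sig2|)).
rewrite (block_expectZ _ _ _ _ (fun k z => `|z%:R + h k - mu|)).
by apply: lerD; apply: ler_wpM2l.
Qed.

(** The variance is at least the contribution of a first renewal at [ks], namely [gs * H ks], and
    [H ks] is the sum of the [v2 t] weighted by [u (t - ks)]. From [ks + n1] on these weights are at
    least [cl]; each earlier step variance is at most [Mg]. *)
Lemma sum_step_variance_le (ks n1 : nat) (gs cl : R) : (ks <= K)%N -> 0 < gs -> 0 < cl ->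
    gs <= g0 ks -> (forall m, (n1 <= m)%N -> cl <= u m) ->
  \sum_(0 <= t < L.+1) v2 t <= ((ks + n1)%:R * Mg + (gs * cl)^-1) * (sig2 + 1).
Proof.
move=> ksK gs0 cl0 gsg clu.
have gc0 : 0 < gs * cl by exact: mulr_gt0.
have Hks : gs * H ks <= sig2.
  rewrite sig2E; apply: le_trans (_ : E0 (fun k _ => H k) <= _); last first.
    by rewrite lerDr -[leLHS]E0_cst; apply: E0_le => k z _; exact: sqr_ge0.
  rewrite block_expect_fst (bigD1 (Ordinal (ksK : (ks < K.+1)%N)))//=.
  rewrite -[leLHS]addr0; apply: lerD; first by rewrite ler_wpM2r.
  by apply: sumr_ge0 => k _; rewrite mulr_ge0.
have Htail : cl * (\sum_(ks + n1 <= t < L.+1) v2 t) <= H ks.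
  rewrite mulr_sumr (big_nat_widenl _ ks)/= ?leq_addr// big_mkcond/=.
  apply: ler_sum => t _; case: ifPn => [kt|_].
    by rewrite mulrC ler_wpM2l// clu//; move: kt; clear; lia.
  by rewrite mulr_ge0//; case/andP: (u01 (t - ks)).
have Hhead : \sum_(0 <= t < 0 + (ks + n1)) v2 t <= (ks + n1)%:R * Mg.
  rewrite add0n; apply: le_trans (_ : \sum_(0 <= t < ks + n1) Mg <= _).
    by apply: ler_sum => t _; exact: v2_le.
  by rewrite sumr_const_nat subn0 mulr_natl.
rewrite (@tail_sum_split _ v2 L 0 (ks + n1)); last by move=> t /v2_gt.
rewrite add0n in Hhead *.
have T : \sum_(ks + n1 <= t < L.+1) v2 t <= (gs * cl)^-1 * sig2.
  rewrite ler_pdivlMl// -mulrA; apply: le_trans Hks.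
  by rewrite ler_wpM2l// ltW.
have X0 : 0 <= (ks + n1)%:R * Mg by rewrite mulr_ge0.
have Y0 : 0 <= (gs * cl)^-1 by rewrite invr_ge0 ltW.
have := mulr_ge0 X0 sig2_ge0.
rewrite mulrDl !mulrDr !mulr1; lra.
Qed.

Lemma delayed_cos_bound (ks n1 : nat) (gs cl : R) : (ks <= K)%N -> 0 < gs -> 0 < cl ->
    gs <= g0 ks -> (forall m, (n1 <= m)%N -> cl <= u m) ->
  forall v kap be',
  `|E (fun z => cos (be' + v * z%:R)) - expR (- (v ^+ 2 / 2 * sig2)) * cos (be' + v * mu)| <=
  (M0 ^+ 3 * C0 * q ^+ 3 * (1 + Mg) * (1 + ((ks + n1)%:R * Mg + (gs * cl)^-1)) +
    (V0 + 2 * B * C2) + 2 * A * C2) *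
  (`|v| ^+ 3 * (kap.+2%:R * (sig2 + 1) + rho ^+ kap * \sum_(0 <= t < L.+1) w t) +
   v ^+ 4 * (sig2 + 1) + v ^+ 2 + `|v|).
Proof.
move=> ksK gs0 cl0 gsg clu v kap be'.
have Ga := sum_step_variance_le ksK gs0 cl0 gsg clu.
apply: le_trans (delayed_cos v kap be') _.
set X := (ks + n1)%:R * Mg + (gs * cl)^-1 in Ga *.
set Gam := \sum_(0 <= t < L.+1) v2 t in Ga *.
set W := \sum_(0 <= t < L.+1) w t.
set P := M0 ^+ 3 * C0 * q ^+ 3 * (1 + Mg).
have X0 : 0 <= X.
  by apply: addr_ge0; [exact: mulr_ge0|rewrite invr_ge0 ltW// mulr_gt0].
have P0 : 0 <= P.
  apply: mulr_ge0; last by rewrite addr_ge0.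
  apply: mulr_ge0; last exact: exprn_ge0.
  by apply: mulr_ge0; [exact: exprn_ge0|exact: le_trans C0_ge1].
have v3 : 0 <= `|v| ^+ 3 by rewrite exprn_ge0.
have v4 : 0 <= v ^+ 4 by rewrite exprn_even_ge0.
have vv : 0 <= v ^+ 2 by rewrite sqr_ge0.
have va : 0 <= `|v| by [].
have W0 : 0 <= W by apply: sumr_ge0.
have rk0 : 0 <= rho ^+ kap by rewrite exprn_ge0// ltW.
have s1 : 0 <= sig2 + 1 by rewrite addr_ge0.
have V00 : 0 <= V0 + 2 * B * C2.
  apply: addr_ge0; last by apply: mulr_ge0 => //; exact: mulr_ge0.
  apply: mulr_ge0; first by apply: mulr_ge0 => //; exact: sqr_ge0.
  by apply: addr_ge0 => //; exact: sqr_ge0.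
have A00 : 0 <= 2 * A * C2 by apply: mulr_ge0 => //; exact: mulr_ge0.
set V := V0 + 2 * B * C2 in V00 *; set Q := 2 * A * C2 in A00 *.
set T1 := `|v| ^+ 3 * (kap.+2%:R * (sig2 + 1) + rho ^+ kap * W) + v ^+ 4 * (sig2 + 1).
have T10 : 0 <= T1.
  by apply: addr_ge0; apply: mulr_ge0 => //; apply: addr_ge0; exact: mulr_ge0.
have main : `|v| ^+ 3 * (kap.+2%:R * Gam + rho ^+ kap * W) + v ^+ 4 * Gam <= (1 + X) * T1.
  have k0 : 0 <= kap.+2%:R :> R by [].
  have e1 : kap.+2%:R * Gam + rho ^+ kap * W <= (1 + X) * (kap.+2%:R * (sig2 + 1) + rho ^+ kap * W).
    have := ler_wpM2l k0 Ga; have := mulr_ge0 X0 (mulr_ge0 rk0 W0); have := mulr_ge0 k0 s1.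
    by rewrite mulrDr !mulrDl; nra.
  have e2 : Gam <= (1 + X) * (sig2 + 1) by rewrite mulrDl mul1r; apply: le_trans Ga _; rewrite lerDr.
  have := ler_wpM2l v3 e1; have := ler_wpM2l v4 e2; rewrite /T1; lra.
have main' := ler_wpM2l P0 main.
have h1 : v ^+ 2 / 2 * V <= V * v ^+ 2.
  rewrite mulrC ler_wpM2l//; lra.
have PX0 : 0 <= P * (1 + X) by rewrite mulr_ge0// addr_ge0.
apply: le_trans (_ : P * ((1 + X) * T1) + (V * v ^+ 2 + Q * `|v|) <= _).
  by apply: lerD => //; apply: lerD => //; rewrite mulrC.
have := mulr_ge0 PX0 vv; have := mulr_ge0 PX0 va; have := mulr_ge0 V00 T10.
have := mulr_ge0 V00 va; have := mulr_ge0 A00 T10; have := mulr_ge0 A00 vv.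
rewrite -(addrA _ (v ^+ 2)) -/T1 mulrA; lra.
Qed.

End delayed.

End core.

(** The order of the quantifiers is the point: [M] is fixed before the truncation, the observed set
    and the noise parameters, so that one constant serves a whole sequence of observed sets. *)
Lemma delayed_cos_estimate {R : realType} (rho C1 C0 C2 gs cl : R) (ks n1 : nat) :
    0 < rho < 1 -> 0 <= C1 -> 0 < gs -> 0 < cl ->
  exists M : R, forall (K L n : nat) (g0 g u b c : nat -> R) (e : nat -> bool),
    (L < K)%N -> (L < n)%N -> (ks <= K)%N ->
    (forall k, 0 <= g k) -> g 0%N = 0 -> \sum_(k < K.+1) g k = 1 ->
    (forall k, 0 <= g0 k) -> \sum_(k < K.+1) g0 k = 1 ->
    u 0%N = 1 -> (forall m, 0 <= u m <= 1) ->
    (forall m, (m < L)%N -> u m.+1 = \sum_(k < m.+1) g k.+1 * u (m - k)%N) ->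
    (forall m j, `|u (m + j)%N - u m| <= C1 * rho ^+ m) ->
    (forall m, (n1 <= m)%N -> cl <= u m) ->
    \sum_(k < K.+1) g k * rho^-1 ^+ (4 * k) <= C0 ->
    \sum_(k < K.+1) g0 k * k.+1%:R ^+ 2 <= C2 -> gs <= g0 ks ->
    (forall t, 0 <= b t <= 1) -> (forall t, 0 <= c t <= 1) ->
    (forall t, ~~ e t -> b t = 0) -> (forall t, ~~ e t -> c t = 0) ->
    (forall t, e t -> (t <= L)%N) ->
    let E := delayed_expect K g0 g b c n in
    let mu := E (fun z => z%:R) in
    let sig2 := E (fun z => (z%:R - mu) ^+ 2) in
    forall v kap be,
    `|E (fun z => cos (be + v * z%:R)) - expR (- (v ^+ 2 / 2 * sig2)) * cos (be + v * mu)| <=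
    M * (`|v| ^+ 3 * (kap.+2%:R * (sig2 + 1) + rho ^+ kap * \sum_(0 <= t < L.+1) (e t)%:R) +
         v ^+ 4 * (sig2 + 1) + v ^+ 2 + `|v|).
Proof.
move=> rho01 C10 gs0 cl0; eexists => K L n g0 g u b c e LK Ln ksK gge g00 gs1 g0ge g0s.
move=> u0 u01 uS uc ucl gm g0m gsg b01 c01 be ce eL E mu sig2 v kap be'.
exact: (delayed_cos_bound LK gge g00 gs1 u0 u01 uS rho01 C10 uc gm b01 c01 be ce eL
  g0ge g0s g0m Ln ksK gs0 cl0 gsg ucl v kap be').
Qed.

(** * Convergence to the normal law from cosine moments *)

Section gaussian.
Context {R : realType}.
Local Notation mu := (@lebesgue_measure R).
Implicit Types (z th be : R) (F G : R -> R).

Definition gauss_density z : R := (Num.sqrt (2 * pi))^-1 * expR (- (z ^+ 2 / 2)).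
Local Notation p := gauss_density.

(** A multiple of the normal density of variance 2. It dominates [p z] times any affine function of
    |z|, and the integrability claims below reduce to it. *)
Let wide z : R := (Num.sqrt (2 * pi))^-1 * expR (- (z ^+ 2 / 4)).

Let pk_gt0 : 0 < (Num.sqrt (2 * pi))^-1 :> R.
Proof. by rewrite invr_gt0 sqrtr_gt0 mulr_gt0// pi_gt0. Qed.

Lemma gauss_density_ge0 z : 0 <= p z.
Proof. by rewrite mulr_ge0 ?expR_ge0// ltW. Qed.

Lemma gauss_densityE : p = normal_pdf 0 1.
Proof.
apply/funext => z; rewrite normal_pdfE ?oner_eq0//; congr (_ * expR _).
  by rewrite /normal_peak expr1n mul1r mulr_natl.
by rewrite subr0 expr1n mulNr.
Qed.

Let wide_integrable : mu.-integrable setT (EFin \o wide).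
Proof.
have s2 : Num.sqrt 2 != 0 :> R by rewrite gt_eqF// sqrtr_gt0.
have -> : EFin \o wide =
    (fun z => ((Num.sqrt (2 * pi))^-1 / normal_peak (Num.sqrt 2))%:E * (normal_pdf 0 (Num.sqrt 2) z)%:E)%E.
  apply/funext => z /=; rewrite -EFinM normal_pdfE// mulrA divfK ?gt_eqF ?normal_peak_gt0//.
  congr ((_ * expR _)%:E); rewrite subr0 sqr_sqrtr// -mulNr.
  by congr (_ / _); rewrite -[RHS]mulr_natr -natrM.
by apply: integrableZl => //; exact: integrable_normal_pdf.
Qed.

Let dominated_integrable F M : measurable_fun setT F -> (forall z, `|F z| <= M * wide z) ->
  mu.-integrable setT (EFin \o F).
Proof.
move=> mF FM; apply: le_integrable (integrableZl measurableT M wide_integrable) => //.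
- exact/measurable_EFinP.
- by move=> z _ /=; rewrite lee_fin (le_trans (FM z))// ler_norm.
Qed.

Let exp_quarter z : 1 + `|z| <= 2 * expR (z ^+ 2 / 4).
Proof.
have := expR_ge1Dx (z ^+ 2 / 4); rewrite -(real_normK (num_real z)).
have := sqr_ge0 (`|z| - 1); rewrite sqrrB1; lra.
Qed.

Let p_wide z : p z * (1 + `|z|) <= 2 * wide z.
Proof.
apply: le_trans (ler_wpM2l (gauss_density_ge0 z) (exp_quarter z)) _.
have E : expR (- (z ^+ 2 / 2)) * expR (z ^+ 2 / 4) = expR (- (z ^+ 2 / 4)).
  by rewrite -expRD; congr expR; field.
by rewrite /gauss_density /wide -E le_eqVlt; apply/orP; left; apply/eqP; ring.
Qed.

Let mp : measurable_fun setT p.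
Proof. by rewrite gauss_densityE; exact: measurable_normal_pdf. Qed.

Let dominated_linear F M : measurable_fun setT F -> (forall z, `|F z| <= M * (1 + `|z|)) ->
  mu.-integrable setT (EFin \o (fun z => p z * F z)).
Proof.
move=> mF FM; apply: (@dominated_integrable _ (2 * `|M|)).
  exact: measurable_funM.
move=> z; rewrite normrM (ger0_norm (gauss_density_ge0 z)).
apply: le_trans (_ : p z * (`|M| * (1 + `|z|)) <= _).
  apply: ler_wpM2l; first exact: gauss_density_ge0.
  by apply: le_trans (FM z) _; rewrite ler_wpM2r ?addr_ge0// ler_norm.
by rewrite mulrCA [leRHS]mulrAC [leRHS]mulrC ler_wpM2l.
Qed.

Definition gauss_expect F : R := \int[mu]_z (p z * F z).

Lemma gauss_integrable F M : measurable_fun setT F -> (forall z, `|F z| <= M) ->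
  mu.-integrable setT (EFin \o (fun z => p z * F z)).
Proof.
move=> mF FM; apply: (@dominated_linear _ M) => // z.
by apply: le_trans (FM z) _; rewrite ler_peMr ?lerDl//; apply: le_trans (FM z).
Qed.

Lemma gauss_expectD F G M N : measurable_fun setT F -> (forall z, `|F z| <= M) ->
    measurable_fun setT G -> (forall z, `|G z| <= N) ->
  gauss_expect (fun z => F z + G z) = gauss_expect F + gauss_expect G.
Proof.
move=> mF FM mG GN; rewrite /gauss_expect -RintegralD//.
- by apply: eq_Rintegral => z _; rewrite mulrDr.
- exact: gauss_integrable FM.
- exact: gauss_integrable GN.
Qed.

Lemma gauss_expectZ a F M : measurable_fun setT F -> (forall z, `|F z| <= M) ->
  gauss_expect (fun z => a * F z) = a * gauss_expect F.
Proof.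
move=> mF FM; rewrite /gauss_expect -RintegralZl//.
- by apply: eq_Rintegral => z _; rewrite mulrCA.
- exact: gauss_integrable FM.
Qed.

Lemma gauss_expect_le F G M N : measurable_fun setT F -> (forall z, `|F z| <= M) ->
    measurable_fun setT G -> (forall z, `|G z| <= N) -> (forall z, F z <= G z) ->
  gauss_expect F <= gauss_expect G.
Proof.
move=> mF FM mG GN FG; apply: le_Rintegral => //.
- exact: gauss_integrable FM.
- exact: gauss_integrable GN.
- by move=> z _; apply: ler_wpM2l => //; exact: gauss_density_ge0.
Qed.

Lemma gauss_expect_cst a : gauss_expect (fun=> a) = a.
Proof.
have -> : gauss_expect (fun=> a) = a * \int[mu]_z p z.
  rewrite -RintegralZl//.
    by apply: eq_Rintegral => z _; rewrite mulrC.
  by rewrite gauss_densityE; exact: integrable_normal_pdf.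
by rewrite gauss_densityE /Rintegral integral_normal_pdf mulr1.
Qed.

Lemma measurable_cos_affine th be : measurable_fun [set: R] (fun z => cos (th * z + be)).
Proof.
apply: measurableT_comp; first exact: continuous_measurable_fun (@continuous_cos R).
by apply: measurable_funD => //; exact: measurable_funM.
Qed.

Lemma measurable_sin_affine th be : measurable_fun [set: R] (fun z => sin (th * z + be)).
Proof.
apply: measurableT_comp; first exact: continuous_measurable_fun (@continuous_sin R).
by apply: measurable_funD => //; exact: measurable_funM.
Qed.

Let p_derive z : is_derive z 1 p (- z * p z).
Proof.
rewrite /gauss_density; set pk := _^-1; apply: is_derive_eq; rewrite /GRing.scale/=; by field.
Qed.

Section by_parts.
Variables th be : R.
Let k z : R := p z * sin (th * z + be).
Let dk z : R := p z * (th * cos (th * z + be) - z * sin (th * z + be)).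

Let k_derive z : is_derive z 1 k (dk z).
Proof.
have H := p_derive z; rewrite /k; apply: is_derive_eq; rewrite /GRing.scale/= /dk; ring.
Qed.

Lemma measurable_affine_trig : measurable_fun setT (fun z => th * cos (th * z + be) - z * sin (th * z + be)).
Proof.
apply: measurable_funB; apply: measurable_funM => //.
- exact: measurable_cos_affine.
- exact: measurable_sin_affine.
Qed.

Lemma affine_trig_bound z : `|th * cos (th * z + be) - z * sin (th * z + be)| <= (1 + `|th|) * (1 + `|z|).
Proof.
apply: le_trans (ler_normB _ _) _; rewrite !normrM.
have : `|th| * `|cos (th * z + be)| <= `|th| * 1 by rewrite ler_wpM2l// cos_max.
have : `|z| * `|sin (th * z + be)| <= `|z| * 1 by rewrite ler_wpM2l// sin_max.
have : 0 <= `|th| * `|z| by rewrite mulr_ge0.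
lra.
Qed.

Let dk_integrable : mu.-integrable setT (EFin \o dk).
Proof. exact: dominated_linear measurable_affine_trig affine_trig_bound. Qed.

Let p_le n : p n.+1%:R <= (Num.sqrt (2 * pi))^-1 * n.+1%:R^-1.
Proof.
rewrite /gauss_density ler_wpM2l ?(ltW pk_gt0)// expRN lef_pV2 ?posrE ?expR_gt0//.
apply: le_trans (expR_ge1Dx _).
by have := sqr_ge0 (n.+1%:R - 1 : R); rewrite sqrrB1; lra.
Qed.

Let k_norm z : `|k z| <= p z.
Proof.
rewrite normrM (ger0_norm (gauss_density_ge0 z)) ler_piMr ?gauss_density_ge0//.
exact: sin_max.
Qed.

Let mdkp : measurable_fun setT dk. Proof. exact: measurable_funM mp measurable_affine_trig. Qed.

(** [dk] is the derivative of [p z * sin (th * z + be)]. Its integral over a symmetric interval is a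
    boundary term, at most twice the density at the endpoint, and dominated convergence passes to
    the whole line. *)
Lemma gauss_by_parts : \int[mu]_z dk z = 0.
Proof.
pose I n : set R := `[- n.+1%:R, n.+1%:R]%classic.
have [_ _ H] : [/\ mu.-integrable setT (EFin \o dk),
  [sequence \int[mu]_(x in setT) (fun n x => `|(EFin \o (dk \_ (I n))) x - (EFin \o dk) x|) n x]_n @ \oo --> 0 &
  [sequence \int[mu]_(x in setT) ((EFin \o (dk \_ (I n))) x)]_n @ \oo --> \int[mu]_(x in setT) ((EFin \o dk) x)]%E.
  apply: (@dominated_convergence _ _ _ mu setT measurableT (fun n => EFin \o (dk \_ (I n))) (EFin \o dk)
    (fun z => `|(dk z)%:E|%E)) => //.
  - move=> n; apply/measurable_EFinP; apply/(measurable_restrictT dk); first exact: measurable_itv.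
    exact: measurable_funTS mdkp.
  - by apply/measurable_EFinP; exact: mdkp.
  - apply: aeW => z _; apply: cvg_near_cst; exists (Num.truncn `|z|) => // n /= zn.
    have : `|z| <= n.+1%:R.
      by apply: le_trans (ltW (truncnS_gt _)) _; rewrite ler_nat ltnS.
    by rewrite ler_norml => zn1; rewrite /patch ifT// inE/=.
  - exact: integrable_abse.
  - apply: aeW => z n _ /=; rewrite /patch; case: ifP => // _.
    by rewrite normr0 lee_fin.
have FTC n : (\int[mu]_(x in setT) ((EFin \o (dk \_ (I n))) x) =
    (k n.+1%:R - k (- n.+1%:R))%:E)%E.
  rewrite -restrict_EFin -integral_mkcond EFinB; apply: continuous_FTC2.
  - by rewrite -subr_gt0 opprK addr_gt0.
  - apply: continuous_subspaceT => z.
    suff : {for z, continuous dk} by [].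
    by apply/differentiable_continuous/derivable1_diffP; apply: ex_derive.
  - split; first by move=> z _; apply: ex_derive.
    + apply: cvg_at_right_filter; apply/differentiable_continuous/derivable1_diffP; apply: ex_derive.
    + apply: cvg_at_left_filter; apply/differentiable_continuous/derivable1_diffP; apply: ex_derive.
  - by move=> z _; rewrite derive1E; apply: derive_val.
have lim0 : (\int[mu]_(x in setT) ((EFin \o (dk \_ (I n))) x))%E @[n --> \oo] --> 0%:E.
  under eq_fun do rewrite FTC.
  apply/cvg_EFin; first exact: nearW.
  apply: (@squeeze_cvgr _ _ _ _ (fun n => - (2 * (Num.sqrt (2 * pi))^-1 * n.+1%:R^-1))
     (fun n => 2 * (Num.sqrt (2 * pi))^-1 * n.+1%:R^-1)).
  - apply: nearW => n; rewrite -ler_norml; apply: le_trans (ler_normB _ _) _.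
    apply: le_trans (lerD (k_norm _) (k_norm _)) _.
    have -> : p (- n.+1%:R) = p n.+1%:R by rewrite /gauss_density sqrrN.
    have := p_le n; set X := _ / _ => pX; rewrite -mulrA -/X; lra.
  - rewrite -oppr0; apply: cvgN; rewrite -[X in _ --> X](mulr0 (2 * (Num.sqrt (2 * pi))^-1)).
    by apply: cvgMr; exact: cvg_harmonic.
  - rewrite -[X in _ --> X](mulr0 (2 * (Num.sqrt (2 * pi))^-1)).
    by apply: cvgMr; exact: cvg_harmonic.
by rewrite /Rintegral (cvg_unique _ H lim0).
Unshelve. all: by end_near.
Qed.

End by_parts.

Let Gd z := p z * `|z|.

Let Gd_integrable : mu.-integrable setT (EFin \o Gd).
Proof.
apply: (@dominated_linear _ 1) => [|z]; last by rewrite normr_id mul1r lerDr.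
exact: normr_measurable.
Qed.

Section characteristic.
Variable be : R.
Let J th := gauss_expect (fun z => cos (th * z + be)).
Let f th z := p z * cos (th * z + be).

Let f_derive th z : is_derive th 1 (f ^~ z) (p z * (- sin (th * z + be) * z)).
Proof. by rewrite /f; apply: is_derive_eq; rewrite /GRing.scale/=; ring. Qed.

Let d1f th z : partial1of2 f th z = p z * (- sin (th * z + be) * z).
Proof. by rewrite partial1of2E; apply: derive_val. Qed.

(** Differentiating under the integral yields the mean of -z sin(th z + be), which integration by
    parts turns into -th times the mean of the cosine. *)
Let J_derive th : is_derive th 1 J (- th * J th).
Proof.
have tI : `]th - 1, th + 1[%classic th by rewrite /= in_itv/= gtrBl ltrDl ltr01.
have fi x : `]th - 1, th + 1[%classic x -> mu.-integrable setT (EFin \o f x).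
  by move=> _; apply: (@gauss_integrable _ 1); [exact: measurable_cos_affine|move=> z; exact: cos_max].
have fd x y : `]th - 1, th + 1[%classic x -> setT y -> derivable (f ^~ y) x 1.
  by move=> _ _; apply: ex_derive.
have G0 y : 0 <= Gd y by rewrite mulr_ge0 ?gauss_density_ge0.
have Gub x y : `]th - 1, th + 1[%classic x -> setT y -> `|partial1of2 f x y| <= Gd y.
  move=> _ _; rewrite d1f normrM (ger0_norm (gauss_density_ge0 y)).
  apply: ler_wpM2l; first exact: gauss_density_ge0.
  by rewrite normrM normrN ler_piMl// sin_max.
have JE : \int[mu]_(y in setT) partial1of2 f th y = - th * J th.
  have E z : partial1of2 f th z =
      p z * (th * cos (th * z + be) - z * sin (th * z + be)) + (- th) * (p z * cos (th * z + be)).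
    by rewrite d1f; ring.
  under eq_Rintegral do rewrite E.
  have I1 : mu.-integrable setT (EFin \o f th) by exact: fi.
  rewrite RintegralD//.
  - by rewrite gauss_by_parts add0r RintegralZl.
  - apply: (@dominated_linear _ (1 + `|th|)); [exact: measurable_affine_trig|exact: affine_trig_bound].
  - by rewrite /= -/(f th _); have := integrableZl measurableT (- th) I1.
rewrite -JE; apply: DeriveDef.
- exact: (derivable_under_integral measurableT tI fi fd G0 Gd_integrable Gub).
- rewrite -derive1E.
  exact: (differentiation_under_integral measurableT tI fi fd G0 Gd_integrable Gub).
Qed.

(** By this differential equation J(th) e^(th^2 / 2) is constant, with the value cos be at th =
    0. *)
Lemma gauss_expect_cos th : gauss_expect (fun z => cos (th * z + be)) = expR (- (th ^+ 2 / 2)) * cos be.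
Proof.
have D (x : R) : is_derive x (1 : R) (fun x : R => J x * expR (x ^+ 2 / 2)) 0.
  by have H := J_derive x; apply: is_derive_eq; rewrite /GRing.scale/=; field.
have := is_derive_0_is_cst th 0 D.
rewrite /J expr0n/= mul0r expR0 mulr1 => JE.
have -> : gauss_expect (fun z => cos (th * z + be)) =
    gauss_expect (fun z => cos (th * z + be)) * expR (th ^+ 2 / 2) * expR (- (th ^+ 2 / 2)).
  by rewrite -mulrA expRxMexpNx_1 mulr1.
rewrite JE mulrC; congr (_ * _).
rewrite -[RHS]gauss_expect_cst; congr gauss_expect.
by apply/funext => z; rewrite mul0r add0r.
Qed.

End characteristic.

Lemma measurable_indicator (A : set R) : measurable A -> measurable_fun setT (\1_A : R -> R).
Proof. exact: measurable_indic. Qed.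

Lemma indicator_bound (A : set R) z : `|\1_A z : R| <= 1.
Proof. by rewrite indicE; case: (_ \in _); rewrite ?normr1 ?normr0. Qed.

(** Markov's inequality, with [C] the first absolute moment. *)
Lemma gauss_tail : exists C : R, forall A (B : set R), 0 < A -> measurable B ->
  (forall z, B z -> A <= `|z|) -> gauss_expect \1_B <= C / A.
Proof.
exists (\int[mu]_z Gd z) => A B A0 mB BA.
rewrite mulrC -RintegralZl//.
apply: le_Rintegral => //.
- by apply: (@gauss_integrable _ 1); [exact: measurable_indicator|exact: indicator_bound].
- have := integrableZl measurableT A^-1 Gd_integrable.
  by congr (integrable _ _ _); apply/funext => z /=; rewrite EFinM.
- move=> z _; rewrite /Gd mulrCA; apply: ler_wpM2l; first exact: gauss_density_ge0.
  rewrite mulrC ler_pdivlMr// indicE; case: (boolP (z \in B)) => [/set_mem/BA|_].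
    by rewrite mul1r.
  by rewrite mul0r.
Qed.

Lemma gauss_interval x y : x <= y ->
  gauss_expect \1_(`]-oo, y]%classic) <= gauss_expect \1_(`]-oo, x]%classic) + (y - x).
Proof.
move=> xy.
have m1 : measurable_fun setT (\1_(`]-oo, x]%classic) : R -> R) by exact: measurable_indicator.
have m2 : measurable_fun setT (\1_(`]x, y]%classic) : R -> R) by exact: measurable_indicator.
have -> : \1_(`]-oo, y]%classic) = (fun z => \1_(`]-oo, x]%classic) z + \1_(`]x, y]%classic) z) :> (R -> R).
  apply/funext => z; rewrite !indicE !mem_setE !in_itv/=.
  have [zx|xz] := leP z x; rewrite ?addr0 ?add0r//= ?(le_trans zx xy)//.
rewrite (gauss_expectD (M := 1) (N := 1))//; [|exact: indicator_bound..].
rewrite lerD2l.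
have -> : y - x = \int[mu]_z \1_(`]x, y]%classic) z.
  rewrite /Rintegral integral_indic//= setIT lebesgue_measure_itv/= lte_fin.
  by move: xy; rewrite le_eqVlt => /predU1P[->|->]; rewrite ?ltxx ?subrr.
apply: le_Rintegral => //.
- by apply: (@gauss_integrable _ 1) => //; exact: indicator_bound.
- exact: integrable_indic_itv.
- move=> z _; rewrite -[leRHS]mul1r; apply: ler_wpM2r; first by rewrite indicE.
  rewrite /gauss_density -[leRHS]mulr1; apply: ler_pM.
  + exact: ltW.
  + exact: expR_ge0.
  + rewrite invf_le1 ?sqrtr_gt0 ?mulr_gt0 ?pi_gt0//.
    rewrite -[leLHS]sqrtr1 ler_wsqrtr//.
    by have := @pi_ge2 R; lra.
  + by rewrite expR_le1 oppr_le0 divr_ge0// sqr_ge0.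
Qed.

Lemma gauss_expect_indic x : gauss_expect \1_(`]-oo, x]%classic) =
  (Num.sqrt (2 * pi))^-1 * \int[mu]_(t in `]-oo, x]) expR (- (t ^+ 2 / 2)).
Proof.
have p_int : mu.-integrable setT (EFin \o p).
  by rewrite gauss_densityE; exact: integrable_normal_pdf.
have e_int : mu.-integrable setT (EFin \o (fun t : R => expR (- (t ^+ 2 / 2)))).
  have := integrableZl measurableT (Num.sqrt (2 * pi)) p_int.
  congr (integrable _ _ _); apply/funext => z /=; rewrite -EFinM /gauss_density mulVKf//.
  by rewrite gt_eqF// -invr_gt0.
rewrite -RintegralZl//; last exact: integrableS e_int.
rewrite [RHS]Rintegral_mkcond; apply: eq_Rintegral => z _.
by rewrite /patch indicE; case: ifP => _; rewrite ?mulr1 ?mulr0.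
Qed.

End gaussian.

(** * Polynomial approximation of a step *)

Section step_polynomial.
Context {R : realType}.
Implicit Types (t eps eta : R).

(** By Bernoulli's inequality the product is at most (1 - x^2)^N. *)
Lemma pow_one_sub_le x N : 0 <= x <= 1 -> (1 - x) ^+ N * (1 + N%:R * x) <= 1 :> R.
Proof.
move=> /andP[x0 x1]; have x1' : 0 <= 1 - x by rewrite subr_ge0.
have h : 1 + N%:R * x <= (1 + x) ^+ N by apply: bernoulli_le; lra.
apply: le_trans (ler_wpM2l (exprn_ge0 N x1') h) _.
rewrite -exprMn exprn_ile1//.
  by rewrite mulr_ge0// addr_ge0.
by have := mulr_ge0 x0 x0; lra.
Qed.

Lemma step_poly_bounds n t : 0 <= t <= 1 -> 0 <= (1 - t ^+ n) ^+ (2 ^ n) <= 1.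
Proof.
move=> /andP[t0 t1]; have tn1 : t ^+ n <= 1 by rewrite exprn_ile1.
have tn0 : 0 <= t ^+ n by rewrite exprn_ge0.
by rewrite exprn_ge0 ?subr_ge0//= exprn_ile1 ?subr_ge0// gerBl.
Qed.

(* The Brosowski-Deutsch polynomials. *)
Lemma step_poly_approx eta eps : 0 < eta -> 0 < eps -> exists n : nat, forall t, 0 <= t <= 1 ->
  (t <= 1 / 2 - eta -> 1 - eps <= (1 - t ^+ n) ^+ (2 ^ n)) /\
  (1 / 2 + eta <= t -> (1 - t ^+ n) ^+ (2 ^ n) <= eps).
Proof.
move=> eta0 eps0; pose r := (1 + 2 * eta)^-1.
have e1 : 1 < 1 + 2 * eta by rewrite ltrDl mulr_gt0.
have r0 : 0 < r by rewrite invr_gt0 (lt_trans _ e1).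
have r1 : r < 1 by rewrite invf_lt1// (lt_trans _ e1).
have [n rn] : exists n, r ^+ n <= eps.
  have : (fun n => r ^+ n) @ \oo --> 0 by apply: cvg_expr; rewrite ger0_norm// ltW.
  move=> /cvgrPdist_le/(_ _ eps0)[n _ /(_ n (leqnn n))]; rewrite sub0r normrN => h.
  by exists n; apply: le_trans h; exact: ler_norm.
exists n => t /andP[t0 t1].
have tn01 : 0 <= t ^+ n <= 1 by rewrite exprn_ge0//= exprn_ile1.
(* This quantity governs both cases: it is at most r^n when t <= 1/2 - eta, as 1 - 2 eta <= r, and
   at least r^(-n) when t >= 1/2 + eta. *)
have N2 : (2 ^ n)%:R * t ^+ n = (2 * t) ^+ n by rewrite natrX exprMn.
split=> tle.
  have h := @bernoulli_le R (- t ^+ n) (2 ^ n).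
  apply: le_trans (h _); last by have /andP[] := tn01; lra.
  rewrite mulrN N2 lerB//.
  apply: le_trans rn; rewrite lerXn2r ?nnegrE ?mulr_ge0 ?(ltW r0)//.
  rewrite /r -[leRHS]mul1r ler_pdivlMr ?(lt_trans _ e1)//.
  have := mulr_ge0 (ltW eta0) (ltW eta0); nra.
have h := pow_one_sub_le (2 ^ n) tn01; rewrite N2 in h.
have ep : (1 + 2 * eta) ^+ n <= (2 * t) ^+ n.
  by rewrite lerXn2r ?nnegrE ?mulr_ge0//; [rewrite addr_ge0// mulr_ge0// ltW|lra].
apply: le_trans rn; rewrite /r exprVn -[leRHS]mul1r ler_pdivlMr; last first.
  by rewrite exprn_gt0// (lt_trans _ e1).
have /andP[q0 _] := step_poly_bounds n (introT andP (conj t0 t1)).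
apply: le_trans h; rewrite ler_wpM2l//; apply: le_trans ep _; lra.
Qed.

End step_polynomial.

Lemma ler_sin {R : realType} :
  {in `[ (- (pi/2)), pi/2] &, {mono @sin R : x y / x <= y}}.
Proof. by apply: le_mono_in => x y xI yI xy; rewrite ltr_sin. Qed.

(** * Finitely supported laws with Gaussian cosine limits *)

Section limit_theorem.
Context {R : realType}.
Variables (J : nat -> nat) (w W : nat -> nat -> R).
Let En m (F : R -> R) := \sum_(j < J m) w m j * F (W m j).
Hypotheses (w_ge0 : forall m j, 0 <= w m j) (w_sum : forall m, \sum_(j < J m) w m j = 1).
Hypothesis En_sq : \forall m \near \oo, En m (fun z => z ^+ 2) <= 1.
Hypothesis En_cos : forall th be,
  En m (fun z => cos (th * z + be)) @[m --> \oo] --> expR (- (th ^+ 2 / 2)) * cos be.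
Implicit Types (F G : R -> R).

Let EnD m F G : En m (fun z => F z + G z) = En m F + En m G.
Proof. by rewrite -big_split/=; apply: eq_bigr => j _; rewrite mulrDr. Qed.

Let EnZ m a F : En m (fun z => a * F z) = a * En m F.
Proof. by rewrite mulr_sumr; apply: eq_bigr => j _; rewrite mulrCA. Qed.

Let En_cst m a : En m (fun=> a) = a.
Proof. by rewrite /En -mulr_suml w_sum mul1r. Qed.

Let En_le m F G : (forall z, F z <= G z) -> En m F <= En m G.
Proof. by move=> FG; apply: ler_sum => j _; apply: ler_wpM2l. Qed.

Let good F := [/\ measurable_fun setT F, exists M, forall z, `|F z| <= M &
  En m F @[m --> \oo] --> gauss_expect F].

Let goodD F G : good F -> good G -> good (fun z => F z + G z).
Proof.
move=> [mF [M FM] cF] [mG [N GN] cG]; split.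
- exact: measurable_funD.
- by exists (M + N) => z; apply: le_trans (ler_normD _ _) _; apply: lerD.
- rewrite (gauss_expectD mF FM mG GN); under eq_fun do rewrite EnD.
  exact: cvgD.
Qed.

Let goodZ a F : good F -> good (fun z => a * F z).
Proof.
move=> [mF [M FM] cF]; split.
- exact: measurable_funM.
- by exists (`|a| * M) => z; rewrite normrM ler_wpM2l.
- rewrite (gauss_expectZ a mF FM); under eq_fun do rewrite EnZ.
  exact: cvgMr.
Qed.

(** The free cosine factor carries the induction: sin s1 cos s2 is half the sum of the sines of s1 +
    s2 and s1 - s2, and a sine is a cosine shifted by pi / 2. Raising the degree thus only changes
    frequencies and phases. *)
Let good_poly (P : {poly R}) a b th be : good (fun z => P.[sin (a * z + b)] * cos (th * z + be)).
Proof.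
elim/poly_ind: P th be => [|P c IH] th be.
  have -> : (fun z => (0 : {poly R}).[sin (a * z + b)] * cos (th * z + be)) = (fun=> 0).
    by apply/funext => z; rewrite horner0 mul0r.
  split; [exact: measurable_cst|by exists 0 => z; rewrite normr0|].
  by rewrite gauss_expect_cst; under eq_fun do rewrite En_cst; exact: cvg_cst.
have good_cos : good (fun z => cos (th * z + be)).
  split; [exact: measurable_cos_affine|by exists 1 => z; exact: cos_max|].
  by rewrite gauss_expect_cos; exact: En_cos.
have -> : (fun z => (P * 'X + c%:P).[sin (a * z + b)] * cos (th * z + be)) =
  (fun z => 1 / 2 * (P.[sin (a * z + b)] * cos ((a + th) * z + (b + be - pi / 2))) +
            (1 / 2 * (P.[sin (a * z + b)] * cos ((a - th) * z + (b - be - pi / 2))) +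
    c * cos (th * z + be))).
  apply/funext => z; rewrite hornerMXaddC.
  have -> : (a + th) * z + (b + be - pi / 2) = (a * z + b) + (th * z + be) - pi / 2 by ring.
  have -> : (a - th) * z + (b - be - pi / 2) = (a * z + b) - (th * z + be) - pi / 2 by ring.
  by move: (a * z + b) (th * z + be) => s1 s2; rewrite !cosBpihalf sinD sinB; field.
by do 2 (apply: goodD; first exact: goodZ); exact: goodZ.
Qed.

(** For |z| <= A the argument a (z - x) lies in [-1, 1], where the sine increases, so (1 + sin)/2
    crosses 1/2 exactly at [x] and a step polynomial can be applied to it. For larger |z|
    periodicity spoils the comparison, but the polynomial stays in [0, 1] and the tail indicator
    absorbs the error. *)
Let sandwich x eps A : 0 < eps -> 0 < A -> eps <= A -> exists F, [/\ good F,
  (forall z, \1_(`]-oo, x - eps]%classic) z <= F z + eps + \1_([set z | A < `|z|]) z) &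
  (forall z, F z <= \1_(`]-oo, x + eps]%classic) z + eps + \1_([set z | A < `|z|]) z)].
Proof.
move=> eps0 A0 epsA.
have pi1 : 1 <= pi / 2 :> R by exact: pihalf_ge1.
pose a := (A + `|x|)^-1.
have Ax : 0 < A + `|x| by rewrite ltr_pwDl.
have a0 : 0 < a by rewrite invr_gt0.
have ae1 : a * eps <= 1.
  by rewrite /a mulrC ler_pdivrMr// mul1r (le_trans epsA)// lerDl.
have ae0 : 0 < a * eps by rewrite mulr_gt0.
(* The amount by which (1 + sin)/2 leaves 1/2 when z is at distance [eps] from [x]. *)
pose eta := sin (a * eps) / 2.
have eta0 : 0 < eta.
  rewrite divr_gt0// sin_gt0_pi// ae0/= (le_lt_trans ae1)//.
  by have := @pi_ge2 R; lra.
have [n Hn] := step_poly_approx eta0 eps0.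
pose P : {poly R} := (1%:P - ((1%:P + 'X) * (1 / 2)%:P) ^+ n) ^+ (2 ^ n).
pose s z := sin (a * z + - (a * x)).
pose t z := (1 + s z) * (1 / 2).
have PE z : P.[s z] = (1 - t z ^+ n) ^+ (2 ^ n) by rewrite /P !(horner_exp, hornerD, hornerN, hornerM, hornerC, hornerX).
have t01 z : 0 <= t z <= 1.
  by have := sin_geN1 (a * z + - (a * x)); have := sin_le1 (a * z + - (a * x)); rewrite /t /s; lra.
have near z : `|z| <= A -> a * z + - (a * x) \in `[(- (pi / 2)), (pi / 2)].
  move=> zA; rewrite in_itv/= -ler_norml; apply: le_trans pi1.
  rewrite -mulrN -mulrDr normrM gtr0_norm// /a mulrC ler_pdivrMr// mul1r.
  by apply: le_trans (ler_normB _ _) _; rewrite lerD2r.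
have aeI : a * eps \in `[(- (pi / 2)), (pi / 2)] by rewrite in_itv/=; lra.
have aeNI : - (a * eps) \in `[(- (pi / 2)), (pi / 2)] by rewrite in_itv/=; lra.
exists (fun z => P.[s z] * cos (0 * z + 0)); split; first exact: good_poly.
- move=> z; rewrite mul0r addr0 cos0 mulr1 PE !indicE.
  have /andP[q0 q1] := step_poly_bounds n (t01 z).
  case: (boolP (z \in [set z | A < `|z|])) => zA /=.
    by have : (z \in `]-oo, (x - eps)]%classic)%:R <= 1 :> R; [case: (_ \in _)|lra].
  case: (boolP (z \in `]-oo, (x - eps)]%classic)) => zx /=; last by lra.
  have {}zA : `|z| <= A by rewrite leNgt; apply: contra zA => h; rewrite inE.
  have {}zx : z <= x - eps by move: zx; rewrite inE/= in_itv.
  have : s z <= sin (- (a * eps)).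
    rewrite /s ler_sin ?near// -mulrN -mulrDr -mulrN ler_wpM2l ?(ltW a0)//; lra.
  rewrite sinN => sz; have := (Hn _ (t01 z)).1; rewrite {1}/t /eta => h.
  by have := h ltac:(lra); lra.
- move=> z; rewrite mul0r addr0 cos0 mulr1 PE !indicE.
  have /andP[q0 q1] := step_poly_bounds n (t01 z).
  case: (boolP (z \in [set z | A < `|z|])) => zA /=.
    by have : 0 <= (z \in `]-oo, (x + eps)]%classic)%:R :> R; [case: (_ \in _)|lra].
  case: (boolP (z \in `]-oo, (x + eps)]%classic)) => zx /=; first by lra.
  have {}zA : `|z| <= A by rewrite leNgt; apply: contra zA => h; rewrite inE.
  have {}zx : x + eps < z by move: zx; rewrite notin_setE/= in_itv/= => /negP; rewrite -ltNge.
  have : sin (a * eps) <= s z.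
    rewrite /s ler_sin ?near// -mulrN -mulrDr ler_wpM2l ?(ltW a0)//; lra.
  move=> sz; have := (Hn _ (t01 z)).2; rewrite {1}/t /eta => h.
  by have := h ltac:(lra); lra.
Qed.

Lemma finite_laws_cvg_normal x :
  En m \1_(`]-oo, x]%classic) @[m --> \oo] --> gauss_expect \1_(`]-oo, x]%classic).
Proof.
have [C HC] := @gauss_tail R.
apply/cvgrPdist_le => eps0 eps0_gt0.
(* On the normal side the comparison costs 4 eps: 2 for the interval, 1 for the polynomial, 1 for
   the tail. On the side of [En] it costs 3: polynomial, tail and convergence. *)
pose eps := eps0 / 7; have e0 : 0 < eps by rewrite divr_gt0.
(* Large enough for both tails, C / A for the normal law and 1 / A^2 by Chebyshev for [En], to be at
   most [eps]. *)
pose A := (1 + `|C|) / eps + 1 + eps.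
have A1 : 1 <= A.
  by rewrite /A addrAC lerDr addr_ge0// ?divr_ge0 ?addr_ge0// ltW.
have A0 : 0 < A by rewrite (lt_le_trans _ A1).
have eA : eps <= A by rewrite /A lerDr addr_ge0// divr_ge0 ?addr_ge0// ltW.
have CA : C / A <= eps.
  rewrite ler_pdivrMr// /A !mulrDr mulrCA divff ?gt_eqF// mulr1.
  have := ler_norm C; have := mulr_gt0 e0 e0; lra.
have A2 : (A ^+ 2)^-1 <= eps.
  rewrite invf_ple ?posrE ?exprn_gt0//; apply: le_trans (_ : A <= _); last first.
    by rewrite expr2 ler_peMl// ltW.
  rewrite /A mulrDl mul1r -addrA -addrA lerDl.
  by rewrite !addr_ge0// ?divr_ge0// ltW.
pose T : set R := [set z | A < `|z|].
have mT : measurable T.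
  rewrite (_ : T = (fun z : R => `|z|) @^-1` `]A, +oo[%classic); last first.
    by apply/seteqP; split => z; rewrite /T/= in_itv/= andbT.
  by rewrite -[X in measurable X]setTI; apply: normr_measurable => //; exact: measurable_itv.
have gT : gauss_expect \1_T <= eps by apply: le_trans CA; apply: HC => // z /ltW.
have EnT : \forall m \near \oo, En m \1_T <= eps.
  near=> m; apply: le_trans A2; rewrite -[leRHS]mulr1.
  apply: le_trans (_ : (A ^+ 2)^-1 * En m (fun z => z ^+ 2) <= _); last first.
    by apply: ler_wpM2l; [rewrite invr_ge0 sqr_ge0|near: m].
  rewrite -EnZ; apply: En_le => z; rewrite indicE; case: (boolP (z \in T)) => [/set_mem zT|_].
    rewrite mulrC ler_pdivlMr ?exprn_gt0// mul1r -[leRHS]real_normK ?num_real//.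
    by rewrite lerXn2r ?nnegrE ?(ltW A0)// ltW.
  by rewrite mulr_ge0 ?invr_ge0 ?sqr_ge0.
have mI y : measurable_fun setT (\1_(`]-oo, y]%classic) : R -> R) by exact: measurable_indicator.
have bI (B : set R) := @indicator_bound R B.
have bound3 (B : set R) z : `|\1_B z + eps + \1_T z| <= 1 + eps + 1.
  apply: le_trans (ler_normD _ _) _; apply: lerD => //.
  by apply: le_trans (ler_normD _ _) _; rewrite lerD// ger0_norm// ltW.
have m3 (y : R) : measurable_fun setT (fun z : R => \1_(`]-oo, y]%classic) z + eps + \1_T z : R).
  by apply: measurable_funD; [exact: measurable_funD|exact: (measurable_indicator mT)].
have ge_sum (y : R) : gauss_expect (fun z : R => \1_(`]-oo, y]%classic) z + eps + \1_T z) =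
    gauss_expect \1_(`]-oo, y]%classic) + eps + gauss_expect \1_T.
  rewrite (gauss_expectD (M := 1 + eps) (N := 1))//.
  - by rewrite (gauss_expectD (M := 1) (N := eps)) ?gauss_expect_cst// => z; rewrite ger0_norm// ltW.
  - exact: measurable_funD.
  - by move=> z; apply: le_trans (ler_normD _ _) _; rewrite lerD// ger0_norm// ltW.
have En_sum m (y : R) : En m (fun z : R => \1_(`]-oo, y]%classic) z + eps + \1_T z) =
    En m \1_(`]-oo, y]%classic) + eps + En m \1_T by rewrite !EnD En_cst.
have [F [[mF [MF bF] cF] F1 F2]] := sandwich (x + eps) e0 A0 eA.
have [G [[mG [MG bG] cG] G1 G2]] := sandwich (x - eps) e0 A0 eA.
rewrite addrK in F1; rewrite subrK in G2.
have gF : gauss_expect F <= gauss_expect \1_(`]-oo, x]%classic) + 4 * eps.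
  apply: le_trans (gauss_expect_le mF bF (m3 (x + eps + eps)) (bound3 _) F2) _.
  rewrite ge_sum; have := @gauss_interval R x (x + eps + eps).
  move=> /(_ ltac:(lra)); lra.
have gG : gauss_expect \1_(`]-oo, x]%classic) - 4 * eps <= gauss_expect G.
  have mG3 : measurable_fun setT (fun z : R => G z + eps + \1_T z : R).
    by apply: measurable_funD; [exact: measurable_funD|exact: (measurable_indicator mT)].
  have bG3 z : `|G z + eps + \1_T z| <= MG + eps + 1.
    apply: le_trans (ler_normD _ _) _; apply: lerD => //.
    by apply: le_trans (ler_normD _ _) _; rewrite lerD// ger0_norm// ltW.
  have := gauss_expect_le (mI (x - eps - eps)) (bI _) mG3 bG3 G1.
  rewrite (gauss_expectD (M := MG + eps) (N := 1))//; last 2 first.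
  - exact: measurable_funD.
  - by move=> z; apply: le_trans (ler_normD _ _) _; rewrite lerD// ger0_norm// ltW.
  rewrite (gauss_expectD (M := MG) (N := eps)) ?gauss_expect_cst//; last first.
    by move=> z; rewrite ger0_norm// ltW.
  have := @gauss_interval R (x - eps - eps) x.
  move=> /(_ ltac:(lra)); lra.
near=> m.
have hT : En m \1_T <= eps by near: m.
have hF : `|gauss_expect F - En m F| <= eps.
  by near: m; move/cvgrPdist_le : cF; apply.
have hG : `|gauss_expect G - En m G| <= eps.
  by near: m; move/cvgrPdist_le : cG; apply.
have uF := En_le m F1; have uG := En_le m G2.
rewrite En_sum in uG; rewrite !EnD En_cst in uF.
have e7 : eps0 = 7 * eps by rewrite /eps; field.
move: hF hG; rewrite !ler_norml e7; lra.
Unshelve. all: by end_near.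
Qed.

End limit_theorem.

(** * The law of the number of points *)

Section probability_real.
Context d (T : measurableType d) (R : realType) (P : probability T R).
Implicit Types A B : set T.

Definition pr A : R := fine (P A).

Lemma prE A : measurable A -> P A = (pr A)%:E.
Proof. by move=> mA; rewrite /pr fineK// fin_num_measure. Qed.

Lemma pr_ge0 A : 0 <= pr A.
Proof. by rewrite /pr fine_ge0. Qed.

Lemma pr_set0 : pr set0 = 0.
Proof. by rewrite /pr measure0. Qed.

Lemma pr_setT : pr setT = 1.
Proof. by rewrite /pr probability_setT. Qed.

Lemma prU A B : measurable A -> measurable B -> A `&` B = set0 ->
  pr (A `|` B) = pr A + pr B.
Proof.
move=> mA mB AB0; apply/EFin_inj.
by rewrite EFinD -!prE ?measureU//; exact: measurableU.
Qed.

Lemma pr_split A B : measurable A -> measurable B ->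
  pr A = pr (A `&` B) + pr (A `&` ~` B).
Proof.
move=> mA mB; rewrite -prU -?setIUr ?setUv ?setIT//.
- exact: measurableI.
- by apply: measurableI => //; exact: measurableC.
- by rewrite setIACA setICr setI0.
Qed.

Lemma pr_setC A : measurable A -> pr (~` A) = 1 - pr A.
Proof.
move=> mA; have := pr_split measurableT mA; rewrite pr_setT !setTI => ->.
by rewrite addrAC subrr add0r.
Qed.

Lemma pr_le A B : measurable A -> measurable B -> A `<=` B -> pr A <= pr B.
Proof.
move=> mA mB AB; rewrite (pr_split mB mA) (_ : B `&` A = A) ?lerDl ?pr_ge0//.
exact/setIidr.
Qed.

Lemma pr_partition (phi : T -> nat) A K : measurable A ->
    (forall k, measurable [set w | phi w = k]) -> (forall w, (phi w <= K)%N) ->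
  pr A = \sum_(k < K.+1) pr (A `&` [set w | phi w = k]).
Proof.
move=> mA mphi phiK.
have mlt n : measurable [set w | (phi w < n)%N].
  rewrite (_ : [set w | _] = \bigcup_(k in `I_n) [set w | phi w = k]).
    by apply: bigcup_measurable => k _.
  by apply/seteqP; split => w /=; [move=> wn; exists (phi w)|move=> [k /= kn ->]].
have H n : pr (A `&` [set w | (phi w < n)%N]) = \sum_(k < n) pr (A `&` [set w | phi w = k]).
  elim: n => [|n IH].
    by rewrite big_ord0 (_ : _ `&` _ = set0) ?pr_set0//; apply/seteqP; split => w [].
  rewrite big_ord_recr/= -IH -prU.
  - congr pr; rewrite -setIUr; congr (_ `&` _).
    apply/seteqP; split => w /=; last by clear; case; lia.
    by move=> h; have [|ge] := ltnP (phi w) n; [left|right; move: h ge; clear; lia].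
  - exact: measurableI.
  - exact: measurableI.
  - by rewrite setIACA (_ : [set w | _] `&` _ = set0) ?setI0//; apply/seteqP; split => w [] /= + e; rewrite e ltnn.
rewrite -H; congr pr; apply/seteqP; split => w; last by case.
by move=> Aw; split => //=; rewrite ltnS.
Qed.

Lemma pr_partition_fin (I : finType) (phi : T -> I) A : measurable A ->
    (forall i, measurable [set w | phi w = i]) ->
  pr A = \sum_i pr (A `&` [set w | phi w = i]).
Proof.
move=> mA mphi.
have : (0 < #|I|)%N by apply/card_gt0P; exists (phi point).
case cI : #|I| => [//|K] _.
rewrite (@pr_partition (fun w => enum_rank (phi w)) A K)//; last 2 first.
- move=> k; rewrite (_ : [set w | _] = \bigcup_(i in [set i : I | enum_rank i = k :> nat]) [set w | phi w = i]).
    by apply: fin_bigcup_measurable => // i _.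
  by apply/seteqP; split => w /=; [move=> <-; exists (phi w)|move=> [i /= <- ->]].
- by move=> w; rewrite -ltnS -cI ltn_ord.
rewrite -(big_mkord xpredT (fun k => pr (A `&` [set w | enum_rank (phi w) = k :> nat]))) -cI big_mkord.
rewrite (reindex _ (onW_bij _ (@enum_rank_bij I)))/=.
by apply: eq_bigr => i _; congr pr; congr (_ `&` _); apply/seteqP; split => w /=; [move/val_inj/enum_rank_inj|move=> ->].
Qed.

End probability_real.

(** * Independent events added one at a time *)

Section cylinders_of_independent_families.
Context d (T : measurableType d) (R : realType) (P : probability T R).
Context (I : choiceType) (F : I -> set_system T).
Hypotheses (F_indep : mutually_independent P F) (F_meas : forall i A, F i A -> measurable A).

(** Only events of product form are considered. They are stable under intersection with an event of
    a fresh index, and recording [J] is what makes freshness checkable. *)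
Definition event_cylinder (J : {fset I}) (E : set T) :=
  exists A : I -> set T, (forall i, i \in J -> F i (A i)) /\ E = \bigcap_(i in [set` J]) A i.

Lemma event_cylinder0 : event_cylinder fset0 setT.
Proof.
exists (fun=> setT); split=> [i|]; first by rewrite inE.
by apply/seteqP; split.
Qed.

Lemma event_cylinder_measurable J E : event_cylinder J E -> measurable E.
Proof.
move=> [A [FA ->]]; apply: fin_bigcap_measurable; first exact: finite_fset.
by move=> i /FA/F_meas.
Qed.

Lemma event_cylinderI J E j B : event_cylinder J E -> j \notin J -> F j B ->
  event_cylinder (j |` J)%fset (E `&` B) /\ pr P (E `&` B) = pr P E * pr P B.
Proof.
move=> [A [FA EE]] jJ FB.
pose A' i := if i == j then B else A i.
have FA' i : i \in (j |` J)%fset -> F i (A' i).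
  by rewrite /A' in_fset1U; case: eqP => [->//|_ /= /FA].
have AA' : {in J, forall i, A' i = A i}.
  by move=> i iJ; rewrite /A'; case: eqP => // ij; rewrite ij (negbTE jJ) in iJ.
have EB : E `&` B = \bigcap_(i in [set` (j |` J)%fset]) A' i.
  rewrite EE; apply/seteqP; split => w.
    move=> [Ew Bw] i /=; rewrite /A' in_fset1U; case: eqP => // _ /= iJ; exact: Ew.
  move=> H; split; last by have := H j; rewrite /A' /= eqxx; apply; rewrite in_fset1U eqxx.
  by move=> i iJ; rewrite -(AA' i iJ); apply: H; rewrite /= in_fset1U [X in _ || X]iJ orbT.
split; first by exists A'.
apply/EFin_inj; rewrite EFinM -!prE; last 3 first.
- exact: F_meas FB.
- by apply: (@event_cylinder_measurable J); exists A.
- apply: measurableI; last exact: F_meas FB.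
  by apply: (@event_cylinder_measurable J); exists A.
rewrite EB F_indep// EE F_indep// big_fsetU1//= muleC; congr (_ * _)%E; last by rewrite /A' eqxx.
by rewrite big_seq [RHS]big_seq; apply: eq_bigr => i iJ; rewrite AA'.
Qed.

End cylinders_of_independent_families.

(** * Exponential moments in class E *)

Section exponential_moments.
Context d (T : measurableType d) (R : realType) (P : probability T R).
Variable X : {RV P >-> nat}.
Let f k : R := pr P [set w | X w = k].

Let measurable_X (A : set nat) : measurable (X @^-1` A).
Proof. by rewrite -[X in measurable X]setTI; exact: measurable_funPT. Qed.

Lemma sum_law_lt n : \sum_(k < n) f k = pr P [set w | (X w < n)%N].
Proof.
elim: n => [|n IH].
  by rewrite big_ord0 (_ : [set w | _] = set0) ?pr_set0//; apply/seteqP; split.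
rewrite big_ord_recr/= IH -prU.
- congr pr; apply/seteqP; split => w /=; first by case=> [|->//]; exact: ltnW.
  by rewrite ltnS leq_eqVlt => /predU1P[]; [right|left].
- exact: (measurable_X [set k | (k < n)%N]).
- exact: (measurable_X [set n]).
- by apply/seteqP; split => w //= [+ e]; rewrite e ltnn.
Qed.

Lemma sum_law_le1 n : \sum_(k < n) f k <= 1.
Proof.
rewrite sum_law_lt -(pr_setT P); apply: pr_le => //.
exact: (measurable_X [set k | (k < n)%N]).
Qed.

Lemma sum_law_cvg : (\sum_(k < n) f k) @[n --> \oo] --> (1 : R).
Proof.
pose F n := [set w | (X w < n)%N].
have mF n : measurable (F n) by exact: (measurable_X [set k | (k < n)%N]).
have UF : \bigcup_n F n = setT.
  by apply/seteqP; split => w // _; exists (X w).+1 => //=; rewrite /F/=.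
have : P \o F @ \oo --> P (\bigcup_n F n).
  apply: nondecreasing_cvg_mu => //; first by rewrite UF.
  by move=> m n mn; apply/subsetPset => w /=; rewrite /F/= => /leq_trans; apply.
rewrite UF probability_setT => H.
under eq_fun do rewrite sum_law_lt.
by have /fine_cvgP[_] := H.
Qed.

(** The atom that truncation creates at [K] has the mass of the tail from [K] on, which for
    [K >= k0] is again geometrically small; this gives a bound uniform in [K]. *)
Lemma classE_moment : classE X -> exists x C : R, [/\ 1 < x, 0 < C &
  forall K, \sum_(k < K.+1) trunc_law f K k * x ^+ k <= C].
Proof.
move=> [r [/andP[r0 r1] [k0 _ Hk0]]].
have fr k : (k0 <= k)%N -> f k <= r ^+ k.
  move=> /Hk0 h; rewrite -lee_fin -prE//; exact: (measurable_X [set k]).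
have f0 k : 0 <= f k by exact: pr_ge0.
have r1' : 0 < 1 - r by rewrite subr_gt0.
have tail K : (k0 <= K)%N -> 1 - \sum_(j < K) f j <= r ^+ K / (1 - r).
  move=> kK; rewrite lerBlDr.
  have /cvgP cvgf := sum_law_cvg; rewrite -[leLHS](cvg_lim _ sum_law_cvg)//.
  apply: limr_le => //; exists K => // n /= Kn.
  rewrite -(subnKC Kn) big_split_ord/= addrC lerD2r.
  apply: le_trans (_ : \sum_(i < n - K) r ^+ K * r ^+ i <= _).
    by apply: ler_sum => i _; rewrite -exprD fr// (leq_trans kK)// leq_addr.
  rewrite -mulr_sumr; apply: ler_wpM2l; first by rewrite exprn_ge0 ?ltW.
  by apply: geometric_sum_le; rewrite r0.
have trunc0 K k : 0 <= trunc_law f K k by apply: trunc_law_ge0 => //; exact: sum_law_le1.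
have f1 k : f k <= 1 by rewrite -(pr_setT P); apply: pr_le => //; exact: (measurable_X [set k]).
have trunc1 K k : trunc_law f K k <= 1.
  rewrite /trunc_law; case: ifP => // _; case: ifP => // _.
  by rewrite gerBl sumr_ge0.
have truncr K k : (k0 <= k)%N -> trunc_law f K k <= r ^+ k / (1 - r).
  move=> kk; rewrite /trunc_law; case: ifP => _.
    apply: le_trans (fr _ kk) _; rewrite ler_peMr ?exprn_ge0 ?(ltW r0)//.
    by rewrite invf_ge1// gerBl ltW.
  case: eqP => [kK|_]; first by subst k; exact: tail.
  by rewrite mulr_ge0 ?exprn_ge0 ?invr_ge0 ?ltW.
(* Chosen so that r x = (1 + r) / 2 is the midpoint of r and 1, while x > 1. *)
pose x := (1 + r) / (2 * r).
have rx : r * x = (1 + r) / 2 by rewrite /x; field; rewrite gt_eqF.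
have x1 : 1 < x by rewrite /x ltr_pdivlMr ?mulr_gt0// mul1r; lra.
have x0 : 0 < x by exact: lt_trans x1.
have rx01 : 0 < r * x < 1 by rewrite rx; lra.
have rx1 : 0 < 1 - r * x by rewrite subr_gt0; case/andP: rx01.
exists x, (k0%:R * x ^+ k0 + (1 - r * x)^-1 / (1 - r)); split => //.
  by rewrite ltr_wpDl ?mulr_ge0 ?exprn_ge0 ?(ltW x0)// divr_gt0// invr_gt0.
move=> K; rewrite (bigID (fun k : 'I_K.+1 => (k < k0)%N))/=; apply: lerD.
  apply: le_trans (_ : \sum_(k < K.+1 | (k < k0)%N) x ^+ k0 <= _).
    apply: ler_sum => k kk; rewrite -[leRHS]mul1r; apply: ler_pM; rewrite ?exprn_ge0 ?(ltW x0)//.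
    by rewrite ler_weXn2l ?(ltW x1)// ltnW.
  rewrite -(big_mkord (fun k => (k < k0)%N) (fun=> x ^+ k0)).
  apply: le_trans (_ : \sum_(0 <= k < k0 + K.+1 | (k < k0)%N) x ^+ k0 <= _).
    rewrite [leRHS](@big_cat_nat _ _ _ K.+1)//= ?leq_addl// lerDl.
    by apply: sumr_ge0 => k _; rewrite exprn_ge0 ?(ltW x0).
  rewrite (_ : \sum_(0 <= k < k0 + K.+1 | (k < k0)%N) x ^+ k0 = \sum_(0 <= k < k0) x ^+ k0); last first.
    by rewrite [RHS](big_nat_widen _ k0 (k0 + K.+1))//= leq_addr.
  by rewrite sumr_const_nat subn0 mulr_natl.
apply: le_trans (_ : \sum_(k < K.+1) (r * x) ^+ k / (1 - r) <= _).
  rewrite [leLHS]big_mkcond/=; apply: ler_sum => k _; case: ifPn => [kk|_].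
    rewrite [(r * x) ^+ k]exprMn [leRHS]mulrAC; apply: ler_wpM2r; first by rewrite exprn_ge0 ?ltW.
    by apply: truncr; rewrite leqNgt.
  by rewrite mulr_ge0 ?exprn_ge0 ?invr_ge0 ?(ltW r1')//; case/andP: rx01 => /ltW.
rewrite -mulr_suml ler_wpM2r ?invr_ge0 ?(ltW r1')//.
exact: geometric_sum_le.
Qed.

End exponential_moments.

(** A total inverse of [val]; its default value 1 at 0 is kept out by the guards [0 < y] in
    [occupied] and [observed]. *)
Definition pos_of (n : nat) : posnat := exist (fun n : nat => (0 < n)%N) n.-1.+1 isT.

Lemma val_pos_of n : (0 < n)%N -> val (pos_of n) = n.
Proof. by case: n. Qed.

Lemma pos_of_val (x : posnat) : pos_of (val x) = x.
Proof. by apply: val_inj; rewrite val_pos_of//; exact: (valP x). Qed.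

Definition occupied (C : configuration posnat) (y : nat) : bool :=
  (0 < y)%N && `[< C (pos_of y) >].

Definition observed (Y : {fset posnat}) (y : nat) : bool := (0 < y)%N && (pos_of y \in Y).

Section observed_sites.
Variable Y : {fset posnat}.

Lemma perm_observed M : (forall y, observed Y y -> (y < M)%N) ->
  perm_eq (map val Y) [seq y <- iota 0 M | observed Y y].
Proof.
move=> YM; apply: uniq_perm.
- by rewrite map_inj_uniq ?fset_uniq//; exact: val_inj.
- by rewrite filter_uniq// iota_uniq.
move=> y; rewrite mem_filter mem_iota add0n leq0n /=; apply/mapP/andP.
  move=> [x xY ->]; have ox : observed Y (val x) by rewrite /observed pos_of_val (valP x).
  by split => //; exact: YM.
by move=> [/andP[y0 yY] _]; exists (pos_of y) => //; rewrite val_pos_of.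
Qed.

Lemma npointsE (C : configuration posnat) M : (forall y, observed Y y -> (y < M)%N) ->
  npoints Y C = (\sum_(y <- iota 0 M) (observed Y y && occupied C y))%N.
Proof.
move=> YM; rewrite /npoints.
have -> : #|` [fset x in Y | `[< C x >]]%fset| = (\sum_(x <- Y) `[< C x >])%N.
  transitivity (size [seq x <- Y | `[< C x >]]).
    apply: perm_size; apply: uniq_perm; rewrite ?filter_uniq ?fset_uniq// => x.
    by rewrite mem_filter !inE/= andbC.
  by rewrite size_filter -sumn_count sumnE big_map.
transitivity (\sum_(y <- map val Y) occupied C y)%N.
  rewrite big_map; apply: eq_bigr => x _.
  by rewrite /occupied pos_of_val (valP x : (0 < val x)%N).
rewrite (perm_big _ (perm_observed YM))/= big_filter big_mkcond/=.
by apply: eq_bigr => y _; case: (observed Y y).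
Qed.

Lemma sum_observed (R : realType) L : (forall y, observed Y y -> (y <= L)%N) ->
  \sum_(0 <= t < L.+1) (observed Y t)%:R = #|` Y|%:R :> R.
Proof.
move=> YL; rewrite -natr_sum /index_iota subn0; congr _%:R.
have -> : #|` Y| = size (map val Y) by rewrite size_map.
rewrite (perm_size (perm_observed (M := L.+1) _))// size_filter -sumn_count.
by rewrite sumnE big_map.
Qed.

Lemma observed_bounded : exists L, forall y, observed Y y -> (y <= L)%N.
Proof.
exists (\max_(x <- Y) val x) => y /andP[y0 yY].
by rewrite -{1}(val_pos_of y0); apply: leq_bigmax_seq.
Qed.

End observed_sites.

Section patterns.

Lemma measurable_occupied y : measurable [set C : configuration posnat | occupied C y].
Proof.
have [->|y0] := posnP y; first by rewrite (_ : [set C | _] = set0)//; apply/seteqP; split.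
rewrite (_ : [set C | _] = [set C : configuration posnat | C (pos_of y)]).
  by apply: sub_sigma_algebra; exists (pos_of y).
by apply/seteqP; split => C /=; rewrite /occupied y0/= => /asboolP.
Qed.

(** The trace on [0, M) is kept in a finite type, so that conditioning on it is a finite sum. *)
Definition pattern M (C : configuration posnat) : M.-tuple bool :=
  [tuple occupied C i | i < M].

Lemma nth_pattern M C y : (y < M)%N -> nth false (pattern M C) y = occupied C y.
Proof.
by move=> yM; rewrite -[y]/(nat_of_ord (Ordinal yM)) -tnth_nth tnth_mktuple.
Qed.

Lemma measurable_pattern M B : measurable [set C : configuration posnat | pattern M C = B].
Proof.
rewrite (_ : [set C | _] = \bigcap_(i in [set: 'I_M]) [set C : configuration posnat | occupied C i = tnth B i]).
  apply: fin_bigcap_measurable => // i _; case: (tnth B i); first exact: measurable_occupied.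
  rewrite (_ : [set C | _] = ~` [set C : configuration posnat | occupied C i]).
    by apply: measurableC; exact: measurable_occupied.
  by apply/seteqP; split => C /=; [move=> ->|move/negP/negbTE].
apply/seteqP; split => C /=; first by move=> <- i _; rewrite tnth_mktuple.
by move=> CB; apply: eq_from_tnth => i; rewrite tnth_mktuple CB.
Qed.

Lemma measurable_npoints Y j : measurable [set C : configuration posnat | npoints Y C = j].
Proof.
have [L YL] := observed_bounded Y.
pose cnt (B : L.+1.-tuple bool) := (\sum_(y <- iota 0 L.+1) (observed Y y && nth false B y))%N.
have E C : npoints Y C = cnt (pattern L.+1 C).
  rewrite (@npointsE Y C L.+1) => [|y /YL//]; rewrite /cnt !big_seq.
  by apply: eq_bigr => y; rewrite mem_iota add0n => /andP[_ yL]; rewrite nth_pattern.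
rewrite (_ : [set C | _] = \bigcup_(B in [set B | cnt B = j]) [set C | pattern L.+1 C = B]).
  by apply: fin_bigcup_measurable => // B _; exact: measurable_pattern.
apply/seteqP; split => C /=; rewrite ?E; first by move=> <-; exists (pattern L.+1 C).
by move=> [B /= <- ->].
Qed.

End patterns.

(** * Bernoulli noise on a fixed pattern *)

Section noise.
Context d (T : measurableType d) (R : realType) (mu : probability T R).
Variables (Z : {RV mu >-> configuration posnat}) (removed born : posnat -> {RV mu >-> bool}).
Variables (p q : posnat -> R) (Y : {fset posnat}).
Let Fam (i : option (posnat + posnat)) : set_system T :=
  match i with
  | None => g_sigma_algebra_preimage Z
  | Some (inl x) => g_sigma_algebra_preimage (removed x)
  | Some (inr x) => g_sigma_algebra_preimage (born x)
  end.
Hypotheses (rem_p : forall x, mu [set w | removed x w] = (p x)%:E)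
  (born_q : forall x, mu [set w | born x w] = (q x)%:E)
  (indep : mutually_independent mu Fam).

Let noisyZ w := noisy (removed^~ w) (born^~ w) (Z w).

Definition birth_prob y : R := if observed Y y then q (pos_of y) else 0.
Definition survival_prob y : R := if observed Y y then 1 - p (pos_of y) else 0.

Definition pattern_probs (o : nat -> bool) (l : seq nat) : seq R :=
  [seq if o y then survival_prob y else birth_prob y | y <- l].

Let measurable_bool d' (T' : measurableType d') (X : {RV mu >-> bool}) (A : set bool) :
  g_sigma_algebra_preimage X (X @^-1` A).
Proof. by exists A; rewrite ?setTI. Qed.

Let Fam_meas i A : Fam i A -> measurable A.
Proof.
by case: i => [[x|x]|] [B mB <-]; apply: measurable_funPT.
Qed.

(** On [E] the occupation of the listed sites is known, so at an observed site one single trial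
    decides: removal if occupied, birth if empty. Its index is not in [J], hence it splits [E] with
    the right probability, and [x] accumulates the points found so far. *)
Lemma noise_count (l : seq nat) (o : nat -> bool) J E x j : uniq l ->
    event_cylinder Fam J E ->
    (forall w, E w -> forall y, y \in l -> occupied (Z w) y = o y) ->
    (forall y, y \in l -> observed Y y ->
       Some (inl (pos_of y)) \notin J /\ Some (inr (pos_of y)) \notin J) ->
  let D := [set w | (x + \sum_(y <- l) (observed Y y && occupied (noisyZ w) y))%N = j] in
  measurable (E `&` D) /\
  pr mu (E `&` D) = pr mu E * bern (pattern_probs o l) (fun z => (z == j)%:R) x.
Proof.
elim: l J E x => [|y l IH] J E x /=.
  move=> _ cE _ _; have mE := event_cylinder_measurable Fam_meas cE.
  have [xj|xj] := eqVneq x j.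
    rewrite (_ : _ `&` _ = E) ?mulr1//; apply/setIidl => w _ /=.
    by rewrite big_nil addn0.
  rewrite (_ : _ `&` _ = set0) ?pr_set0 ?mulr0//; apply/seteqP; split => w //= [_].
  by rewrite big_nil addn0 => /eqP; rewrite (negbTE xj).
move=> /andP[yl ul] cE Eo lJ.
have Eo' : forall w, E w -> forall y', y' \in l -> occupied (Z w) y' = o y'.
  by move=> w Ew y' y'l; apply: Eo => //; rewrite inE y'l orbT.
have lJ' : forall y', y' \in l -> observed Y y' ->
    Some (inl (pos_of y')) \notin J /\ Some (inr (pos_of y')) \notin J.
  by move=> y' y'l; apply: lJ; rewrite inE y'l orbT.
have [oy|oy] := boolP (observed Y y); last first.
  rewrite /survival_prob /birth_prob (negbTE oy) if_same mul0r addr0 subr0 mul1r.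
  have [m1 p1] := IH J E x ul cE Eo' lJ'.
  by under eq_set do rewrite big_cons (negbTE oy) add0n; split.
have y0 : (0 < y)%N by case/andP: oy.
pose i := if o y then Some (inl (pos_of y)) else Some (inr (pos_of y)) : option (posnat + posnat).
pose B := if o y then ~` [set w | removed (pos_of y) w] else [set w | born (pos_of y) w].
pose s := if o y then survival_prob y else birth_prob y.
have iJ : i \notin J.
  by have [] := lJ y (mem_head _ _) oy; rewrite /i; case: (o y).
have FB : Fam i B.
  rewrite /i /B; case: (o y) => /=.
    exact: (measurable_bool _ (removed (pos_of y)) (~` [set b | b])).
  exact: (measurable_bool _ (born (pos_of y)) [set b | b]).
have FBC : Fam i (~` B).
  rewrite /i /B; case: (o y) => /=.
    by rewrite setCK; exact: (measurable_bool _ (removed (pos_of y)) [set b | b]).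
  exact: (measurable_bool _ (born (pos_of y)) (~` [set b | b])).
have mB : measurable B := Fam_meas FB.
have prB : pr mu B = s.
  rewrite /B /s /survival_prob /birth_prob oy; case: (o y); last by rewrite /pr born_q.
  rewrite pr_setC; first by rewrite /pr rem_p.
  by apply: (@Fam_meas (Some (inl (pos_of y)))); exact: (measurable_bool _ (removed (pos_of y)) [set b | b]).
have [cEB pEB] := event_cylinderI indep Fam_meas cE iJ FB.
have [cEC pEC] := event_cylinderI indep Fam_meas cE iJ FBC.
have lJi : forall y', y' \in l -> observed Y y' ->
    Some (inl (pos_of y')) \notin (i |` J)%fset /\ Some (inr (pos_of y')) \notin (i |` J)%fset.
  move=> y' y'l oy'; have [h1 h2] := lJ' y' y'l oy'.
  (* On positive numbers [pos_of] is injective, so distinct sites use distinct trials. *)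
  have ne : pos_of y' != pos_of y.
    apply/eqP => /(congr1 val); rewrite !val_pos_of//; last by case/andP: oy'.
    by move=> e; move: yl; rewrite -e y'l.
  rewrite !in_fset1U !negb_or h1 h2 !andbT /i; case: (o y); split => //.
have eta w : E w -> occupied (noisyZ w) y = (w \in B).
  move=> Ew; have := Eo w Ew y (mem_head _ _); rewrite /occupied y0/= => Zy.
  rewrite /B -Zy; apply/asboolP/idP; case: asboolP => Zw /=.
  - by move=> [[_ h]|[]//]; rewrite inE /=; exact/negP.
  - by move=> [[]//|[_ h]]; rewrite inE.
  - by rewrite inE /= => /negP h; left.
  - by rewrite inE /= => h; right.
have [m1 p1] := IH _ _ x.+1 ul cEB (fun w Ew => Eo' w Ew.1) lJi.
have [m2 p2] := IH _ _ x ul cEC (fun w Ew => Eo' w Ew.1) lJi.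
set D1 := [set w | (x.+1 + _)%N = j] in m1 p1.
set D2 := [set w | (x + \sum_(y <- l) _)%N = j] in m2 p2.
have ED : E `&` [set w | (x + \sum_(y <- y :: l) (observed Y y && occupied (noisyZ w) y))%N = j] =
    (E `&` B `&` D1) `|` (E `&` ~` B `&` D2).
  apply/seteqP; split => w.
    move=> [Ew] /=; rewrite big_cons oy eta//=.
    case: (boolP (w \in B)) => [/set_mem Bw|/negP Bw] /= Dw; [left|right]; split => //.
    - by rewrite /D1/= addSnnS.
    - by split => // Bw'; apply: Bw; exact: mem_set.
  move=> [[[Ew Bw] Dw]|[[Ew Bw] Dw]]; split => //=; rewrite big_cons oy eta//=.
    by rewrite mem_set//= addnA addn1.
  by rewrite memNset.
rewrite ED; split; first exact: measurableU.
rewrite prU//; last by apply/seteqP; split => w //= [[[_ Bw] _] [[_ /(_ Bw)]]].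
rewrite p1 p2 pEB pEC pr_setC// prB -/s; ring.
Qed.

End noise.

(** * Law of the renewal pattern *)

Section renewal_law.
Context d (T : measurableType d) (R : realType) (P : probability T R).
Variable xi : nat -> {RV P >-> nat}.
Hypotheses (xi_gt0 : forall i w, (0 < xi i w)%N) (xi_indep : mutually_independent_RV xi)
  (xi_common : forall i, (1 <= i)%N -> distribution P (xi i) =1 distribution P (xi 1%N)).
Variables (L K : nat) (b c : nat -> R).
Hypotheses (LK : (L < K)%N) (b_gt : forall t, (L < t)%N -> b t = 0)
  (c_gt : forall t, (L < t)%N -> c t = 0).

Definition step_law i k : R := pr P [set w | xi i w = k].

Let Fam i := g_sigma_algebra_preimage (xi i).
(* Since [L < K], truncated steps produce the same configuration on [0, L]. *)
Let tau i w := minn (xi i w) K.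
Let X w := renewal_config xi w.

Let Fam_set i (A : set nat) : Fam i (xi i @^-1` A).
Proof. by exists A; rewrite ?setTI. Qed.

Let Fam_meas i A : Fam i A -> measurable A.
Proof. by move=> [B mB <-]; apply: measurable_funPT. Qed.

Let Fam_indep : mutually_independent P Fam := xi_indep.

Lemma step_law_common i k : (1 <= i)%N -> step_law i k = step_law 1 k.
Proof.
move=> i1; rewrite /step_law /pr; congr fine.
by have := xi_common i1 [set k]; rewrite /distribution /pushforward /=.
Qed.

Lemma step_law_ge0 i k : 0 <= step_law i k.
Proof. exact: pr_ge0. Qed.

Lemma step_law0 i : step_law i 0 = 0.
Proof.
rewrite /step_law (_ : [set w | _] = set0) ?pr_set0//.
by apply/seteqP; split => w //= e; have := xi_gt0 i w; rewrite e.
Qed.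

Let measurable_step i (A : set nat) : measurable (xi i @^-1` A).
Proof. exact: Fam_meas (Fam_set i A). Qed.

Lemma pr_tau i k : pr P [set w | tau i w = k] = trunc_law (step_law i) K k.
Proof.
rewrite /trunc_law; case: (ltngtP k K) => kK.
- by congr pr; apply/seteqP; split => w /=; rewrite /tau; move: kK; clear; lia.
- rewrite (_ : [set w | _] = set0) ?pr_set0//; apply/seteqP; split => w //=.
  by rewrite /tau; move: kK; clear; lia.
- rewrite sum_law_lt -pr_setC; last exact: (measurable_step i [set k | (k < K)%N]).
  by congr pr; apply/seteqP; split => w /=; rewrite /tau kK; clear; lia.
Qed.

Let path_event (ts : seq nat) := [set w | forall j, (j < size ts)%N -> tau j w = nth 0%N ts j].

Let path_rcons ts k :
  path_event (rcons ts k) = path_event ts `&` [set w | tau (size ts) w = k].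
Proof.
apply/seteqP; split => w /=.
  move=> H; split => [j jt|]; first by rewrite H ?size_rcons ?nth_rcons ?jt// ltnW.
  by rewrite H ?size_rcons// nth_rcons ltnn eqxx.
move=> [H e] j; rewrite size_rcons ltnS leq_eqVlt nth_rcons => /predU1P[->|jt].
  by rewrite ltnn eqxx.
by rewrite jt H.
Qed.

Let Fam_tau i k : Fam i [set w | tau i w = k].
Proof. exact: (Fam_set i [set j | minn j K = k]). Qed.

(** The indices stay below [size ts], so the next step is always fresh. *)
Let path_cylinder ts : exists2 J, event_cylinder Fam J (path_event ts) &
  forall j, j \in J -> (j < size ts)%N.
Proof.
elim/last_ind: ts => [|ts k [J cJ Jt]].
  exists fset0 => // ; rewrite (_ : path_event _ = setT); first exact: event_cylinder0.
  by apply/seteqP; split.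
have sJ : size ts \notin J by apply/negP => /Jt; rewrite ltnn.
have [cE _] := event_cylinderI Fam_indep Fam_meas cJ sJ (Fam_tau (size ts) k).
exists (size ts |` J)%fset; first by rewrite path_rcons.
by move=> j; rewrite in_fset1U size_rcons ltnS => /orP[/eqP->//|/Jt/ltnW].
Qed.

Let path_measurable ts : measurable (path_event ts).
Proof. by have [J cJ _] := path_cylinder ts; exact: event_cylinder_measurable cJ. Qed.

Let pr_path_rcons ts k : pr P (path_event (rcons ts k)) =
  pr P (path_event ts) * trunc_law (step_law (size ts)) K k.
Proof.
have [J cJ Jt] := path_cylinder ts.
have sJ : size ts \notin J by apply/negP => /Jt; rewrite ltnn.
have [_ pE] := event_cylinderI Fam_indep Fam_meas cJ sJ (Fam_tau (size ts) k).
by rewrite path_rcons pE pr_tau.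
Qed.

Let psums (ts : seq nat) := [seq sumn (take i.+1 ts) | i <- iota 0 (size ts)].

Let site (o : nat -> bool) y : R := if o y then c y else b y.

Let blocks (ts : seq nat) := [seq site (fun x => x \in psums ts) y | y <- iota 0 (sumn ts)].

Let psums_rcons ts k : psums (rcons ts k) = rcons (psums ts) (sumn ts + k).
Proof.
rewrite /psums size_rcons -addn1 iotaD map_cat/= add0n -[RHS]cats1; congr (_ ++ _).
  apply/eq_in_map => i; rewrite mem_iota add0n => /andP[_ it].
  by rewrite -cats1 takel_cat.
by rewrite -(size_rcons ts k) take_size sumn_rcons.
Qed.

Let sumn_take_le i (ts : seq nat) : (sumn (take i ts) <= sumn ts)%N.
Proof. by rewrite -{2}(cat_take_drop i ts) sumn_cat leq_addr. Qed.

(** A further step puts its renewal at or after [sumn ts], which leaves the earlier sites alone and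
    makes [sumn ts] the only renewal of the new block. For empty [ts] this fails: the origin is not
    a renewal. *)
Let blocks_rcons ts k : ts != [::] ->
  blocks (rcons ts k) = blocks ts ++ site_probs b c (sumn ts) k.
Proof.
move=> ts0; rewrite /blocks sumn_rcons iotaD map_cat add0n; congr (_ ++ _).
  apply/eq_in_map => y; rewrite mem_iota add0n => /andP[_ yt].
  rewrite /site psums_rcons; congr (if _ then _ else _) => /=.
  rewrite mem_rcons inE; case: eqP => // e.
  by move: yt; rewrite e ltnNge leq_addr.
case: k => [//|k] /=; congr (_ :: _).
  rewrite /site psums_rcons (_ : (sumn ts \in _) = true)//= mem_rcons inE; apply/orP; right.
  apply/mapP; exists (size ts).-1; last by rewrite prednK ?take_size// lt0n size_eq0.
  by rewrite mem_iota add0n/= prednK// lt0n size_eq0.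
apply/eq_in_map => y; rewrite mem_iota => /andP[yt yk].
rewrite /site psums_rcons (_ : (y \in _) = false)//=; apply/negbTE.
rewrite mem_rcons inE negb_or; apply/andP; split; first by apply/eqP; move: yk; clear; lia.
apply/mapP => -[i _ e]; have := sumn_take_le i.+1 ts; rewrite -e; move: yt; clear; lia.
Qed.

Let blocks1 k : blocks [:: k] = empty_probs b k.
Proof.
rewrite /blocks /empty_probs /= addn0; apply/eq_in_map => y; rewrite mem_iota add0n => /andP[_ yk].
by rewrite /site /psums/= addn0 inE; case: eqP => // e; move: yk; rewrite e ltnn.
Qed.

Let sumn_take_nth (ts : seq nat) i : sumn (take i ts) = (\sum_(0 <= j < i) nth 0%N ts j)%N.
Proof.
elim: i ts => [|i IH] ts; first by rewrite take0 big_geq.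
case: ts => [|t ts]; first by rewrite [RHS]big1// => j _; rewrite nth_nil.
by rewrite big_nat_recl//= IH.
Qed.

(** A partial sum of truncated steps that is at most [L < K] contains no truncated step, so it is a
    true partial sum; and once the path has passed [L], no later renewal falls in [0, L]. *)
Let path_occupied ts w y : path_event ts w -> (L < sumn ts)%N -> (y <= L)%N ->
  occupied (X w) y = (y \in psums ts).
Proof.
move=> Ew Lts yL.
have sum_tau i : (i <= size ts)%N ->
    sumn (take i ts) = (\sum_(0 <= j < i) tau j w)%N.
  move=> it; rewrite sumn_take_nth big_nat [RHS]big_nat; apply: eq_bigr => j /andP[_ ji].
  by rewrite Ew// (leq_trans ji).
have psE i w' : partial_sum xi i w' = (\sum_(0 <= j < i.+1) xi j w')%N.
  by rewrite /partial_sum big_mkord.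
have tau_le j : (tau j w <= xi j w)%N by rewrite /tau geq_minl.
have small i : (\sum_(0 <= j < i) tau j w <= L)%N ->
    (\sum_(0 <= j < i) tau j w)%N = (\sum_(0 <= j < i) xi j w)%N.
  move=> le; rewrite big_nat [RHS]big_nat; apply: eq_bigr => j /andP[_ ji].
  have : (tau j w < K)%N.
    apply: leq_ltn_trans LK; apply: leq_trans le.
    by rewrite (big_cat_nat (n := j))//=; [rewrite (big_ltn ji) addnCA leq_addr|exact: ltnW].
  by rewrite /tau; clear; lia.
apply/idP/mapP.
  move=> /andP[y0 /asboolP[i]]; rewrite val_pos_of// psE => e.
  have sle : (\sum_(0 <= j < i.+1) tau j w <= y)%N by rewrite -e; apply: leq_sum.
  have it : (i < size ts)%N.
    rewrite ltnNge; apply/negP => ti.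
    have : (sumn ts <= y)%N.
      rewrite -(take_size ts) sum_tau//; apply: leq_trans sle.
      by rewrite [leqRHS](big_cat_nat (n := size ts))//=; [exact: leq_addr|exact: leqW].
    by move: Lts yL; clear; lia.
  exists i; first by rewrite mem_iota.
  by rewrite sum_tau// small ?e// (leq_trans sle).
move=> [i]; rewrite mem_iota add0n => /andP[_ it] yE.
rewrite sum_tau// in yE.
have yx : y = (\sum_(0 <= j < i.+1) xi j w)%N by rewrite yE; apply: small; rewrite -yE.
have y0 : (0 < y)%N by rewrite yx big_nat_recl// (leq_trans (xi_gt0 0 w))// leq_addr.
by rewrite /occupied y0/=; apply/asboolP; exists i; rewrite psE val_pos_of.
Qed.

Let pattern_measurable M (B : M.-tuple bool) : measurable [set w | pattern M (X w) = B].
Proof.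
rewrite -[X in measurable X]setTI.
exact: (measurable_renewal_config xi measurableT (measurable_pattern B)).
Qed.

Let weight (F : nat -> R) (B : L.+1.-tuple bool) :=
  bern [seq site (nth false B) y | y <- iota 0 L.+1] F 0.

Let g := trunc_law (step_law 1) K.

(** Induction on the number of blocks still to come. With none left the path determines the pattern;
    otherwise the event is partitioned by the value of the next truncated step, whose block is
    appended. *)
Lemma renewal_pattern_path n (F : nat -> R) ts : ts != [::] -> (L < sumn ts + n)%N ->
  \sum_(B : L.+1.-tuple bool) pr P (path_event ts `&` [set w | pattern L.+1 (X w) = B]) * weight F B =
  pr P (path_event ts) * bern (blocks ts) (renewal_expect K g b c n (sumn ts) F) 0.
Proof.
elim: n ts => [|n IH] ts ts0; rewrite ?addn0 => Lts.
  have [[w Ew]|noE] := pselect (exists w, path_event ts w); last first.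
    have E0 : path_event ts = set0 by apply/seteqP; split => w // Ew; apply: noE; exists w.
    by rewrite E0 pr_set0 mul0r big1// => B _; rewrite set0I pr_set0 mul0r.
  rewrite (bigD1 (pattern L.+1 (X w)))//= big1 ?addr0 => [|B /eqP BX].
    have -> : path_event ts `&` [set w' | pattern L.+1 (X w') = pattern L.+1 (X w)] = path_event ts.
      apply/setIidl => w' Ew' /=; apply: eq_from_tnth => i; rewrite !tnth_mktuple.
      have iL : (i <= L)%N by rewrite -ltnS.
      by rewrite (path_occupied Ew' Lts iL) (path_occupied Ew Lts iL).
    congr (_ * _); rewrite /weight /blocks.
    rewrite -(subnKC Lts) iotaD map_cat bern_cat.
    have -> : [seq site (nth false (pattern L.+1 (X w))) y | y <- iota 0 L.+1] =
              [seq site (fun x => x \in psums ts) y | y <- iota 0 L.+1].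
      apply/eq_in_map => y; rewrite mem_iota add0n => /andP[_ yL].
      rewrite ltnS in yL; by rewrite /site nth_pattern// (path_occupied Ew Lts yL).
    (* The last block may overshoot [L], but sites beyond [L] have parameter 0. *)
    apply: bern_ext => z _; rewrite bern_nseq0//; apply/allP => s /mapP[y].
    rewrite mem_iota add0n => /andP[Ly _] ->.
    by rewrite /site; case: ifP => _; rewrite ?c_gt ?b_gt.
  rewrite (_ : _ `&` _ = set0) ?pr_set0 ?mul0r//; apply/seteqP; split => w' // [Ew' /= e].
  apply: BX; rewrite -e; apply: eq_from_tnth => i; rewrite !tnth_mktuple.
  have iL : (i <= L)%N by rewrite -ltnS.
  by rewrite (path_occupied Ew' Lts iL) (path_occupied Ew Lts iL).
have tauK w : (tau (size ts) w <= K)%N by rewrite /tau geq_minr.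
under eq_bigr => B _.
  rewrite (@pr_partition _ _ _ P (tau (size ts)) _ K)//; last 2 first.
  - exact: measurableI.
  - by move=> k; exact: Fam_meas (Fam_tau _ _).
  rewrite mulr_suml; over.
rewrite exchange_big/=.
have -> : bern (blocks ts) (renewal_expect K g b c n.+1 (sumn ts) F) 0 =
    \sum_(k < K.+1) g k * bern (blocks ts ++ site_probs b c (sumn ts) k)
                              (renewal_expect K g b c n (sumn ts + k) F) 0.
  rewrite /= (bern_sum (blocks ts) K.+1 g (fun k => bern (site_probs b c (sumn ts) k)
      (renewal_expect K g b c n (sumn ts + k) F))).
  by apply: eq_bigr => k _; rewrite bern_cat.
rewrite mulr_sumr; apply: eq_bigr => k _.
have gE : g k = trunc_law (step_law (size ts)) K k.
  congr (trunc_law _ K k); apply/funext => j; apply/esym/step_law_common.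
  by rewrite lt0n size_eq0.
rewrite mulrA gE -pr_path_rcons -blocks_rcons// -sumn_rcons.
(* A step of length 0 makes no progress towards [L], so the induction hypothesis is out of reach; it
   has probability 0. *)
have [k0|k0] := posnP k.
  have g0 : pr P (path_event (rcons ts k)) = 0.
    by rewrite pr_path_rcons -gE k0 /g trunc_law_lt ?step_law0 ?mulr0// (leq_ltn_trans _ LK).
  rewrite g0 mul0r big1// => B _.
  suff -> : pr P (path_event ts `&` [set w | pattern L.+1 (X w) = B] `&` [set w | tau (size ts) w = k]) = 0.
    by rewrite mul0r.
  apply/eqP; rewrite eq_le pr_ge0 andbT -g0 path_rcons; apply: pr_le.
  - by apply: measurableI; [exact: measurableI|exact: Fam_meas (Fam_tau _ _)].
  - by apply: measurableI => //; exact: Fam_meas (Fam_tau _ _).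
  - by move=> w [[]].
rewrite -IH; last 2 first.
- by case: (ts).
- by rewrite sumn_rcons; move: Lts k0; clear; lia.
by apply: eq_bigr => B _; rewrite path_rcons setIAC.
Qed.

Lemma renewal_pattern_expect n (F : nat -> R) : (L < n)%N ->
  \sum_(B : L.+1.-tuple bool) pr P [set w | pattern L.+1 (X w) = B] * weight F B =
  delayed_expect K (trunc_law (step_law 0) K) (trunc_law (step_law 1) K) b c n F.
Proof.
move=> Ln; have tauK w : (tau 0 w <= K)%N by rewrite /tau geq_minr.
under eq_bigr => B _.
  rewrite (@pr_partition _ _ _ P (tau 0) _ K)//; last first.
    by move=> k; exact: Fam_meas (Fam_tau _ _).
  rewrite mulr_suml; over.
rewrite exchange_big/=; apply: eq_bigr => k _.
have E0 : path_event [::] = setT by apply/seteqP; split.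
have p1 : pr P (path_event [:: nat_of_ord k]) = trunc_law (step_law 0) K k.
  by rewrite -[[:: _]]/(rcons [::] _) pr_path_rcons E0 pr_setT mul1r.
have sk : sumn [:: nat_of_ord k] = k by rewrite /= addn0.
have Lk : (L < sumn [:: nat_of_ord k] + n)%N by rewrite (leq_trans Ln)// leq_addl.
have := @renewal_pattern_path n F [:: nat_of_ord k] isT Lk.
rewrite sk blocks1 p1 => <-.
apply: eq_bigr => B _; rewrite -[[:: _]]/(rcons [::] _) path_rcons E0 setTI.
by rewrite setIC.
Qed.

End renewal_law.

Section linearity.
Context {R : realType}.
Implicit Types (F G : nat -> R).

Lemma renewal_expect_ext K g b c n s F G x :
    (forall z, (x <= z <= x + n * K)%N -> F z = G z) ->
  renewal_expect K g b c n s F x = renewal_expect K g b c n s G x.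
Proof.
elim: n s x => [|n IH] s x FG /=; first by apply: FG; rewrite mul0n addn0 leqnn.
apply: eq_bigr => k _; congr (_ * _); apply: bern_ext => z zP; apply: IH => y yP; apply: FG.
have : (size (site_probs b c s k) <= K)%N.
  case: k zP => -[|k] kK _ //=; rewrite size_map size_iota.
  by rewrite -ltnS.
by move: zP yP; rewrite mulSn; clear; lia.
Qed.

Lemma delayed_expect_ext K g0 g b c n F G :
    (forall z, (z <= n.+1 * K)%N -> F z = G z) ->
  delayed_expect K g0 g b c n F = delayed_expect K g0 g b c n G.
Proof.
move=> FG; apply: eq_bigr => k _; congr (_ * _); apply: bern_ext => z.
rewrite /empty_probs size_map size_iota add0n => /andP[_ zk].
apply: renewal_expect_ext => y /andP[_ yz]; apply: FG.
have kK : (k <= K)%N by rewrite -ltnS.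
by move: yz zk kK; rewrite mulSn; clear; lia.
Qed.

Lemma renewal_expect_sum K g b c n s J (a : nat -> R) (G : nat -> nat -> R) x :
  renewal_expect K g b c n s (fun z => \sum_(i < J) a i * G i z) x =
  \sum_(i < J) a i * renewal_expect K g b c n s (G i) x.
Proof.
elim: n s x => [//|n IH] s x /=.
under [RHS]eq_bigr => i _ do rewrite mulr_sumr.
rewrite exchange_big/=; apply: eq_bigr => k _.
have -> : renewal_expect K g b c n (s + k) (fun z => \sum_(i < J) a i * G i z) =
    fun z => \sum_(i < J) a i * renewal_expect K g b c n (s + k) (G i) z.
  by apply/funext => z; exact: IH.
rewrite (bern_sum _ _ a (fun i => renewal_expect K g b c n (s + k) (G i))) mulr_sumr.
by apply: eq_bigr => i _; rewrite mulrCA.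
Qed.

Lemma delayed_expect_sum K g0 g b c n J (a : nat -> R) (G : nat -> nat -> R) :
  delayed_expect K g0 g b c n (fun z => \sum_(i < J) a i * G i z) =
  \sum_(i < J) a i * delayed_expect K g0 g b c n (G i).
Proof.
under [RHS]eq_bigr => i _ do rewrite mulr_sumr.
rewrite exchange_big/=; apply: eq_bigr => k _.
have -> : renewal_expect K g b c n k (fun z => \sum_(i < J) a i * G i z) =
    fun z => \sum_(i < J) a i * renewal_expect K g b c n k (G i) z.
  by apply/funext => z; exact: renewal_expect_sum.
rewrite (bern_sum _ _ a (fun i => renewal_expect K g b c n k (G i))) mulr_sumr.
by apply: eq_bigr => i _; rewrite mulrCA.
Qed.

Lemma sum_indicators J (F : nat -> R) z : (z < J)%N ->
  F z = \sum_(j < J) F j * (z == j)%:R.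
Proof.
move=> zJ; rewrite (bigD1 (Ordinal zJ))//= eqxx mulr1 big1 ?addr0// => j jz.
rewrite (_ : (z == j) = false) ?mulr0//; apply/negbTE.
by apply: contra jz => /eqP e; apply/eqP/val_inj.
Qed.

(** The count is at most [n.+1 * K]: the initial block and [n] further ones hold at most [K] sites
    each. An expectation is therefore determined by the point probabilities. *)
Lemma delayed_expect_indicators K g0 g b c n F :
  delayed_expect K g0 g b c n F =
  \sum_(j < (n.+1 * K).+1) F j * delayed_expect K g0 g b c n (fun z => (z == j)%:R).
Proof.
rewrite -(delayed_expect_sum K g0 g b c n (n.+1 * K).+1 F (fun j z => (z == j)%:R)).
by apply: delayed_expect_ext => z zK; apply: sum_indicators.
Qed.

End linearity.

Section finitely_valued_expectation.
Context d (T : measurableType d) (R : realType) (Q : probability T R).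
Variables (X : T -> nat) (J : nat).
Hypotheses (mX : forall j, measurable [set w | X w = j]) (XJ : forall w, (X w < J)%N).

Lemma expectation_finite (F : nat -> R) :
  'E_Q[fun w => F (X w)]%E = (\sum_(j < J) F j * pr Q [set w | X w = j])%:E.
Proof.
rewrite unlock.
have -> : (fun w => (F (X w))%:E) =
    (fun w => (\sum_(j < J) F j * \1_[set w | X w = j] w)%:E).
  apply/funext => w; rewrite (sum_indicators F (XJ w)); congr (_%:E).
  apply: eq_bigr => j _; rewrite indicE; congr (_ * (nat_of_bool _)%:R).
  by apply/eqP/idP => [e|]; [exact/mem_set|move/set_mem].
suff H n : Q.-integrable setT (EFin \o (fun w => \sum_(j < n) F j * \1_[set w | X w = j] w)) /\
  (\int[Q]_w (\sum_(j < n) F j * \1_[set w | X w = j] w)%:E =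
   (\sum_(j < n) F j * pr Q [set w | X w = j])%:E)%E by have [_] := H J.
elim: n => [|n [I1 E1]].
  have -> : (fun w => \sum_(j < 0) F j * \1_[set w | X w = j] w) = (fun=> 0) :> (T -> R).
    by apply/funext => w; rewrite big_ord0.
  rewrite big_ord0; split; first exact: integrable0.
  by under eq_integral do rewrite big_ord0; rewrite integral0.
have I2 : Q.-integrable setT (EFin \o (fun w => F n * \1_[set w | X w = n] w)).
  have := integrableZl measurableT (F n) (integrable_indic Q (mX n)).
  by congr (integrable _ _ _); apply/funext => w /=; rewrite EFinM.
have E : (fun w => \sum_(j < n.+1) F j * \1_[set w | X w = j] w) =
    (fun w => \sum_(j < n) F j * \1_[set w | X w = j] w + F n * \1_[set w | X w = n] w).
  by apply/funext => w; rewrite big_ord_recr.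
split.
  rewrite E; have := integrableD measurableT I1 I2.
  by congr (integrable _ _ _); apply/funext => w /=; rewrite EFinD.
under eq_integral do rewrite big_ord_recr/=.
have := integralD_EFin measurableT I1 I2 => /=.
under eq_integral do rewrite -EFinD.
move=> ->; rewrite E1 big_ord_recr/= EFinD; congr (_ + _)%E.
under eq_integral do rewrite EFinM.
rewrite integralZl//; last exact: integrable_indic.
by rewrite EFinM -prE//; congr (_ * _)%E; rewrite integral_indic// setIT.
Qed.

End finitely_valued_expectation.

Section noisy_renewal_law.
Context d (T : measurableType d) (R : realType) (P : probability T R).
Variable xi : nat -> {RV P >-> nat}.
Hypotheses (xi_gt0 : forall i w, (0 < xi i w)%N) (xi_indep : mutually_independent_RV xi)
  (xi_common : forall i, (1 <= i)%N -> distribution P (xi i) =1 distribution P (xi 1%N)).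
Variables (p q : posnat -> R) (Q : probability (configuration posnat) R).
Hypothesis Q_noise : bernoulli_noise (renewal_process xi) p q Q.
Variables (Y : {fset posnat}) (L K n : nat).
Hypotheses (YL : forall y, observed Y y -> (y <= L)%N) (LK : (L < K)%N) (Ln : (L < n)%N).

Let E := delayed_expect K (trunc_law (step_law xi 0) K) (trunc_law (step_law xi 1) K)
  (birth_prob q Y) (survival_prob p Y) n.

(** Condition on the pattern of [Z] up to [L]: this event involves the index [None] only, so all
    trials are still fresh for [noise_count], and the sum over patterns is
    [renewal_pattern_expect]. *)
Lemma noisy_renewal_npoints j :
  pr Q [set C | npoints Y C = j] = E (fun z => (z == j)%:R).
Proof.
have [d' [T' [mu [Z [removed [born [ZP rem_p born_q indep Qmu]]]]]]] := Q_noise.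
pose noisyZ w := noisy (removed^~ w) (born^~ w) (Z w).
pose pat w := pattern L.+1 (Z w).
have mpat B : measurable [set w | pat w = B].
  have := measurable_pattern B; rewrite -[X in _ -> measurable X]setTI.
  apply: (@measurable_funPT _ _ _ _ Z measurableT).
pose D := [set w | npoints Y (noisyZ w) = j].
pose l := iota 0 L.+1.
have DE : D = [set w | (0 + \sum_(y <- l) (observed Y y && occupied (noisyZ w) y))%N = j].
  apply/seteqP; split => w /=; rewrite /D/= (@npointsE Y _ L.+1)// => y /YL//.
have H B : measurable ([set w | pat w = B] `&` D) /\
    pr mu ([set w | pat w = B] `&` D) =
    pr mu [set w | pat w = B] *
    bern (pattern_probs p q Y (nth false B) l) (fun z => (z == j)%:R) 0.
  rewrite DE.
  apply: (noise_count rem_p born_q indep (J := [fset None]%fset)).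
  - exact: iota_uniq.
  - exists (fun=> [set w | pat w = B]); split.
      move=> i; rewrite in_fset1 => /eqP ->.
      by exists [set C | pattern L.+1 C = B]; [exact: measurable_pattern|rewrite setTI].
    apply/seteqP; split => w /=; first by move=> ? i _.
    by move=> h; apply: (h None); rewrite /= in_fset1.
  - move=> w <- y; rewrite mem_iota add0n => /andP[_ yL].
    by rewrite nth_pattern.
  - by move=> y _ _; rewrite !in_fset1.
have mD : measurable D.
  rewrite (_ : D = \bigcup_(B in setT) ([set w | pat w = B] `&` D)).
    by apply: fin_bigcup_measurable => // B _; exact: (H B).1.
  by apply/seteqP; split => w; [move=> Dw; exists (pat w)|move=> [B _ []]].
have -> : pr Q [set C | npoints Y C = j] = pr mu D.
  by rewrite /pr Qmu//; exact: measurable_npoints.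
rewrite (pr_partition_fin mu mD mpat).
rewrite /E -(renewal_pattern_expect xi_gt0 xi_indep xi_common LK _ _ _ Ln)/=; last 2 first.
- by move=> t Lt; rewrite /birth_prob; case: ifP => // /YL; rewrite leqNgt Lt.
- by move=> t Lt; rewrite /survival_prob; case: ifP => // /YL; rewrite leqNgt Lt.
apply: eq_bigr => B _; rewrite setIC (H B).2; congr (_ * _).
have := ZP _ (measurable_pattern B).
by rewrite /pr /renewal_process /distribution /pushforward/= => ->.
Qed.

Lemma npoints_lt C : (npoints Y C < (n.+1 * K).+1)%N.
Proof.
have [B ->] : exists B : nat -> bool, npoints Y C = (\sum_(y <- iota 0 L.+1) B y)%N.
  by eexists; rewrite (@npointsE Y C L.+1)// => y /YL.
rewrite ltnS; apply: leq_trans (_ : L.+1 <= _)%N.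
  rewrite -[leqRHS](size_iota 0) -sum1_size; apply: leq_sum => y _; exact: leq_b1.
by move: LK Ln; clear; nia.
Qed.

Lemma noisy_renewal_expectation (F : nat -> R) :
  'E_Q[fun C => F (npoints Y C)]%E = (E F)%:E.
Proof.
rewrite (expectation_finite Q (measurable_npoints Y) npoints_lt) /E delayed_expect_indicators.
by congr (_%:E); apply: eq_bigr => j _; rewrite noisy_renewal_npoints.
Qed.

Lemma noisy_renewal_variance : 'V_Q[fun C => (npoints Y C)%:R : R]%E =
  (E (fun z => (z%:R - E (fun z => z%:R)) ^+ 2))%:E.
Proof.
rewrite -noisy_renewal_expectation /variance unlock.
by rewrite (noisy_renewal_expectation (fun z => z%:R)).
Qed.

End noisy_renewal_law.

(** * The limit theorem *)

Section positivity.
Context d (T : measurableType d) (R : realType) (P : probability T R).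
Variable X : {RV P >-> nat}.
Let f k : R := pr P [set w | X w = k].

Lemma law_exists_gt0 : exists k, 0 < f k.
Proof.
apply: contrapT => /forallNP H.
have f0 k : f k = 0 by apply/eqP; rewrite eq_le pr_ge0 andbT leNgt; exact/negP.
have := sum_law_cvg X; have -> : (fun n => \sum_(k < n) pr P [set w | X w = k]) = cst 0.
  by apply/funext => n; apply: big1 => k _; exact: f0.
by move=> /cvg_lim; rewrite lim_cst// => /(_ (@Rhausdorff R)) /eqP; rewrite eq_sym oner_eq0.
Qed.

Lemma aperiodic_law N : aperiodic X -> (2 <= N)%N -> exists2 k, 0 < f k & ~~ (N %| k)%N.
Proof.
move=> aX N2; apply: contrapT => H.
have mX (A : set nat) : measurable (X @^-1` A).
  by rewrite -[X in measurable X]setTI; exact: measurable_funPT.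
have f0 k : ~~ (N %| k)%N -> f k = 0.
  move=> Nk; apply/eqP; rewrite eq_le pr_ge0 andbT leNgt; apply/negP => fk.
  by apply: H; exists k.
have : P (~` [set w | (N %| X w)%N]) = 0.
  apply/negligibleP; first exact: (mX [set k | ~ (N %| k)%N]).
  pose F k := if (N %| k)%N then set0 else [set w | X w = k].
  apply: (@negligibleS _ _ _ _ (\bigcup_k F k)).
    by move=> w /= /negP/negbTE Nw; exists (X w); rewrite // /F Nw.
  apply: negligible_bigcup => k; rewrite /F; case: ifPn => [_|/f0 fk]; first exact: negligible_set0.
  apply/negligibleP; first exact: (mX [set k]).
  by have := prE P (mX [set k]); rewrite [pr _ _]fk.
rewrite probability_setC; last exact: (mX [set k | (N %| k)%N]).
have := aX N N2; set a := P _ => a1 /eqP.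
have afin : a \is a fin_num by rewrite fin_num_measure//; exact: (mX [set k | (N %| k)%N]).
by rewrite sube_eq// add0e => /eqP e; rewrite -e ltxx in a1.
Qed.

End positivity.

(** Since ln t <= t for t = a^c, one has ln a <= a^c / c; a [kap] of order a^c / (c l) with l = -ln
    rho is enough for rho^kap a <= 1. *)
Lemma log_scale {R : realType} (rho c : R) : 0 < rho < 1 -> 0 < c ->
  exists2 D : R, 0 < D & forall a : R, 1 <= a ->
    exists kap : nat, rho ^+ kap * a <= 1 /\ kap.+2%:R <= D * a `^ c.
Proof.
move=> /andP[r0 r1] c0; pose l := - ln rho.
have l0 : 0 < l by rewrite oppr_gt0 ln_lt0// r0 r1.
(* The 3 pays for the rounding up of [kap] and the two successors in [kap.+2], as a^c >= 1. *)
exists ((c * l)^-1 + 3) => [|a a1]; first by rewrite addr_gt0 ?invr_gt0 ?mulr_gt0.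
have a0 : 0 < a by exact: lt_le_trans a1.
pose t := a `^ c.
have t1 : 1 <= t by rewrite -[leLHS](powRr0 a) ler_powR// ltW.
have t0 : 0 < t by exact: lt_le_trans t1.
pose z := t / (c * l); have z0 : 0 <= z by rewrite divr_ge0 ?mulr_ge0 ?ltW.
pose kap := Num.truncn z; exists kap.+1; split; last first.
  have : kap%:R <= z by rewrite truncn_le.
  by rewrite -/t /z mulrDl -!natr1 [(c * l)^-1 * t]mulrC; lra.
have kz : z <= kap.+1%:R by rewrite ltW// truncnS_gt.
have lnt : ln a * c <= t.
  have -> : ln a * c = ln t by rewrite ln_powR mulrC.
  exact/ltW/ln_sublinear.
have -> : rho ^+ kap.+1 = expR (- (l * kap.+1%:R)).
  by rewrite /l mulNr opprK mulrC expRM_natl lnK// posrE.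
rewrite -(lnK (x := a)) ?posrE// -expRD -[leRHS]expR0 ler_expR addrC subr_le0.
apply: le_trans (_ : l * z <= _); last by rewrite ler_pM2l.
have -> : l * z = t / c by rewrite /z; field; rewrite !gt_eqF.
by rewrite ler_pdivlMr.
Qed.

(** * Choice of scales *)

Section cosine_limit.
Context {R : realType}.
Variables (a s mu : nat -> R) (E : nat -> (nat -> R) -> R) (M rho c1 c2 : R).
Hypotheses (rho01 : 0 < rho < 1) (c1_gt0 : 0 < c1) (c2_gt0 : 0 < c2)
  (a_cvg : a m @[m --> \oo] --> (+oo : set_system R))
  (s_ge : \forall m \near \oo, c1 * a m `^ c2 <= s m)
  (E_cos : forall m v kap be,
    `|E m (fun z => cos (be + v * z%:R)) - expR (- (v ^+ 2 / 2 * s m)) * cos (be + v * mu m)|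
    <= M * (`|v| ^+ 3 * (kap.+2%:R * (s m + 1) + rho ^+ kap * a m) +
            v ^+ 4 * (s m + 1) + v ^+ 2 + `|v|)).

(* [kap] of order [t m] gives [rho ^+ kap * a m <= 1], while the standard
   deviation is at least of order [t m ^+ 2]. *)
Let t m := a m `^ (c2 / 4).

Let t_large A : \forall m \near \oo, A <= t m.
Proof.
pose A' := Num.max A 0.
have /cvgryPge /(_ (A' `^ (4 / c2))) := a_cvg.
apply: filterS => m; set y := _ `^ _ => ya.
have A'0 : 0 <= A' by rewrite le_max lexx orbT.
apply: le_trans (_ : A' <= _); first by rewrite le_max lexx.
have -> : A' = y `^ (c2 / 4).
  by rewrite -powRrM (_ : 4 / c2 * (c2 / 4) = 1) ?powRr1//; field; rewrite gt_eqF.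
apply: ge0_ler_powR => //; rewrite ?nnegrE ?powR_ge0//; first by rewrite divr_ge0// ltW.
by apply: le_trans ya; rewrite powR_ge0.
Qed.

(** With |v| = |th| / sigma the dominant error |v|^3 kap sigma^2 is of order t / sigma, that is 1 /
    t because sigma >= sqrt(c1) t^2. The other terms are at most of order 1 / sigma, also O(1 /
    t). *)
Lemma normalized_cos_cvg th be :
  E m (fun z => cos (th * ((z%:R - mu m) / Num.sqrt (s m)) + be)) @[m --> \oo]
    --> expR (- (th ^+ 2 / 2)) * cos be.
Proof.
have c4 : 0 < c2 / 4 by rewrite divr_gt0.
have [D D0 HD] := log_scale rho01 c4.
pose q := (Num.sqrt c1)^-1.
pose B := `|M| * (`|th| ^+ 3 * (2 * D * q + 1) + 2 * th ^+ 4 + th ^+ 2 + `|th|).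
have a_large : \forall m \near \oo, 1 <= a m by have /cvgryPge := a_cvg; exact.
suff main : \forall m \near \oo,
    `|expR (- (th ^+ 2 / 2)) * cos be -
      E m (fun z => cos (th * ((z%:R - mu m) / Num.sqrt (s m)) + be))| <= B / t m.
  apply/cvgrPdist_le => eps eps0.
  near=> m; apply: le_trans (_ : B / t m <= _); first by near: m; exact: main.
  have t0 : 0 < t m by apply: lt_le_trans ltr01 _; near: m; exact: t_large.
  by rewrite ler_pdivrMr// mulrC -ler_pdivrMr//; near: m; exact: t_large.
near=> m.
have t1 : 1 <= t m by near: m; exact: t_large.
have t0 : 0 < t m by exact: lt_le_trans t1.
have a1 : 1 <= a m by near: m; exact: a_large.
have sm : c1 * a m `^ c2 <= s m by near: m.
have tc : q <= t m by near: m; exact: t_large.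
have rc0 : 0 < Num.sqrt c1 by rewrite sqrtr_gt0.
have q0 : 0 < q by rewrite invr_gt0.
have s4 : c1 * t m ^+ 4 <= s m.
  apply: le_trans sm; rewrite ler_pM2l// /t -powR_mulrn ?powR_ge0// -powRrM.
  by rewrite (_ : c2 / 4 * 4%:R = c2)//; field.
pose sg := Num.sqrt (s m).
have sgt : Num.sqrt c1 * t m ^+ 2 <= sg.
  have -> : Num.sqrt c1 * t m ^+ 2 = Num.sqrt (c1 * t m ^+ 4).
    rewrite sqrtrM ?(ltW c1_gt0)// (_ : t m ^+ 4 = (t m ^+ 2) ^+ 2) ?sqrtr_sqr ?ger0_norm ?sqr_ge0//.
    by rewrite -exprM.
  by rewrite ler_wsqrtr.
have ct1 : 1 <= Num.sqrt c1 * t m by rewrite mulrC -ler_pdivrMr// div1r.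
have tsg : t m <= sg.
  by apply: le_trans sgt; rewrite expr2 mulrA ler_peMl// ltW.
have sg1 : 1 <= sg by exact: le_trans tsg.
have sg0 : 0 < sg by exact: lt_le_trans sg1.
have s0 : 0 <= s m by rewrite leNgt; apply/negP => h; move: sg0; rewrite /sg ltr0_sqrtr ?ltxx.
have ssg : s m = sg ^+ 2 by rewrite sqr_sqrtr.
have [kap [ka kD]] := HD _ a1.
pose v := th / sg.
(* This phase performs the centring. *)
have := E_cos m v kap (be - v * mu m).
have -> : (fun z : nat => cos (be - v * mu m + v * z%:R)) =
    (fun z => cos (th * ((z%:R - mu m) / Num.sqrt (s m)) + be)).
  by apply/funext => z; congr cos; rewrite -/sg /v; field; rewrite gt_eqF.
rewrite subrK (_ : v ^+ 2 / 2 * s m = th ^+ 2 / 2); last first.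
  by rewrite ssg /v; field; rewrite gt_eqF.
rewrite distrC; move/le_trans; apply.
have vE : `|v| = `|th| / sg by rewrite /v normrM normfV (gtr0_norm sg0).
set Z := (X in M * X).
have ra0 : 0 <= rho ^+ kap * a m.
  by rewrite mulr_ge0 ?(le_trans ler01 a1)// exprn_ge0//; case/andP: rho01 => /ltW.
have s10 : 0 <= s m + 1 by rewrite addr_ge0.
have Z0 : 0 <= Z.
  apply: addr_ge0 (normr_ge0 _); apply: addr_ge0 (sqr_ge0 _); apply: addr_ge0.
    by rewrite mulr_ge0 ?exprn_ge0// addr_ge0// mulr_ge0 ?ler0n.
  by rewrite mulr_ge0// exprn_even_ge0.
apply: le_trans (_ : `|M| * Z <= _); first by rewrite ler_wpM2r// ler_norm.
rewrite /B -[leRHS]mulrA; apply: ler_wpM2l; first exact: normr_ge0.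
pose w := sg^-1.
have w0 : 0 < w by rewrite invr_gt0.
have wt : w <= (t m)^-1 by rewrite lef_pV2 ?posrE.
have w1 : w <= 1 by rewrite invf_le1.
have twq : t m * w <= q / t m.
  rewrite ler_pdivlMr// mulrAC ler_pdivrMr// -ler_pdivrMl ?invr_gt0// invrK.
  by rewrite -expr2.
have w2 n : w ^+ n.+1 <= (t m)^-1.
  by apply: le_trans wt; rewrite exprS ler_piMr ?(ltW w0)// exprn_ile1// ltW.
have sE : s m + 1 <= 2 * sg ^+ 2 by rewrite -ssg; have := sqrtr_ge0 (s m); rewrite -/sg ssg; nra.
rewrite /Z vE -/w; rewrite 3!(@mulrDl _ _ _ (t m)^-1); apply: lerD; last first.
  by rewrite ler_wpM2l.
apply: lerD; last first.
  by rewrite -real_normK ?num_real// vE exprMn -[th ^+ 2]real_normK ?num_real// ler_wpM2l ?exprn_ge0.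
have v4 : v ^+ 4 = th ^+ 4 * w ^+ 4 by rewrite /v exprMn.
apply: lerD; last first.
  rewrite v4; apply: le_trans (_ : th ^+ 4 * w ^+ 4 * (2 * sg ^+ 2) <= _).
    by rewrite ler_wpM2l// mulr_ge0 ?exprn_even_ge0.
  have -> : th ^+ 4 * w ^+ 4 * (2 * sg ^+ 2) = 2 * th ^+ 4 * w ^+ 2.
    by rewrite /w; field; rewrite gt_eqF.
  by rewrite ler_wpM2l// mulr_ge0 ?exprn_even_ge0.
apply: le_trans (_ : (`|th| * w) ^+ 3 * (D * t m * (2 * sg ^+ 2) + 1) <= _).
  rewrite ler_wpM2l ?exprn_ge0 ?mulr_ge0 ?(ltW w0)//; apply: lerD => //.
  by apply: ler_pM => //; rewrite ler0n.
have -> : (`|th| * w) ^+ 3 * (D * t m * (2 * sg ^+ 2) + 1) =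
    `|th| ^+ 3 * (2 * D * (t m * w) + w ^+ 3).
  by rewrite /w; field; rewrite gt_eqF.
rewrite -[leRHS]mulrA ler_wpM2l ?exprn_ge0// [leRHS]mulrDl mul1r; apply: lerD => //.
by rewrite -[leRHS]mulrA ler_wpM2l// mulr_ge0 ?ltW.
Unshelve. all: by end_near.
Qed.

End cosine_limit.

Section noisy_renewal_cosine.
Context d (T : measurableType d) (R : realType) (P : probability T R).
Variable xi : nat -> {RV P >-> nat}.
Hypotheses (xi_gt0 : forall i w, (0 < xi i w)%N) (xi1_aperiodic : aperiodic (xi 1%N))
  (xi0_E : classE (xi 0%N)) (xi1_E : classE (xi 1%N)).
Variables (p q : posnat -> R).
Hypotheses (p01 : forall x, 0 <= p x <= 1) (q01 : forall x, 0 <= q x <= 1).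

Let f := step_law xi 1.
Let f0 := step_law xi 0.
Let f_ge0 k : 0 <= f k. Proof. exact: step_law_ge0. Qed.
Let f_0 : f 0 = 0. Proof. exact: step_law0. Qed.
Let f_le1 n : \sum_(k < n) f k <= 1. Proof. exact: sum_law_le1. Qed.
Let f0_le1 n : \sum_(k < n) f0 k <= 1. Proof. exact: sum_law_le1. Qed.

(** The set where [u] is positive is additive by [renewal_seq_supermul] and contains every atom of
    the step, so aperiodicity rules out a common divisor. *)
Lemma renewal_seq_eventually_gt0 : exists n0, forall n, (n0 <= n)%N -> 0 < renewal_seq f n.
Proof.
apply: (@numerical_semigroup (fun n => 0 < renewal_seq f n)).
- by rewrite renewal_seq0.
- move=> a b ua ub; apply: lt_le_trans (renewal_seq_supermul f_ge0 a b).
  exact: mulr_gt0.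
move=> N N2; have [[|k] fk Nk] := aperiodic_law xi1_aperiodic N2; first by rewrite dvdn0 in Nk.
exists k.+1 => //; rewrite renewal_seqS; apply: lt_le_trans fk _.
rewrite big_ord_recr/= subnn renewal_seq0 mulr1 lerDr sumr_ge0// => i _.
by rewrite mulr_ge0// renewal_seq_ge0.
Qed.

Lemma noisy_renewal_cos_estimate : exists (M rho : R) (ks : nat), 0 < rho < 1 /\
  forall (Y : {fset posnat}) (L K n : nat), (forall y, observed Y y -> (y <= L)%N) ->
    (L < K)%N -> (L < n)%N -> (ks < K)%N ->
  let E := delayed_expect K (trunc_law f0 K) (trunc_law f K)
    (birth_prob q Y) (survival_prob p Y) n in
  let mu := E (fun z => z%:R) in let sig2 := E (fun z => (z%:R - mu) ^+ 2) in
  forall v kap be, `|E (fun z => cos (be + v * z%:R)) - expR (- (v ^+ 2 / 2 * sig2)) * cos (be + v * mu)|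
    <= M * (`|v| ^+ 3 * (kap.+2%:R * (sig2 + 1) + rho ^+ kap * #|` Y|%:R) +
            v ^+ 4 * (sig2 + 1) + v ^+ 2 + `|v|).
Proof.
have [x [C0 [x1 C00 f_exp]]] := classE_moment xi1_E.
have [y [Cy [y1 Cy0 f0_exp]]] := classE_moment xi0_E.
have [C [rho0 [Cp rho001 rate0]]] :=
  renewal_rate f_0 f_ge0 f_le1 x1 C00 f_exp renewal_seq_eventually_gt0.
have x0 : 0 < x by exact: lt_trans x1.
have xV : 0 < x^-1 < 1 by rewrite invr_gt0 x0 invf_lt1.
(* By Bernoulli (1 - z)^4 >= 1 - 4 z = 1/x. Enlarging [rho] to at least 1 - z thus makes rho^(-4) <=
   x, and the exponential moment of the step covers the one required. *)
pose z : R := (1 - x^-1) / 4.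
have z01 : 0 < z < 1 by rewrite /z; lra.
pose rho := Num.max rho0 (1 - z).
have rho01 : 0 < rho < 1.
  rewrite lt_max gt_max; case/andP: rho001 => -> ->/=.
  by case/andP: z01 => z0 _; rewrite gtrBl.
have r0 : 0 < rho by case/andP: rho01.
have rate n : `|renewal_seq f n.+1 - renewal_seq f n| <= C * rho ^+ n.
  apply: le_trans (rate0 n) _; rewrite ler_pM2l// lerXn2r ?nnegrE ?(ltW r0)//.
    by case/andP: rho001 => /ltW.
  by rewrite le_max lexx.
have rho4 : rho^-1 ^+ 4 <= x.
  rewrite exprVn -[leRHS]invrK lef_pV2 ?posrE ?exprn_gt0 ?invr_gt0//.
  apply: le_trans (_ : (1 - z) ^+ 4 <= _).
    by apply: le_trans (bernoulli_le _ _); rewrite /z; lra.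
  rewrite lerXn2r ?nnegrE ?(ltW r0)//; first by case/andP: z01 => _ /ltW; rewrite subr_ge0.
  by rewrite le_max lexx orbT.
have [cl cl0 [n1 u_low]] := renewal_lower f_0 f_ge0 f_le1 x1 C00 f_exp rho01 rate.
have u_cauchy := geometric_cauchy rho01 rate.
have [D D0 HD] := sqr_le_exp y1.
(* Any atom of the first step will do; it is fixed once for all observed sets. *)
have [ks fks] := law_exists_gt0 (xi 0%N).
have C1_ge0 : 0 <= C / (1 - rho).
  by rewrite divr_ge0 ?ltW// subr_gt0; case/andP: rho01.
have [M HM] := @delayed_cos_estimate R rho (C / (1 - rho)) C0 (D * Cy) (f0 ks) cl ks n1
  rho01 C1_ge0 fks cl0.
exists M, rho, ks; split => // Y L K n YL LK Ln ksK E mu sig2 v kap be.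
rewrite -(sum_observed R YL).
apply: (HM K L n (trunc_law f0 K) (trunc_law f K) (renewal_seq f)) => //.
- exact: ltnW.
- by move=> k; exact: trunc_law_ge0.
- by rewrite trunc_law_lt// (leq_ltn_trans _ LK).
- exact: sum_trunc_law.
- by move=> k; apply: trunc_law_ge0 => // j; exact: step_law_ge0.
- exact: sum_trunc_law.
- by move=> m; rewrite renewal_seq_ge0// renewal_seq_le1.
- move=> m mL; rewrite renewal_seqS; apply: eq_bigr => k _; congr (_ * _).
  by rewrite trunc_law_lt// (leq_ltn_trans _ LK)// (leq_trans (ltn_ord k)).
- apply: le_trans (f_exp K); apply: ler_sum => k _; rewrite exprM ler_wpM2l//.
    exact: trunc_law_ge0.
  by rewrite lerXn2r ?nnegrE ?exprn_ge0 ?invr_ge0 ?(ltW r0) ?(ltW x0).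
- apply: le_trans (_ : D * \sum_(k < K.+1) trunc_law f0 K k * y ^+ k <= _).
    rewrite mulr_sumr; apply: ler_sum => k _; rewrite [leRHS]mulrCA ler_wpM2l//.
    by apply: trunc_law_ge0 => // j; exact: step_law_ge0.
  by rewrite ler_wpM2l ?(ltW D0)//; exact: f0_exp.
- by rewrite trunc_law_lt.
- by move=> t; rewrite /birth_prob; case: ifP => // _; rewrite lexx ler01.
- move=> t; rewrite /survival_prob; case: ifP => [_|_]; last by rewrite lexx ler01.
  by have /andP[p0 p1] := p01 (pos_of t); rewrite subr_ge0 p1 gerBl.
- by move=> t; rewrite /birth_prob => /negbTE ->.
- by move=> t; rewrite /survival_prob => /negbTE ->.
Qed.

End noisy_renewal_cosine.

Section normalized_count.
Context d (T : measurableType d) (R : realType) (Q : probability T R).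
Variables (X : T -> nat) (J : nat).
Hypotheses (mX : forall j, measurable [set w | X w = j]) (XJ : forall w, (X w < J)%N).

Lemma law_of_finite (S : set R) (g : nat -> R) :
  Q [set w | S (g (X w))] = (\sum_(j < J) pr Q [set w | X w = j] * \1_S (g j))%:E.
Proof.
have mS : measurable [set w | S (g (X w))].
  rewrite (_ : [set w | _] = \bigcup_(j in [set j | S (g j)]) [set w | X w = j]).
    exact: bigcup_measurable.
  by apply/seteqP; split => w /=; [exists (X w)|move=> [j /= Sj ->]].
have := expectation_finite Q mX XJ (fun j => \1_S (g j)).
under [in X in _ = X%:E]eq_bigr do rewrite mulrC.
move=> <-; rewrite unlock (_ : (fun w => (\1_S (g (X w)))%:E) = (fun w => (\1_[set w | S (g (X w))] w)%:E)).
  by rewrite integral_indic// setIT.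
by apply/funext => w; rewrite !indicE; congr (nat_of_bool _)%:R%:E; apply/idP/idP; rewrite !inE.
Qed.

End normalized_count.

Theorem corollary4p3 (R : realType) (d : measure_display)
    (T : measurableType d) (P : probability T R)
    (xi : nat -> {RV P >-> nat})
    (xi_gt0 : forall i w, (0 < xi i w)%N)
    (xi_indep : mutually_independent_RV xi)
    (xi_common : forall i, (1 <= i)%N ->
      distribution P (xi i) =1 distribution P (xi 1%N))
    (xi1_aperiodic : aperiodic (xi 1%N))
    (xi0_E : classE (xi 0%N)) (xi1_E : classE (xi 1%N))
    (p q : posnat -> R)
    (p01 : forall x, 0 <= p x <= 1) (q01 : forall x, 0 <= q x <= 1)
    (Q : probability (configuration posnat) R)
    (Q_noise : bernoulli_noise (renewal_process xi) p q Q)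
    (Y : nat -> {fset posnat})
    (N := fun m (Z : configuration posnat) => (npoints (Y m) Z)%:R : R)
    (c1 c2 : R) (c1_gt0 : 0 < c1) (c2_gt0 : 0 < c2)
    (Y_cvg : #|` Y m|%:R @[m --> \oo] --> (+oo : set_system R))
    (Y_var : forall m, (1 <= m)%N ->
      ((c1 * (#|` Y m|%:R `^ c2))%:E <= 'V_Q[N m])%E)
    (x : R) :
  Q [set Z | (N m Z - fine 'E_Q[N m]) / Num.sqrt (fine 'V_Q[N m]) <= x]
      @[m --> \oo]
    --> ((Num.sqrt (2 * pi))^-1 *
          \int[lebesgue_measure]_(t in `]-oo, x]) expR (- (t ^+ 2 / 2)))%:E.
Proof.
have [M [rho [ks [rho01 cosE]]]] :=
  noisy_renewal_cos_estimate xi_gt0 xi1_aperiodic xi0_E xi1_E p01 q01.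
have [L YL] := choice (fun m => observed_bounded (Y m)).
(* Beyond [L m] for the truncation to be invisible, beyond [ks] for it to keep that atom of the
   first step. *)
pose K m := (maxn (L m) ks).+1.
have LK m : (L m < K m)%N by rewrite ltnS leq_maxl.
have ksK m : (ks < K m)%N by rewrite ltnS leq_maxr.
have Ln m : (L m < (L m).+1)%N by [].
pose E m := delayed_expect (K m) (trunc_law (step_law xi 0) (K m)) (trunc_law (step_law xi 1) (K m))
  (birth_prob q (Y m)) (survival_prob p (Y m)) (L m).+1.
pose mu m : R := E m (fun z => z%:R); pose s m : R := E m (fun z => (z%:R - mu m) ^+ 2).
have expE m F : 'E_Q[fun C => F (npoints (Y m) C)]%E = (E m F)%:E.
  exact: (noisy_renewal_expectation xi_gt0 xi_indep xi_common Q_noise (YL m) (LK m) (Ln m)).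
have muE m : fine 'E_Q[N m]%E = mu m by rewrite (expE m (fun z => z%:R)).
have varE m : 'V_Q[N m]%E = (s m)%:E.
  exact: (noisy_renewal_variance xi_gt0 xi_indep xi_common Q_noise (YL m) (LK m) (Ln m)).
have s_ge : \forall m \near \oo, c1 * #|` Y m|%:R `^ c2 <= s m.
  by exists 1%N => // m /= m1; have := Y_var m m1; rewrite varE lee_fin.
pose J m := ((L m).+2 * K m).+1.
have NJ m C : (npoints (Y m) C < J m)%N.
  exact: (npoints_lt (YL m) (LK m) (Ln m)).
pose w m j : R := pr Q [set C | npoints (Y m) C = j].
pose W m j : R := (j%:R - mu m) / Num.sqrt (s m).
have sumE m (F : nat -> R) : \sum_(j < J m) w m j * F j = E m F.
  apply/EFin_inj; rewrite -expE (expectation_finite Q (measurable_npoints (Y m)) (NJ m) F).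
  by congr (_%:E); apply: eq_bigr => j _; rewrite mulrC.
(* For the finitely many other [m] the quotient may involve a division by 0. *)
have s_gt0 : \forall m \near \oo, 0 < s m.
  have /cvgryPge/(_ 1) := Y_cvg; apply: filterS2 s_ge => m sm a1.
  by apply: lt_le_trans sm; rewrite mulr_gt0// powR_gt0// (lt_le_trans ltr01).
have main : \sum_(j < J m) w m j * \1_`]-oo, x] (W m j) @[m --> \oo] --> gauss_expect \1_`]-oo, x].
  apply: finite_laws_cvg_normal.
  - by move=> m j; exact: pr_ge0.
  - move=> m; under eq_bigr do rewrite -[w _ _]mulr1.
    rewrite (sumE m (fun=> 1)); apply/EFin_inj.
    by rewrite -(expE m (fun=> 1)) expectation_cst.
  (* Once the variance is positive, the normalized count has second moment exactly 1. *)
  - apply: filterS s_gt0 => m sm; rewrite le_eqVlt; apply/orP; left; apply/eqP.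
    transitivity ((\sum_(j < J m) w m j * (j%:R - mu m) ^+ 2) / s m).
      rewrite mulr_suml; apply: eq_bigr => j _.
      by rewrite /W expr_div_n sqr_sqrtr ?mulrA// ltW.
    by rewrite (sumE m (fun z => (z%:R - mu m) ^+ 2)) divff// gt_eqF.
  - move=> th be; under eq_fun do rewrite (sumE _ (fun z => cos (th * W _ z + be))).
    apply: (normalized_cos_cvg rho01 c1_gt0 c2_gt0 Y_cvg s_ge) => m v kap be'.
    exact: (cosE _ _ _ _ (YL m) (LK m) (Ln m) (ksK m)).
rewrite gauss_expect_indic in main.
rewrite (_ : (fun m => _) = (fun m => (\sum_(j < J m) w m j * \1_`]-oo, x] (W m j))%:E)).
  by apply/fine_cvgP; split => //; exact: nearW.
apply/funext => m; rewrite muE varE/= -(law_of_finite Q (measurable_npoints (Y m)) (NJ m)).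
congr (Q _); apply/seteqP; split => Z /=; by rewrite in_itv.
Qed.
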